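(* Let $\mathbf{\Xi}=\mathbf{\Lambda}\cup\mathbf{\Gamma}_\times\cup\mathbf{\Gamma}_x$, where $$\mathbf{\Lambda}=\{\Lambda\subset\mathbb{R}^2 \mid \Lambda\text{ a lattice}\},\qquad \mathbf{\Gamma}_\times=\{\Gamma_1\times\Gamma_2 \mid \Gamma_1,\Gamma_2\subset\mathbb{R}\text{ periodic configurations}\},$$ $$\mathbf{\Gamma}_x=\{\Lambda\cup(\Lambda+x) \mid \Lambda=a\mathbb{Z}\times a^{-1}\mathbb{Z}\text{ for some }a>0,\text{ or }\Lambda=\Lambda_2;\ x\in\mathbb{R}^2\}.$$ For any fixed $\alpha>0$ and any fixed density $\rho>0$, the hexagonal lattice $\rho^{-1/2}\Lambda_2$ is the unique minimizer, up to orthogonal transformations, of the energy among configurations from $\mathbf{\Xi}$ scaled to density $\rho$: if $\Gamma=c\,\Gamma'$ with $c>0$, $\Gamma'\in\mathbf{\Xi}$, and $\Gamma$ has density $\rho$, then $$E_{\phi_\alpha}(\rho^{-1/2}\Lambda_2)\le E_{\phi_\alpha}(\Gamma),$$ with equality only if $\Gamma=\mathcal{Q}\,\rho^{-1/2}\Lambda_2$ for some orthogonal matrix $\mathcal{Q}$. In other words, the hexagonal lattice is universally optimal in $\mathbf{\Xi}$.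
   Context: For $\alpha>0$ let $\phi_\alpha(r)=e^{-\alpha r^2}$, $r\ge 0$. Lattices are always full-rank. A periodic configuration in $\mathbb{R}^d$ is a set $\Gamma=\bigcup_{j=1}^J(\Lambda+x_j)$ with $\Lambda\subset\mathbb{R}^d$ a lattice, $J\geq 1$, and $x_j-x_k\notin\Lambda$ for $j\neq k$. Its density is $J/\mathrm{vol}(\mathbb{R}^d/\Lambda)$. Its energy is $$E_{\phi_\alpha}(\Gamma)=\frac1J\sum_{j,k=1}^J\ \sum_{\substack{\lambda\in\Lambda\\ \lambda+x_j-x_k\neq 0}}\phi_\alpha(|\lambda+x_j-x_k|),$$ which does not depend on the chosen representation of $\Gamma$. Configurations differing only by an orthogonal transformation have the same energy and are identified. The hexagonal lattice (density $1$) is $$\Lambda_2=\sqrt{\tfrac{2}{\sqrt3}}\begin{pmatrix}1&\tfrac12\\0&\tfrac{\sqrt3}{2}\end{pmatrix}\mathbb{Z}^2 .$$ *)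

(* Defs.v *)
From HB Require Import structures.
From mathcomp Require Import all_boot all_order all_algebra.
From mathcomp Require Import all_classical all_reals all_analysis.

Set Implicit Arguments.
Unset Strict Implicit.
Unset Printing Implicit Defensive.

Import Order.TTheory GRing.Theory Num.Theory.

Local Open Scope classical_set_scope.
Local Open Scope ring_scope.

(* The norm `|v| that the libraries put on matrices is the sup norm, hence an
   explicit Euclidean norm. *)
Definition eucl_norm (R : realType) (d : nat) (v : 'cV[R]_d) : R :=
  Num.sqrt (\sum_(i < d) v i 0 ^+ 2).

Definition orthogonal_mx (R : realType) (d : nat) (Q : 'M[R]_d) : Prop :=
  Q^T *m Q = 1%:M.

Definition translate (R : realType) (d : nat) (x : 'cV[R]_d)
  (A : set 'cV[R]_d) : set 'cV[R]_d := [set v + x | v in A].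

Definition dilate (R : realType) (d : nat) (c : R)
  (A : set 'cV[R]_d) : set 'cV[R]_d := [set c *: v | v in A].

(* B Z^d, for the columns of B *)
Definition lattice_of (R : realType) (d : nat) (B : 'M[R]_d) :
  set 'cV[R]_d := range (fun z : 'cV[int]_d => B *m map_mx intr z).

Definition is_lattice (R : realType) (d : nat) (L : set 'cV[R]_d) : Prop :=
  exists2 B : 'M[R]_d, B \in unitmx & L = lattice_of B.

(* A periodic configuration together with a representation of it; the
   configuration itself is the set [points G] below. *)
Record periodic_conf (R : realType) (d : nat) := PeriodicConf {
  basis : 'M[R]_d;
  ncosets : nat;
  shift : 'I_ncosets -> 'cV[R]_d;
  basis_unit : basis \in unitmx;
  ncosets_gt0 : (0 < ncosets)%N;
  shift_distinct : forall j k : 'I_ncosets, j != k ->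
    ~ lattice_of basis (shift j - shift k) }.

Definition points (R : realType) (d : nat) (G : periodic_conf R d) :
  set 'cV[R]_d :=
  \bigcup_(j in [set: 'I_(ncosets G)])
    translate (shift j) (lattice_of (basis G)).

(* vol (R^d / B Z^d) = |det B| *)
Definition density (R : realType) (d : nat) (G : periodic_conf R d) : R :=
  (ncosets G)%:R / `|\det (basis G)|.

(* [esum] is the supremum of the finite partial sums, so this is meaningful
   for potentials f with nonnegative values only. *)
Definition energy (R : realType) (d : nat) (f : R -> R)
  (G : periodic_conf R d) : \bar R :=
  (((ncosets G)%:R^-1)%:E *
   \sum_(j < ncosets G) \sum_(k < ncosets G)
     \esum_(l in [set l | lattice_of (basis G) l
                          /\ (l + shift j - shift k)%R <> 0%R])
       (f (eucl_norm (l + shift j - shift k)%R))%:E)%E.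

Definition gaussian (R : realType) (alpha r : R) : R :=
  expR (- (alpha * r ^+ 2)).

Lemma lattice_ofZ (R : realType) (d : nat) (c : R) (B : 'M[R]_d) :
  lattice_of (c *: B) = dilate c (lattice_of B).
Proof.
apply/seteqP; split=> [_ [z _ <-]|_ [_ [z _ <-] <-]].
  by exists (B *m map_mx intr z); [exists z | rewrite scalemxAl].
by exists z => //; rewrite scalemxAl.
Qed.

Lemma ord1_distinct (R : realType) (d : nat) (B : 'M[R]_d)
  (x : 'I_1 -> 'cV[R]_d) (j k : 'I_1) :
  j != k -> ~ lattice_of B (x j - x k).
Proof. by rewrite !ord1 eqxx. Qed.

Definition lattice_conf (R : realType) (d : nat) (B : 'M[R]_d)
  (B_unit : B \in unitmx) : periodic_conf R d :=
  PeriodicConf B_unit (ltn0Sn 0) (@ord1_distinct R d B (fun=> 0)).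

Lemma points_lattice_conf (R : realType) (d : nat) (B : 'M[R]_d)
  (B_unit : B \in unitmx) : points (lattice_conf B_unit) = lattice_of B.
Proof.
apply/seteqP; split=> [_ [j _ [v Bv <-]]|v Bv]; first by rewrite /= addr0.
by exists ord0 => //; exists v; rewrite //= addr0.
Qed.

Definition hexagonal_basis (R : realType) : 'M[R]_2 :=
  Num.sqrt (2 / Num.sqrt 3) *:
  (block_mx 1%:M (2^-1)%:M 0 (Num.sqrt 3 / 2)%:M : 'M[R]_(1 + 1)).

Definition hexagonal_lattice (R : realType) : set 'cV[R]_2 :=
  lattice_of (hexagonal_basis R).
Arguments hexagonal_lattice R : clear implicits.

Lemma hexagonal_basis_unit (R : realType) (rho : R) :
  0 < rho -> (Num.sqrt rho)^-1 *: hexagonal_basis R \in unitmx.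
Proof.
move=> rho_gt0; rewrite /hexagonal_basis unitmxE !detZ.
rewrite (@det_ublock _ 1 1) !det_scalar unitfE gt_eqF //.
by rewrite !(mulr_gt0, exprn_gt0, invr_gt0, divr_gt0, sqrtr_gt0).
Qed.

(* rho^(-1/2) Lambda_2, see [points_hexagonal_conf] *)
Definition hexagonal_conf (R : realType) (rho : R) (rho_gt0 : 0 < rho) :
  periodic_conf R 2 := lattice_conf (hexagonal_basis_unit rho_gt0).

Lemma points_hexagonal_conf (R : realType) (rho : R) (rho_gt0 : 0 < rho) :
  points (hexagonal_conf rho_gt0) =
  dilate (Num.sqrt rho)^-1 (hexagonal_lattice R).
Proof. by rewrite points_lattice_conf lattice_ofZ. Qed.

(* a Z x a^-1 Z *)
Definition rectangular_lattice (R : realType) (a : R) : set 'cV[R]_2 :=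
  lattice_of (block_mx a%:M 0 0 (a^-1)%:M : 'M[R]_(1 + 1)).

Definition lattices2 (R : realType) : set (set 'cV[R]_2) :=
  [set A | is_lattice A].
Arguments lattices2 R : clear implicits.

Definition products2 (R : realType) : set (set 'cV[R]_2) :=
  [set A | exists G1 G2 : periodic_conf R 1,
    A = [set (col_mx u v : 'cV[R]_(1 + 1)) | u in points G1 & v in points G2]].
Arguments products2 R : clear implicits.

Definition doubled2 (R : realType) : set (set 'cV[R]_2) :=
  [set A | exists (L : set 'cV[R]_2) (x : 'cV[R]_2),
    ((exists2 a : R, 0 < a & L = rectangular_lattice a)
      \/ L = hexagonal_lattice R)
    /\ A = L `|` translate x L].
Arguments doubled2 R : clear implicits.

Definition Xi (R : realType) : set (set 'cV[R]_2) :=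
  lattices2 R `|` products2 R `|` doubled2 R.
Arguments Xi R : clear implicits.

Definition scaled_Xi (R : realType) (rho : R) : set (periodic_conf R 2) :=
  [set G | density G = rho /\
    exists (c : R) (A : set 'cV[R]_2),
      [/\ 0 < c, Xi R A & points G = dilate c A]].

(* Main.v *)
Require Import Defs.
From HB Require Import structures.
From mathcomp Require Import all_boot all_order all_algebra.
From mathcomp Require Import all_classical all_reals all_analysis.
From mathcomp Require Import ring lra zify.

(** Adding the self-term, the energy of a configuration is a theta function;
    by a Gaussian-weighted count (Poisson summation as the weight flattens) the
    density and the energy can be read off any representation of it as finitely
    many cosets.  Each family is then a statement about Gaussian sums.
    - Lattices: after Gauss reduction of the form this is Montgomery's theorem.
      By Poisson duality the form may be taken of large discriminant; a form
      far from hexagonal has a minimum short enough to win alone, and otherwise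
      one averages over the rotation of order three and uses convexity of exp
      on each orbit.
    - Products: the energy is a product of two one-dimensional energies.  On the
      line, dense configurations are bounded through their Fourier side with a
      Fejer kernel, sparse ones by ordering the points and the tangent bound
      [exp (- s (x^2 - 1)) >= 1 - 2 s (x - 1)], valid for [s >= 13/10].
    - Doubled rectangular lattices: the one-dimensional sum is smallest at the
      half period, so the centred rectangular lattice is the worst competitor.
    - Doubled hexagonal lattices: for large parameters the three lattice points
      around the shift suffice, for small ones the first Fourier modes. *)

Set Implicit Arguments.
Unset Strict Implicit.
Unset Printing Implicit Defensive.

Import Order.TTheory GRing.Theory Num.Theory.
Import numFieldNormedType.Exports.

Local Open Scope classical_set_scope.
Local Open Scope ring_scope.

(** Equality is the delicate point. The hexagonal lattice recurs among the lattices, and also among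
    the doubled rectangular lattices shifted by half a period in both directions, which are centred
    rectangular lattices. Such cases are sent back to the lattice case; every other comparison is
    proved strict. Everything of density rho is measured against one parameter X, for which the
    hexagonal form is X (m^2 + m n + n^2). Duality sends X to (4/3) pi^2 / X, with fixed point 2 pi
    / sqrt 3, about 3.63, so the weak bound pi >= 3.1 already yields X >= 7/2 on one of the two
    sides. The hexagonal sum is then at most 1 + 6.05 exp (- X): six shortest vectors and a small
    remainder. Most numerical constants serve to beat 6.05. The constant 13/10 lies just above the
    root 1.2565 of exp s = 1 + 2 s, which is the tangent bound at x = 0. Poisson summation is
    obtained without Fourier analysis, as a limit of an exact identity between cosine powers and
    binomial coefficients. As sums are suprema of finite partial sums, signed series are always
    handled together with a companion that makes their terms nonnegative. *)

Definition hasum (R : realType) (T : choiceType) (D : set T) (f : T -> R)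
    (S : R) : Prop :=
  (forall i, D i -> 0 <= f i) /\ \esum_(i in D) (f i)%:E = S%:E.

(** * Unordered sums of nonnegative terms with a finite value *)

Section HasSum.
Variable R : realType.
Implicit Types (T U : choiceType).

Lemma hasum_uniq T (D : set T) (f : T -> R) S S' :
  hasum D f S -> hasum D f S' -> S = S'.
Proof. by move=> [_ h] [_]; rewrite h => -[]. Qed.

Lemma hasum_eq T (D : set T) (f : T -> R) S S' :
  S = S' -> hasum D f S -> hasum D f S'.
Proof. by move=> ->. Qed.

Lemma hasum_ge0 T (D : set T) (f : T -> R) S : hasum D f S -> 0 <= S.
Proof. by move=> [f0 h]; rewrite -lee_fin -h esum_ge0. Qed.

Lemma hasum_ext T (D : set T) (f g : T -> R) S :
  (forall i, D i -> f i = g i) -> hasum D f S -> hasum D g S.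
Proof.
move=> fg [f0 h]; split=> [i Di|]; first by rewrite -fg// f0.
by rewrite -h; apply: eq_esum => i Di; rewrite fg.
Qed.

Lemma hasum_le T (D : set T) (f g : T -> R) F G :
  (forall i, D i -> f i <= g i) -> hasum D f F -> hasum D g G -> F <= G.
Proof.
move=> fg [f0 hf] [g0 hg]; rewrite -lee_fin -hf -hg.
by apply: le_esum => i Di; rewrite lee_fin fg.
Qed.

Lemma hasum_cmp T (D : set T) (f g : T -> R) G :
  (forall i, D i -> 0 <= f i <= g i) -> hasum D g G -> exists F, hasum D f F.
Proof.
move=> fg [g0 hg].
have h0 : (0 <= \esum_(i in D) (f i)%:E)%E.
  by apply: esum_ge0 => i /fg/andP[]; rewrite lee_fin.
have h1 : (\esum_(i in D) (f i)%:E <= G%:E)%E.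
  by rewrite -hg; apply: le_esum => i /fg/andP[_]; rewrite lee_fin.
exists (fine (\esum_(i in D) (f i)%:E)); split; first by move=> i /fg/andP[].
by rewrite fineK// ge0_fin_numE// (le_lt_trans h1)// ltry.
Qed.

Lemma hasumD T (D : set T) (f g : T -> R) F G :
  hasum D f F -> hasum D g G -> hasum D (fun i => f i + g i) (F + G).
Proof.
move=> [f0 hf] [g0 hg]; split; first by move=> i Di; rewrite addr_ge0 ?f0 ?g0.
under eq_esum do rewrite EFinD.
by rewrite esumD ?hf ?hg// => i Di; rewrite lee_fin ?f0 ?g0.
Qed.

(** Termwise domination keeps the differences nonnegative. Sums with signed cosine weights are later
    produced in this way. *)
Lemma hasumB T (D : set T) (f g : T -> R) F G :
  (forall i, D i -> g i <= f i) -> hasum D f F -> hasum D g G ->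
  hasum D (fun i => f i - g i) (F - G).
Proof.
move=> fg hf hg.
have fg0 i : D i -> 0 <= f i - g i <= f i.
  by move=> Di; rewrite subr_ge0 fg//= gerBl; apply: hg.1.
have [H hH] := hasum_cmp fg0 hf.
have h : hasum D f (H + G).
  by have := hasumD hH hg; apply: hasum_ext => i _; rewrite subrK.
by rewrite (hasum_uniq hf h) addrK.
Qed.

Lemma hasumZ T (D : set T) (c : R) (f : T -> R) F : 0 <= c ->
  hasum D f F -> hasum D (fun i => c * f i) (c * F).
Proof.
move=> c0 [f0 hf]; split; first by move=> i Di; rewrite mulr_ge0 ?f0.
move: c0; rewrite le_eqVlt => /orP[/eqP <-|c0].
  by rewrite mul0r esum1// => i _; rewrite mul0r.
(* The supremum is scaled in one direction only; the reverse inequality is the same statement for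
   [c^-1] and the scaled terms. *)
have key (k : R) (h : T -> R) (H : R) : 0 < k -> (\esum_(i in D) (h i)%:E <= H%:E)%E ->
    (\esum_(i in D) (k * h i)%:E <= (k * H)%:E)%E.
  move=> k0 hH; rewrite ge_ereal_sup//= => _ [X [fX XD] <-].
  rewrite fsbig_finite//= sumEFin lee_fin -mulr_sumr ler_pM2l// -lee_fin.
  apply: le_trans hH.
  by rewrite esum_ge//; exists X => //; rewrite fsbig_finite//= sumEFin.
have h1 := key _ _ _ c0 (eq_ind_r (fun z => (z <= F%:E)%E) (lexx _) hf).
have h0 : (0 <= \esum_(i in D) (c * f i)%:E)%E.
  by apply: esum_ge0 => i Di; rewrite lee_fin mulr_ge0 ?f0// ltW.
have hfin : (\esum_(i in D) (c * f i)%:E)%E \is a fin_num.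
  by rewrite ge0_fin_numE// (le_lt_trans h1)// ltry.
move: h1 h0; rewrite -(fineK hfin); set S := fine _ => h1 _.
have := key c^-1 (fun i => c * f i) S.
rewrite invr_gt0 c0 -(fineK hfin) -/S lexx => /(_ isT isT).
under eq_esum do rewrite mulrA mulVf ?gt_eqF// mul1r.
rewrite hf !lee_fin ler_pdivlMl// in h1 * => h2.
by congr (_%:E); apply/eqP; rewrite eq_le h1 h2.
Qed.

Lemma hasum_bij T U (P : set T) (Q : set U) (e : T -> U) (f : U -> R) S :
  set_bij P Q e -> hasum Q f S <-> hasum P (fun i => f (e i)) S.
Proof.
move=> he; rewrite /hasum (reindex_esum P Q e _ he); split=> -[f0 ->]; split=> //.
  by case: he => h _ _ i /h /f0.
by case: he => _ _ h j /h [i /f0 + <-].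
Qed.

Lemma hasum_pair T U (I : set T) (J : T -> set U) (f : T -> U -> R)
    (g : T -> R) S :
  (forall i, I i -> hasum (J i) (f i) (g i)) ->
  hasum I g S <-> hasum (I `*`` J) (fun k => f k.1 k.2) S.
Proof.
move=> hf.
have E : \esum_(k in I `*`` J) (f k.1 k.2)%:E = \esum_(i in I) (g i)%:E.
  rewrite -(@esum_esum _ _ _ I J (fun i j => (f i j)%:E)); last first.
    by move=> i j Ii Jj; rewrite lee_fin; apply: (hf i Ii).1.
  by apply: eq_esum => i Ii; exact: (hf i Ii).2.
split=> -[h0 h1]; split=> //.
- by move=> [i j] [Ii Jj]; apply: (hf i Ii).1.
- by rewrite E.
- by move=> i Ii; apply: hasum_ge0 (hf i Ii).
- by rewrite -E.
Qed.

Lemma hasum_seq T (r : seq T) (f : T -> R) : uniq r ->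
  (forall i, i \in r -> 0 <= f i) -> hasum [set` r] f (\sum_(i <- r) f i).
Proof.
move=> ur f0; split=> //.
rewrite -sumEFin (fsbig_seq _ _ ur).
rewrite -esum_fset; last 2 first.
- exact: finite_seq.
- by move=> i; rewrite inE/= => /f0; rewrite lee_fin.
by congr esum; apply/seteqP; split=> i /=; rewrite inE.
Qed.

Lemma hasum_subset T (D E : set T) (f : T -> R) S : D `<=` E ->
  (forall i, E i -> ~ D i -> f i = 0) -> hasum D f S <-> hasum E f S.
Proof.
move=> DE f0.
have e : \esum_(i in D) (f i)%:E = \esum_(i in E) (f i)%:E.
  rewrite esum_mkcond [RHS]esum_mkcond; apply: eq_esum => i _.
  have [/set_mem iE|iE] := boolP (i \in E).
    case: ifPn => // /negP; rewrite inE => iD; by rewrite f0.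
  by rewrite ifN//; apply: contra iE; rewrite !inE; exact: DE.
rewrite /hasum e; split=> -[h0 h]; split=> // i; last by move=> /DE/h0.
by move=> Ei; have [Di|Di] := pselect (D i); [exact: h0|rewrite f0].
Qed.

Lemma hasum_ge_sub T (D E : set T) (f : T -> R) S S' : D `<=` E ->
  hasum D f S -> hasum E f S' -> S <= S'.
Proof.
move=> DE hS [h0 h1]; have [f0 h2] := hS; rewrite -lee_fin -h1 -h2.
rewrite esum_mkcond [leRHS]esum_mkcond; apply: le_esum => i _.
case: ifPn => [/set_mem/DE/mem_set -> //|_].
by case: ifPn => // /set_mem/h0; rewrite lee_fin.
Qed.

Lemma hasum_ge_seq T (D : set T) (r : seq T) (f : T -> R) S : uniq r ->
  (forall i, i \in r -> D i) -> hasum D f S -> \sum_(i <- r) f i <= S.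
Proof.
move=> ur rD hS; have [f0 _] := hS.
apply: hasum_ge_sub (hasum_seq ur _) hS => //.
by move=> i /rD; exact: f0.
Qed.

Lemma hasum_split T (D : set T) (r : seq T) (f : T -> R) S : uniq r ->
  (forall i, i \in r -> D i) ->
  hasum D f S <-> hasum (D `\` [set` r]) f (S - \sum_(i <- r) f i) /\
                  (forall i, i \in r -> 0 <= f i).
Proof.
move=> ur rD; split=> [hS|[h f0]].
  split; last by move=> i /rD; apply: hS.1.
  pose g i := if i \in r then f i else 0.
  have hg : hasum D g (\sum_(i <- r) f i).
    apply/(@hasum_subset _ [set` r]) => //.
      by move=> i _ /negP; rewrite /g/= => /negbTE ->.
    have : hasum [set` r] f (\sum_(i <- r) f i).
      by apply: hasum_seq => // i /rD; apply: hS.1.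
    by apply: hasum_ext => i /= ir; rewrite /g ir.
  have gle i : D i -> g i <= f i.
    by move=> Di; rewrite /g; case: ifP => // _; apply: hS.1.
  apply: (@hasum_ext _ _ (fun i => f i - g i)).
    by move=> i [Di /negP ir]; rewrite /g ifN ?subr0.
  apply/(@hasum_subset _ (D `\` [set` r]) D); last exact: hasumB hS hg.
    by move=> i [].
  move=> i Di; rewrite /g; case: ifPn => [ir _|]; first by rewrite subrr.
  by move=> /negP ir []; split.
pose g i := if i \in r then f i else 0.
pose k i := if i \in r then 0 else f i.
have hg : hasum D g (\sum_(i <- r) f i).
  apply/(@hasum_subset _ [set` r]) => //.
    by move=> i _ /negP; rewrite /g/= => /negbTE ->.
  have : hasum [set` r] f (\sum_(i <- r) f i) by exact: hasum_seq.
  by apply: hasum_ext => i /= ir; rewrite /g ir.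
have hk : hasum D k (S - \sum_(i <- r) f i).
  apply/(@hasum_subset _ (D `\` [set` r])).
  - by move=> i [].
  - by move=> i Di; rewrite /k; case: ifPn => // /negP ir []; split.
  - by apply: (hasum_ext _ h) => i [_ /negP ir]; rewrite /k ifN.
have := hasumD hg hk; rewrite addrC subrK; move=> hgk; apply: (hasum_ext _ hgk) => i Di.
by rewrite /g /k; case: ifP; rewrite ?addr0 ?add0r.
Qed.

Lemma hasum_lt T (D : set T) (f g : T -> R) F G i0 :
  (forall i, D i -> f i <= g i) -> D i0 -> f i0 < g i0 ->
  hasum D f F -> hasum D g G -> F < G.
Proof.
move=> fg Di0 lt0 hf hg; have h := hasumB fg hg hf.
rewrite -subr_gt0; apply: (@lt_le_trans _ _ (\sum_(i <- [:: i0]) (g i - f i))).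
  by rewrite big_seq1 subr_gt0.
by apply: hasum_ge_seq h => // i; rewrite inE => /eqP ->.
Qed.

Lemma hasum_approx T (D : set T) (f : T -> R) S (e : R) : 0 < e ->
  hasum D f S -> exists r : seq T, [/\ uniq r, (forall i, i \in r -> D i)
    & S - e < \sum_(i <- r) f i].
Proof.
move=> e0 [f0 h].
have : ((S - e)%:E < \esum_(i in D) (f i)%:E)%E.
  by rewrite h lte_fin ltrBlDr ltrDl.
move=> /ereal_sup_gt[_ [X [fX XD] <-]].
rewrite fsbig_finite//= sumEFin lte_fin => lt.
exists (finmap.enum_fset (fset_set X)); split=> //.
by move=> i; rewrite in_fset_set// inE; exact: XD.
Qed.

Lemma hasum_big T (I : Type) (r : seq I) (D : set T) (f : I -> T -> R)
    (S : I -> R) :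
  (forall i, hasum D (f i) (S i)) ->
  hasum D (fun t => \sum_(i <- r) f i t) (\sum_(i <- r) S i).
Proof.
move=> h; elim: r => [|i r IH].
  rewrite big_nil; split; first by move=> t _; rewrite big_nil.
  by rewrite esum1// => t _; rewrite big_nil.
by rewrite big_cons; apply: hasum_ext (hasumD (h i) IH) => t _; rewrite big_cons.
Qed.

Lemma hasum_fin (T : finType) (f : T -> R) : (forall i, 0 <= f i) ->
  hasum [set: T] f (\sum_i f i).
Proof.
move=> f0; rewrite -big_enum/=.
have -> : [set: T] = [set` enum T].
  by apply/seteqP; split=> // i _ /=; rewrite mem_enum.
by apply: hasum_seq => //; exact: enum_uniq.
Qed.

(** Dominated convergence for series. Finitely many terms carry all of [G] but [e / 3]; on them
    convergence is termwise, and the tails of [F n] and [H] both lie below the tail of [G]. *)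
Lemma tannery T (D : set T) (f : nat -> T -> R) (F : nat -> R) (h g : T -> R)
    (H G : R) :
  (forall n, hasum D (f n) (F n)) -> hasum D h H -> hasum D g G ->
  (forall n i, D i -> f n i <= g i) ->
  (forall i, D i -> (fun n => f n i) @ \oo --> h i) ->
  F @ \oo --> H.
Proof.
move=> hf hh hg fg cv.
have hleg i : D i -> h i <= g i.
  move=> Di; have : \forall n \near \oo, f n i <= g i by apply: nearW => n; exact: fg.
  by move: (cv i Di) => /cvg_lim <- //; apply: limr_le; apply/cvg_ex; exists (h i); exact: cv.
apply/cvgrPdist_lt => e e0.
have e3 : 0 < e / 3 by rewrite divr_gt0.
have [r [ur rD hr]] := hasum_approx e3 hg.
have cvr : (fun n => \sum_(i <- r) f n i) @ \oo --> \sum_(i <- r) h i.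
  rewrite big_seq; under eq_fun do rewrite big_seq.
  apply: (@cvg_big _ _ +%R 0) => //; first exact: add_continuous.
  by move=> i ir; apply: cv; exact: rD.
have [gr _] := (hasum_split g G ur rD).1 hg.
have [hr' _] := (hasum_split h H ur rD).1 hh.
move/cvgrPdist_lt : cvr => /(_ _ e3); apply: filterS => n hn.
have [fr _] := (hasum_split (f n) (F n) ur rD).1 (hf n).
have a1 : F n - \sum_(i <- r) f n i <= G - \sum_(i <- r) g i.
  by apply: hasum_le fr gr => i [Di _]; exact: fg.
have a2 : H - \sum_(i <- r) h i <= G - \sum_(i <- r) g i.
  by apply: hasum_le hr' gr => i [Di _]; exact: hleg.
have a3 := hasum_ge0 fr; have a4 := hasum_ge0 hr'.
move: hn; rewrite !ltr_norml => /andP[b1 b2]; apply/andP; split; lra.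
Qed.

End HasSum.

(** * Cosine sums over arithmetic progressions, and powers of the cosine *)

Section TrigSums.
Variable R : realType.
Implicit Types (x y t : R) (m l p : nat).

Lemma cosD2piz x (z : int) : cos (x + 2 * pi * z%:~R) = cos x.
Proof.
have P n y : cos (y + 2 * pi * n%:R) = cos y.
  rewrite -[RHS](periodicn (@cosD2pi R) n); congr cos; congr (_ + _).
  by rewrite -[RHS]mulr_natr -[pi *+ 2]mulr_natl.
case: z => n; first by rewrite -pmulrn P.
by rewrite -[LHS](P n.+1) NegzE mulrNz -pmulrn; congr cos; ring.
Qed.

Lemma cos2piz (z : int) : cos (2 * pi * z%:~R) = 1 :> R.
Proof. by rewrite -[X in cos X]add0r cosD2piz cos0. Qed.

Lemma sinD2piz x (z : int) : sin (x + 2 * pi * z%:~R) = sin x.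
Proof. by rewrite -!cosBpihalf addrAC cosD2piz. Qed.

Lemma sin_piD x : sin (x + pi) = - sin x. Proof. exact: sinDpi. Qed.

Lemma sin_piz (z : int) : sin (pi * z%:~R) = 0 :> R.
Proof.
have P n : sin (pi * n%:R) = 0 :> R.
  elim: n => [|n IH]; first by rewrite mulr0 sin0.
  by rewrite -natr1 mulrDr mulr1 sin_piD IH oppr0.
case: z => n; first by rewrite -pmulrn P.
by rewrite NegzE mulrNz -pmulrn mulrN sinN P oppr0.
Qed.

Lemma sin_pi_eq0 x : sin (pi * x) = 0 -> exists z : int, x = z%:~R.
Proof.
move=> sx; have /andP[fx gx] := floor_itv x.
have h : sin (pi * (x - (Num.floor x)%:~R)) = 0.
  by rewrite mulrBr sinB sx sin_piz mul0r mulr0 subrr.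
exists (Num.floor x); apply/eqP/negP => /negP xf.
have : 0 < sin (pi * (x - (Num.floor x)%:~R)).
  have f0 : 0 < x - (Num.floor x)%:~R by rewrite subr_gt0 lt_neqAle eq_sym xf.
  apply: sin_gt0_pi; rewrite mulr_gt0 ?pi_gt0//= -[ltRHS]mulr1 ltr_pM2l ?pi_gt0//.
  by rewrite ltrBlDr addrC -(intrD _ _ 1).
by rewrite h ltxx.
Qed.

(** The factor [2 * sin h] makes the sum telescope, by the product-to-sum formula. *)
Lemma sum_cos_arith x h n :
  2 * sin h * (\sum_(j < n) cos (x + 2 * h * j%:R)) =
  sin (x - h + 2 * h * n%:R) - sin (x - h).
Proof.
elim: n => [|n IH]; first by rewrite big_ord0 !mulr0 addr0 subrr.
rewrite big_ord_recr/= mulrDr IH.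
have -> : x - h + 2 * h * n.+1%:R = (x + 2 * h * n%:R) + h.
  by rewrite -natr1; ring.
have -> : x - h + 2 * h * n%:R = (x + 2 * h * n%:R) - h by ring.
set A := x + 2 * h * n%:R; rewrite (sinB A) (sinD A); ring.
Qed.

(** Orthogonality of characters modulo [l]. If [l] does not divide [i], the telescoped ends differ
    by a multiple of 2 pi while sin (pi i / l) is not zero. *)
Lemma sum_cos_roots x l (i : int) : (0 < l)%N ->
  \sum_(j < l) cos (2 * pi * i%:~R * (x + j%:R) / l%:R) =
  if (l %| i)%Z then l%:R * cos (2 * pi * i%:~R * x / l%:R) else 0.
Proof.
move=> l0; have lR : l%:R != 0 :> R by rewrite pnatr_eq0 -lt0n.
case: ifPn => [/dvdzP[k ->]|li].
  transitivity (\sum_(j < l) cos (2 * pi * (k * l)%:~R * x / l%:R)).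
    apply: eq_bigr => j _; rewrite -[RHS](cosD2piz _ (k * j)); congr cos.
    rewrite !intrM -!pmulrn; field; by rewrite lR.
  by rewrite sumr_const card_ord [RHS]mulr_natl.
pose h : R := pi * (i%:~R / l%:R).
have sh : sin h != 0.
  apply: contra li => /eqP /sin_pi_eq0[z hz]; apply/dvdzP; exists z.
  apply/eqP; rewrite -(eqr_int R) intrM -pmulrn -hz; apply/eqP; field.
  by rewrite lR.
have := sum_cos_arith (2 * pi * i%:~R * x / l%:R) h l.
have -> : 2 * h * l%:R = 2 * pi * i%:~R by rewrite /h; field; rewrite lR.
rewrite sinD2piz subrr => /eqP; rewrite mulf_eq0 mulf_eq0 (negbTE sh) pnatr_eq0/=.
move=> /eqP h0; rewrite -[RHS]h0; apply: eq_bigr => j _; congr cos; rewrite /h; field.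
by rewrite lR.
Qed.

(** Real form of the binomial expansion of a power of exp (i x) + exp (- i x); the induction step is
    Pascal's rule. *)
Lemma cosX x n : (2 * cos x) ^+ n =
  \sum_(r < n.+1) 'C(n, r)%:R * cos ((n%:R - 2 * r%:R) * x).
Proof.
elim: n => [|n IH]; first by rewrite big_ord1 expr0 bin0 mul1r mulr0 subr0 mul0r cos0.
rewrite exprS IH mulr_sumr.
pose c (r : nat) := cos ((n.+1%:R - 2 * r%:R) * x).
have E (r : nat) : 2 * cos x * ('C(n, r)%:R * cos ((n%:R - 2 * r%:R) * x)) =
    'C(n, r)%:R * c r + 'C(n, r)%:R * c r.+1.
  rewrite mulrCA -mulrDr; congr (_ * _).
  have -> : c r = cos ((n%:R - 2 * r%:R) * x + x).
    by congr cos; rewrite -[n.+1]addn1 natrD; ring.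
  have -> : c r.+1 = cos ((n%:R - 2 * r%:R) * x - x).
    by congr cos; rewrite -[n.+1]addn1 -[r.+1]addn1 !natrD; ring.
  by rewrite cosD cosB; ring.
under eq_bigr do rewrite E.
rewrite big_split/= [X in X + _]big_ord_recl/= [X in _ + X]big_ord_recr/=.
rewrite [RHS]big_ord_recl [X in _ = _ + X]big_ord_recr/= !bin0 !binn.
rewrite -!addrA; congr (_ + _); rewrite addrA; congr (_ + _).
rewrite -big_split/=; apply: eq_bigr => i _.
by rewrite /bump/= add1n binS natrD mulrDl.
Qed.

End TrigSums.

(** * One-dimensional theta series and their cosine counterparts *)

Section GaussSums.
Variable R : realType.
Implicit Types (s x y b q : R).

Lemma hasum_series (f : nat -> R) S : (forall n, 0 <= f n) ->
  series f @ \oo --> S -> hasum [set: nat] f S.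
Proof.
move=> f0 h; split=> //; rewrite -nneseries_esumT; last first.
  by move=> n; rewrite lee_fin.
apply: cvg_lim => //.
have -> : (fun n => (\sum_(0 <= i < n) (f i)%:E)%E) = EFin \o series f.
  by apply/funext => n /=; rewrite sumEFin.
by apply/fine_cvgP; split => //; apply: nearW.
Qed.

Lemma hasum_geometric q : 0 <= q < 1 ->
  hasum [set: nat] (fun n => q ^+ n) (1 - q)^-1.
Proof.
move=> /andP[q0 q1]; apply: hasum_series; first by move=> n; rewrite exprn_ge0.
have -> : (fun n => q ^+ n) = geometric 1 q by apply/funext => n /=; rewrite mul1r.
by rewrite -[(_)^-1]mul1r; apply: cvg_geometric_series; rewrite ger0_norm.
Qed.

Lemma hasum_int (f g : nat -> R) F G :
  hasum [set: nat] f F -> hasum [set: nat] g G ->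
  hasum [set: int] (fun z => match z with Posz n => f n | Negz n => g n end)
    (F + G).
Proof.
move=> hf hg.
have bP : set_bij [set: nat] (range Posz) Posz.
  by split=> [n _|m n _ _ []|]//; exists n.
have bN : set_bij [set: nat] (range Negz) Negz.
  by split=> [n _|m n _ _ []|]//; exists n.
pose f' (z : int) := if z is Posz n then f n else 0.
pose g' (z : int) := if z is Negz n then g n else 0.
have hf' : hasum [set: int] f' F.
  apply/(@hasum_subset _ _ (range Posz)) => //.
    by case=> [n|n] _ //= h; case: h; exists n.
  by apply/(hasum_bij _ _ bP).
have hg' : hasum [set: int] g' G.
  apply/(@hasum_subset _ _ (range Negz)) => //.
    by case=> [n|n] _ //= h; case: h; exists n.
  by apply/(hasum_bij _ _ bN).
have := hasumD hf' hg'; apply: hasum_ext => -[n|n] _ /=; rewrite ?addr0 ?add0r//.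
Qed.

Lemma hasum_int_geometric q : 0 <= q < 1 ->
  exists S, hasum [set: int] (fun z => q ^+ `|z|%N) S.
Proof.
move=> q01; have h := hasum_geometric q01; have /andP[q0 _] := q01.
exists ((1 - q)^-1 + q * (1 - q)^-1).
have := hasum_int h (hasumZ q0 h).
by apply: hasum_ext => -[n|n] _ //=; rewrite -exprS.
Qed.

(** The periodized Gaussian, a Jacobi theta function of the shift [x]; its finiteness for [s > 0] is
    the next lemma. *)
Definition gsum s x : R :=
  fine (\esum_(n in [set: int]) (expR (- (s * (n%:~R + x) ^+ 2)))%:E).

(** From u^2 >= 2 u - 1 with u = |n + x|, the terms lie below a multiple of the geometric terms
    q^|n|, where q = exp (- 2 s). *)
Lemma hasum_gsum s x : 0 < s ->
  hasum [set: int] (fun n => expR (- (s * (n%:~R + x) ^+ 2))) (gsum s x).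
Proof.
move=> s0; pose q := expR (- (2 * s)).
have q01 : 0 <= q < 1.
  by rewrite expR_ge0/= expR_lt1 oppr_lt0 mulr_gt0.
have [S hS] := hasum_int_geometric q01.
have [|F hF] := hasum_cmp _ (hasumZ (expR_ge0 (s * (2 * `|x| + 1))) hS)
    (f := fun n : int => expR (- (s * (n%:~R + x) ^+ 2))).
  move=> n _; rewrite expR_ge0/= -expRM_natl -expRD ler_expR.
  have -> : (`|n|%N%:R : R) = `|n%:~R| by rewrite -intr_norm -abszE pmulrn.
  rewrite -subr_ge0.
  set N := n%:~R : R.
  have h1 : `|N| <= `|N + x| + `|x|.
    by rewrite -[X in `|X| <= _](addrK x) (le_trans (ler_normB _ _)).
  have h2 : (N + x) ^+ 2 = `|N + x| ^+ 2 by rewrite real_normK// num_real.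
  rewrite h2; move: h1; set u := `|N + x|; set v := `|N|; set w := `|x| => h1.
  have h3 : 0 <= (u - 1) ^+ 2 by rewrite sqr_ge0.
  have -> : s * (2 * w + 1) + v * - (2 * s) - - (s * u ^+ 2) =
    s * ((u - 1) ^+ 2 + 2 * (u + w - v)) by ring.
  rewrite mulr_ge0 ?(ltW s0)//; lra.
by rewrite /gsum hF.2.
Qed.

Lemma gsum_ge0 s x : 0 < s -> 0 <= gsum s x.
Proof. by move=> /(hasum_gsum x)/hasum_ge0. Qed.

Lemma int_bijD (z : int) : set_bij [set: int] [set: int] (fun n => n + z).
Proof.
split=> // [m n _ _ /addIr//|n _]; by exists (n - z) => //; rewrite subrK.
Qed.

Lemma int_bijN : set_bij [set: int] [set: int] (fun n : int => - n).
Proof.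
split=> // [m n _ _ /oppr_inj//|n _]; by exists (- n) => //; rewrite opprK.
Qed.

Lemma gsumDz s x (z : int) : 0 < s -> gsum s (x + z%:~R) = gsum s x.
Proof.
move=> s0; apply: hasum_uniq (hasum_gsum _ s0) _.
apply/(hasum_ext _ ((hasum_bij _ _ (int_bijD z)).1 (hasum_gsum x s0))).
by move=> n _ /=; rewrite intrD; congr (expR (- (_ * _ ^+ 2))); ring.
Qed.

Lemma gsumN s x : 0 < s -> gsum s (- x) = gsum s x.
Proof.
move=> s0; apply: hasum_uniq (hasum_gsum _ s0) _.
apply/(hasum_ext _ ((hasum_bij _ _ int_bijN).1 (hasum_gsum x s0))).
by move=> n _ /=; rewrite rmorphN/=; congr (expR (- (_ * _))); ring.
Qed.

Lemma gsum0_gt1 s : 0 < s -> 1 < gsum s 0.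
Proof.
move=> s0; have := @hasum_ge_seq R int setT [:: 0%:Z; 1%:Z] _ _ isT (fun _ _ => I)
  (hasum_gsum 0 s0).
rewrite !big_cons big_nil addr0.
apply: lt_le_trans; rewrite addr0 expr0n mulr0 oppr0 expR0 ltrDl.
exact: expR_gt0.
Qed.

Lemma hasum_gcos b x : 0 < b ->
  exists S, hasum [set: int]
    (fun k => expR (- (b * k%:~R ^+ 2)) * (1 + cos (2 * pi * k%:~R * x))) S.
Proof.
move=> b0; apply: hasum_cmp (hasumZ (ler0n _ 2) (hasum_gsum 0 b0)).
move=> k _; rewrite addr0 mulr_ge0 ?expR_ge0///=.
rewrite mulrC ler_wpM2r ?expR_ge0//.
by have := cos_le1 (2 * pi * k%:~R * x); lra.
Qed.

(* The signed sum of [exp (- b k^2) * cos (2 pi k x)]; sums being defined for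
   nonnegative terms only, it is obtained as a difference. *)
Definition gcos b x : R :=
  fine (\esum_(k in [set: int])
    (expR (- (b * k%:~R ^+ 2)) * (1 + cos (2 * pi * k%:~R * x)))%:E) -
  gsum b 0.

Lemma hasum_gcosE b x : 0 < b ->
  hasum [set: int]
    (fun k => expR (- (b * k%:~R ^+ 2)) * (1 + cos (2 * pi * k%:~R * x)))
    (gsum b 0 + gcos b x).
Proof.
by move=> b0; have [S hS] := hasum_gcos x b0; rewrite /gcos addrC subrK hS.2.
Qed.

Lemma gcos0 b : 0 < b -> gcos b 0 = gsum b 0.
Proof.
move=> b0; apply: (addrI (gsum b 0)); apply: hasum_uniq (hasum_gcosE 0 b0) _.
have := hasumD (hasum_gsum 0 b0) (hasum_gsum 0 b0); apply: hasum_ext => k _ /=.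
by rewrite mulr0 cos0 addr0; ring.
Qed.

End GaussSums.

(** * The Gaussian profile of central binomial coefficients and the size of the middle one *)

Section Binomial.
Variable R : realType.

Lemma bin_central_step m i :
  ((m + i).+1 * 'C(2 * m, (m + i).+1) = (m - i) * 'C(2 * m, m + i))%N.
Proof. by rewrite mul_bin_left; congr (_ * _)%N; lia. Qed.

(** A ratio of neighbours is 1 - (2 i + 1) / (m + i + 1), at most exp (- (2 i + 1) / (m + J)), and
    the first odd numbers add up to a square. *)
Lemma bin_central_ub m i J : (0 < m + J)%N -> (i <= J)%N ->
  'C(2 * m, m + i)%:R <=
  'C(2 * m, m)%:R * expR (- (i%:R ^+ 2 / (m + J)%:R)) :> R.
Proof.
move=> mJ; elim: i => [|i IH] iJ.
  by rewrite addn0 expr0n mul0r oppr0 expR0 mulr1.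
have := bin_central_step m i => /(congr1 (fun n => n%:R : R)).
rewrite !natrM -addnS => E.
have d0 : 0 < (m + i.+1)%:R :> R by rewrite ltr0n addnS.
have mJR : 0 < (m + J)%:R :> R by rewrite ltr0n.
have -> : 'C(2 * m, m + i.+1)%:R = ((m - i)%:R / (m + i.+1)%:R) * 'C(2 * m, m + i)%:R :> R.
  by apply: (mulfI (lt0r_neq0 d0)); rewrite E mulrA mulrCA mulrA mulfK ?gt_eqF// mulrC.
have h : (m - i)%:R / (m + i.+1)%:R <= expR (- ((2 * i + 1)%:R / (m + J)%:R)) :> R.
  have [mi|mi] := leqP i m; last first.
    have -> : (m - i = 0)%N by lia.
    by rewrite mul0r expR_ge0.
  apply: (@le_trans _ _ (1 + - ((2 * i + 1)%:R / (m + i.+1)%:R))).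
    rewrite natrB// ler_pdivrMr// mulrDl mulNr mulfVK ?gt_eqF// mul1r.
    rewrite -natrB// -natrB; last by lia.
    by rewrite ler_nat; lia.
  apply: le_trans (expR_ge1Dx _) _; rewrite ler_expR lerN2.
  by rewrite ler_wpM2l// lef_pV2 ?posrE// ler_nat; lia.
have {}IH := IH (ltnW iJ).
apply: le_trans (ler_pM _ _ h IH) _; rewrite ?divr_ge0//.
rewrite mulrCA -expRD le_eqVlt; apply/orP; left; apply/eqP; congr (_ * expR _) => //.
by rewrite -opprD -mulrDl; congr (- (_ / _)); ring.
Qed.

(** The same product, now with the inverse ratio 1 + (2 i + 1) / (m - i) bounded by an
    exponential. *)
Lemma bin_central_lb m i J : (J < m)%N -> (i <= J)%N ->
  'C(2 * m, m)%:R * expR (- (i%:R ^+ 2 / (m - J)%:R)) <=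
  'C(2 * m, m + i)%:R :> R.
Proof.
move=> mJ; elim: i => [|i IH] iJ.
  by rewrite addn0 expr0n mul0r oppr0 expR0 mulr1.
have := bin_central_step m i => /(congr1 (fun n => n%:R : R)).
rewrite !natrM -addnS => E.
have d0 : 0 < (m + i.+1)%:R :> R by rewrite ltr0n addnS.
have mJR : 0 < (m - J)%:R :> R by rewrite ltr0n subn_gt0.
have miR : 0 < (m - i)%:R :> R by rewrite ltr0n subn_gt0; lia.
have -> : 'C(2 * m, m + i.+1)%:R = ((m - i)%:R / (m + i.+1)%:R) * 'C(2 * m, m + i)%:R :> R.
  by apply: (mulfI (lt0r_neq0 d0)); rewrite E mulrA mulrCA mulrA mulfK ?gt_eqF// mulrC.
have h : expR (- ((2 * i + 1)%:R / (m - J)%:R)) <= (m - i)%:R / (m + i.+1)%:R :> R.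
  rewrite expRN -[leRHS]invf_div lef_pV2 ?posrE ?expR_gt0 ?divr_gt0//.
  apply: (@le_trans _ _ (1 + ((2 * i + 1)%:R / (m - i)%:R))).
    rewrite ler_pdivrMr// mulrDl mulfVK ?gt_eqF// mul1r -natrD ler_nat; lia.
  apply: le_trans (expR_ge1Dx _) _; rewrite ler_expR.
  by rewrite ler_wpM2l// lef_pV2 ?posrE// ler_nat; lia.
have {}IH := IH (ltnW iJ).
apply: le_trans (ler_pM _ _ h IH); rewrite ?mulr_ge0 ?expR_ge0//.
rewrite mulrCA -expRD le_eqVlt; apply/orP; left; apply/eqP; congr (_ * expR _) => //.
by rewrite -opprD -mulrDl; congr (- (_ / _)); ring.
Qed.

Definition cbin (m : nat) : R := 'C(2 * m, m)%:R / 4 ^+ m.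

Lemma cbinS m : cbin m.+1 = cbin m * ((2 * m + 1)%:R / (2 * m + 2)%:R).
Proof.
have e : (m.+1 * 'C(2 * m.+1, m.+1) = 2 * ((2 * m + 1) * 'C(2 * m, m)))%N.
  have h1 := mul_bin_diag (2 * m + 1) m.
  have h2 : ('C(2 * m.+1, m.+1) = 2 * 'C(2 * m + 1, m.+1))%N.
    have -> : (2 * m.+1 = (2 * m + 1).+1)%N by lia.
    have e : ('C(2 * m + 1, m) = 'C(2 * m + 1, m.+1))%N.
      rewrite -bin_sub; last by lia.
      by have -> : (2 * m + 1 - m = m.+1)%N by lia.
    by rewrite binS e; lia.
  rewrite h2 mulnCA; congr (2 * _)%N; rewrite -h1.
  by have -> : ((2 * m + 1).-1 = 2 * m)%N by lia.
move: e => /(congr1 (fun n => n%:R : R)); rewrite !natrM => e.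
rewrite /cbin exprS; have m1 : m.+1%:R != 0 :> R by rewrite pnatr_eq0.
apply: (mulfI m1); rewrite mulrA e.
have -> : (2 * m + 1)%:R = 2 * m%:R + 1 :> R by rewrite natrD natrM.
have -> : (2 * m + 2)%:R = 2 * m%:R + 2 :> R by rewrite natrD natrM.
rewrite -natr1.
field.
rewrite expf_neq0 ?andbT//; have : 0 <= m%:R :> R by []; move=> ?; rewrite gt_eqF//; lra.
Qed.

Lemma cbin_gt0 m : 0 < cbin m.
Proof. by rewrite divr_gt0 ?exprn_gt0// ltr0n bin_gt0; lia. Qed.

(** Half of Wallis' formula. Only existence and positivity of the limit are proved; its value 1 / pi
    comes out of Poisson summation at a self-dual parameter. *)
Lemma cvg_cbin : exists L : R, 0 < L /\
  (fun m => m%:R * cbin m ^+ 2) @ \oo --> L.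
Proof.
pose v m : R := m%:R * cbin m ^+ 2.
have inc : nondecreasing_seq v.
  apply/nondecreasing_seqP => n; rewrite /v cbinS; set r := ((2 * n + 1)%:R / _ : R); set c := cbin n.
  have -> : n.+1%:R * (c * r) ^+ 2 = c ^+ 2 * (n.+1%:R * r ^+ 2) by ring.
  rewrite [leLHS]mulrC ler_wpM2l ?sqr_ge0// /r.
  rewrite expr_div_n mulrA ler_pdivlMr ?exprn_gt0 ?ltr0n//; last by lia.
  rewrite -!natrX -!natrM ler_nat; nia.
have ub n : v n <= 1 / 2.
  (* With [n + 1/2] in place of [n] the sequence decreases, starting at 1/2. *)
  suff : (n%:R + 1 / 2) * cbin n ^+ 2 <= 1 / 2 :> R.
    by apply: le_trans; rewrite ler_wpM2r ?sqr_ge0//; lra.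
  elim: n => [|n IH]; first by rewrite /cbin bin0 expr0; lra.
  apply: le_trans IH; rewrite cbinS; set r := ((2 * n + 1)%:R / _ : R); set c := cbin n.
  have -> : (n.+1%:R + 1 / 2) * (c * r) ^+ 2 = c ^+ 2 * ((n.+1%:R + 1 / 2) * r ^+ 2) by ring.
  rewrite [leRHS]mulrC ler_wpM2l ?sqr_ge0// /r.
  rewrite expr_div_n mulrA ler_pdivrMr ?exprn_gt0 ?ltr0n//; last by lia.
  have n0 : 0 <= n%:R :> R by [].
  have -> : (2 * n + 1)%:R = 2 * n%:R + 1 :> R by rewrite natrD natrM.
  have -> : (2 * n + 2)%:R = 2 * n%:R + 2 :> R by rewrite natrD natrM.
  by rewrite -natr1; nra.
have cv : cvgn v by apply: nondecreasing_is_cvgn => //; exists (1 / 2) => _ [n _ <-].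
exists (limn v); split => //.
apply: (@lt_le_trans _ _ (v 1%N)); first by rewrite mulr_gt0 ?exprn_gt0 ?cbin_gt0.
exact: nondecreasing_cvgn_le.
Qed.

End Binomial.

(** * Taylor bounds for exp, sin and cos, a lower bound for pi, convexity of exp *)

Section Elementary.
Variable R : realType.
Implicit Types (x y s t : R).

Lemma le_of_derive (f df : R -> R) (a b : R) : a <= b ->
  (forall x, a <= x <= b -> is_derive x 1 f (df x)) ->
  (forall x, a <= x <= b -> 0 <= df x) -> f a <= f b.
Proof.
move=> ab fd fd0; move: ab; rewrite le_eqVlt => /predU1P[-> //|ab].
have sub x : x \in `]a, b[%R -> a <= x <= b.
  by rewrite in_itv/= => /andP[/ltW -> /ltW ->].
have [| |c /sub cab e] := @MVT R f df a b ab.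
- by move=> x /sub; exact: fd.
- apply: derivable_within_continuous => x; rewrite in_itv/= => xab.
  exact: (@ex_derive _ _ _ _ _ _ _ (fd x xab)).
- by rewrite -subr_ge0 e mulr_ge0 ?fd0// subr_ge0 ltW.
Qed.

Definition texp n x : R := \sum_(k < n) x ^+ k / k`!%:R.

Lemma is_derive_texp n x : is_derive x 1 (texp n.+1) (texp n x).
Proof.
have -> : texp n.+1 = \sum_(k < n.+1) (fun x => x ^+ k / k`!%:R).
  by apply/funext => y; rewrite /texp fct_sumE.
rewrite /texp.
have H (k : 'I_n.+1) : is_derive x 1 (fun x : R => x ^+ k / k`!%:R)
    ((k%:R * x ^+ k.-1) / k`!%:R).
  have -> : (fun x : R => x ^+ k / k`!%:R) = k`!%:R^-1 \*: ((@id R) ^+ k).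
    by apply/funext => y /=; rewrite fctE /= mulrC; congr (_ * _).
  apply: is_derive_eq; rewrite /= [LHS]mulrC; congr (_ / _).
  by rewrite /GRing.scale/= mulr1.
apply: is_derive_eq; rewrite big_ord_recl/= mul0r mul0r add0r.
apply: eq_bigr => k _; rewrite /bump/= add1n factS natrM invfM.
have k0 : k.+1%:R != 0 :> R by rewrite pnatr_eq0.
by rewrite [_%:R * _]mulrC -!mulrA; congr (_ * _); rewrite mulrA mulfV// mul1r.
Qed.

Lemma texp0 n : texp n.+1 0 = 1.
Proof.
rewrite /texp big_ord_recl/= expr0 fact0 divr1 big1 ?addr0// => i _.
by rewrite expr0n mul0r.
Qed.

(** Induction by integrating from 0; for negative [x] each integration reverses the inequality,
    hence the parity. *)
Lemma texp_bounds n x :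
  (0 <= x -> texp n x <= expR x) /\
  (x <= 0 -> if odd n then expR x <= texp n x else texp n x <= expR x).
Proof.
elim: n x => [|n IH] x.
  by rewrite /texp big_ord0; split=> _; rewrite expR_ge0.
split=> [x0|x0].
  rewrite -subr_ge0.
  have := @le_of_derive (expR - texp n.+1) (fun x => expR x - texp n x) 0 x x0.
  rewrite !fctE expR0 texp0 subrr; apply.
    move=> y _; apply: is_deriveB; exact: is_derive_texp.
  by move=> y /andP[y0 _]; rewrite subr_ge0; apply: (IH y).1.
rewrite /=; case: ifPn => on; rewrite -subr_ge0.
  have := @le_of_derive (expR - texp n.+1) (fun x => expR x - texp n x) x 0 x0.
  rewrite !fctE expR0 texp0 subrr => h; rewrite -opprB oppr_ge0; apply: h.
    move=> y _; apply: is_deriveB; exact: is_derive_texp.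
  by move=> y /andP[_ y0]; rewrite subr_ge0; have := (IH y).2 y0; rewrite (negbTE on).
have := @le_of_derive (texp n.+1 - expR) (fun x => texp n x - expR x) x 0 x0.
rewrite !fctE expR0 texp0 subrr => h; rewrite -opprB oppr_ge0; apply: h.
  move=> y _; apply: is_deriveB; exact: is_derive_texp.
by move=> y /andP[_ y0]; rewrite subr_ge0; have := (IH y).2 y0; rewrite negbK in on; rewrite on.
Qed.

(** Taylor polynomials of odd degree lie below exp on the whole line, which is why degrees 3 and 5
    are the ones used. *)
Lemma expR_ge_taylor3 x : 1 + x + x ^+ 2 / 2 + x ^+ 3 / 6 <= expR x.
Proof.
have [h1 h2] := texp_bounds 4 x.
have : texp 4 x <= expR x by have [x0|/ltW x0] := leP 0 x; [exact: h1|exact: h2].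
by rewrite /texp !big_ord_recr big_ord0/= !factS fact0; lra.
Qed.

Lemma expR_ge_taylor5 x :
  1 + x + x ^+ 2 / 2 + x ^+ 3 / 6 + x ^+ 4 / 24 + x ^+ 5 / 120 <= expR x.
Proof.
have [h1 h2] := texp_bounds 6 x.
have : texp 6 x <= expR x by have [x0|/ltW x0] := leP 0 x; [exact: h1|exact: h2].
by rewrite /texp !big_ord_recr big_ord0/= !factS fact0; lra.
Qed.

(** Start of a chain up to [cos_ge6] in which each bound is the integral of the preceding one. *)
Lemma sin_le x : 0 <= x -> sin x <= x.
Proof.
move=> x0; rewrite -subr_ge0.
have := @le_of_derive (id - sin) (fun x => 1 - cos x) 0 x x0.
rewrite !fctE sin0 subr0; apply=> y _.
by rewrite subr_ge0 cos_le1.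
Qed.

Let isX (k : nat) (c x : R) : is_derive x 1 (c \*: ((@id R) ^+ k.+1)) (c * (k.+1%:R * x ^+ k)).
Proof. by apply: is_derive_eq; rewrite /= /GRing.scale/= mulr1. Qed.

Lemma cos_ge2 x : 1 - x ^+ 2 / 2 <= cos x.
Proof.
wlog x0 : x / 0 <= x => [h|].
  have [/h//|/ltW x0] := leP 0 x.
  by have := h (- x); rewrite oppr_ge0 cosN sqrrN; apply.
pose F : R -> R := cos + 2^-1 \*: ((@id R) ^+ 2).
have FE (y : R) : F y = cos y + 2^-1 * y ^+ 2 by [].
pose F' (x : R) : R := - sin x + 2^-1 * (2%:R * x ^+ 1).
have D y : is_derive y 1 F (F' y).
  by do ?[apply: is_deriveD | apply: is_deriveN | exact: isX].
have P y : 0 <= y <= x -> 0 <= F' y.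
  by move=> /andP[y0 _]; rewrite /F'; have := sin_le y0; rewrite expr1; lra.
have := le_of_derive x0 (fun y _ => D y) P.
by rewrite !FE cos0 expr0n/=; lra.
Qed.

Lemma sin_ge3 x : 0 <= x -> x - x ^+ 3 / 6 <= sin x.
Proof.
move=> x0.
pose F : R -> R := sin + 6^-1 \*: ((@id R) ^+ 3) + (-1) \*: ((@id R) ^+ 1).
have FE (y : R) : F y = sin y + 6^-1 * y ^+ 3 + -1 * y ^+ 1 by [].
pose F' (x : R) : R := cos x + 6^-1 * (3%:R * x ^+ 2) + -1 * (1%:R * x ^+ 0).
have D y : is_derive y 1 F (F' y).
  by do ?[apply: is_deriveD | apply: is_deriveN | exact: isX].
have P y : 0 <= y <= x -> 0 <= F' y.
  by move=> /andP[y0 _]; rewrite /F'; have := cos_ge2 y; rewrite expr0; lra.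
have := le_of_derive x0 (fun y _ => D y) P.
by rewrite !FE sin0 !expr0n/= expr1; lra.
Qed.

Lemma cos_le4 x : cos x <= 1 - x ^+ 2 / 2 + x ^+ 4 / 24.
Proof.
wlog x0 : x / 0 <= x => [h|].
  have [/h//|/ltW x0] := leP 0 x.
  have := h (- x); rewrite oppr_ge0 cosN sqrrN => /(_ x0).
  by have -> : (- x) ^+ 4 = x ^+ 4 by ring.
pose F : R -> R := - cos + (- 2^-1) \*: ((@id R) ^+ 2) + 24^-1 \*: ((@id R) ^+ 4).
have FE (y : R) : F y = - cos y + - 2^-1 * y ^+ 2 + 24^-1 * y ^+ 4 by [].
pose F' (x : R) : R := - (- sin x) + (- 2^-1) * (2%:R * x ^+ 1) +
    24^-1 * (4%:R * x ^+ 3).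
have D y : is_derive y 1 F (F' y).
  by do ?[apply: is_deriveD | apply: is_deriveN | exact: isX].
have P y : 0 <= y <= x -> 0 <= F' y.
  by move=> /andP[y0 _]; rewrite /F'; have := sin_ge3 y0; rewrite expr1; lra.
have := le_of_derive x0 (fun y _ => D y) P.
by rewrite !FE cos0 !expr0n/=; lra.
Qed.

Lemma sin_le5 x : 0 <= x -> sin x <= x - x ^+ 3 / 6 + x ^+ 5 / 120.
Proof.
move=> x0.
pose F : R -> R := - sin + (- 6^-1) \*: ((@id R) ^+ 3) + 120^-1 \*: ((@id R) ^+ 5) + 1 \*: ((@id R) ^+ 1).
have FE (y : R) : F y = - sin y + - 6^-1 * y ^+ 3 + 120^-1 * y ^+ 5 + 1 * y ^+ 1 by [].
pose F' (x : R) : R := - cos x + (- 6^-1) * (3%:R * x ^+ 2) +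
    120^-1 * (5%:R * x ^+ 4) + 1 * (1%:R * x ^+ 0).
have D y : is_derive y 1 F (F' y).
  by do ?[apply: is_deriveD | apply: is_deriveN | exact: isX].
have P y : 0 <= y <= x -> 0 <= F' y.
  by move=> /andP[y0 _]; rewrite /F'; have := cos_le4 y; rewrite expr0; lra.
have := le_of_derive x0 (fun y _ => D y) P.
by rewrite !FE sin0 !expr0n/= expr1; lra.
Qed.

Lemma cos_ge6 x : 0 <= x -> 1 - x ^+ 2 / 2 + x ^+ 4 / 24 - x ^+ 6 / 720 <= cos x.
Proof.
move=> x0.
pose F : R -> R := cos + 2^-1 \*: ((@id R) ^+ 2) + (- 24^-1) \*: ((@id R) ^+ 4) + 720^-1 \*: ((@id R) ^+ 6).
have FE (y : R) : F y = cos y + 2^-1 * y ^+ 2 + - 24^-1 * y ^+ 4 + 720^-1 * y ^+ 6 by [].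
pose F' (x : R) : R := - sin x + 2^-1 * (2%:R * x ^+ 1) +
    (- 24^-1) * (4%:R * x ^+ 3) + 720^-1 * (6%:R * x ^+ 5).
have D y : is_derive y 1 F (F' y).
  by do ?[apply: is_deriveD | apply: is_deriveN | exact: isX].
have P y : 0 <= y <= x -> 0 <= F' y.
  by move=> /andP[y0 _]; rewrite /F'; have := sin_le5 y0; rewrite expr1; lra.
have := le_of_derive x0 (fun y _ => D y) P.
by rewrite !FE cos0 !expr0n/=; lra.
Qed.

(** The degree 6 minorant of cos is still positive on [1, 1.55], whereas cos vanishes at pi / 2. *)
Lemma pi_ge31 : 31 / 10 <= pi :> R.
Proof.
have h0 := @pihalf_ge1 R; have h2 := @pihalf_lt2 R.
have := @cos_ge6 (pi / 2); rewrite cos_pihalf => /(_ _).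
move: h0 h2; set x : R := pi / 2 => h0 h2 /(_ (le_trans ler01 h0)) h.
suff : 155 / 100 <= x by rewrite /x; lra.
rewrite leNgt; apply/negP => hx; move: h.
have -> : x ^+ 4 = (x ^+ 2) ^+ 2 by ring.
have -> : x ^+ 6 = (x ^+ 2) ^+ 3 by ring.
have : 1 <= x ^+ 2 by nra.
have : x ^+ 2 <= 961 / 400 by nra.
set y := x ^+ 2 => y1 y2; nra.
Qed.

Lemma sin_ge_quarter x : 0 <= x <= pi / 2 -> x / 4 <= sin x.
Proof.
move=> /andP[x0 x1]; have x2 := lt_trans (le_lt_trans x1 (@pihalf_lt2 R)) _.
have := sin_ge3 x0; have h := @pihalf_lt2 R.
have : x ^+ 2 <= 4 by nra.
by move=> ? ?; nra.
Qed.

Lemma pi_sqr_ge : 961 / 100 <= pi ^+ 2 :> R.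
Proof.
have -> : 961 / 100 = (31 / 10) ^+ 2 :> R by field.
by rewrite lerXn2r ?nnegrE ?pi_ge31 ?pi_ge0//; lra.
Qed.

Lemma expR_convex t z : 0 <= t <= 1 -> expR (t * z) <= (1 - t) + t * expR z.
Proof.
move=> /andP[t0 t1].
(* The tangent line at [t * z] is compared with exp at 0 here and at [z] in [h2]; the weights
   [1 - t] and [t] cancel the slopes. *)
have h1 : expR (t * z) * (1 - t * z) <= 1.
  have := expR_ge1Dx (- (t * z)); rewrite expRN => h.
  by rewrite -ler_pdivlMl ?expR_gt0// mulr1.
have h2 : expR (t * z) * (1 + (1 - t) * z) <= expR z.
  have := expR_ge1Dx ((1 - t) * z) => h.
  have -> : expR z = expR (t * z) * expR ((1 - t) * z).
    by rewrite -expRD; congr expR; ring.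
  by rewrite ler_wpM2l ?expR_ge0.
have : (1 - t) * (expR (t * z) * (1 - t * z)) + t * (expR (t * z) * (1 + (1 - t) * z)) <= (1 - t) * 1 + t * expR z.
  by apply: lerD; rewrite ler_wpM2l// subr_ge0.
have -> : (1 - t) * (expR (t * z) * (1 - t * z)) + t * (expR (t * z) * (1 + (1 - t) * z)) = expR (t * z) by ring.
by rewrite mulr1.
Qed.

End Elementary.

(** * The finite identity behind Poisson summation *)

Section FinitePoisson.
Variable R : realType.
Implicit Types (x y : R) (m l : nat).

(** An even cosine power is the finite model of a Gaussian; it is sampled at the [l] integer steps
    of one of its periods. *)
Definition cospow m l y : R := \sum_(j < l) cos (pi * (y + j%:R) / l%:R) ^+ (2 * m).

Lemma cospowE m l y : (0 < l)%N ->
  4 ^+ m * cospow m l y = l%:R * \sum_(r < (2 * m).+1)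
   if (l %| m%:Z - r%:Z)%Z
   then 'C(2 * m, r)%:R * cos (2 * pi * (m%:Z - r%:Z)%:~R * y / l%:R) else 0.
Proof.
move=> l0; rewrite /cospow mulr_sumr.
have E0 (c : R) : 4 ^+ m * c ^+ (2 * m) = (2 * c) ^+ (2 * m).
  by rewrite exprMn [2 ^+ (2 * m)]exprM; congr (_ ^+ m * _); ring.
under eq_bigr do rewrite E0 cosX.
rewrite exchange_big/= mulr_sumr; apply: eq_bigr => r _.
rewrite -mulr_sumr.
have E (j : 'I_l) : cos (((2 * m)%:R - 2 * r%:R) * (pi * (y + j%:R) / l%:R)) =
   cos (2 * pi * (m%:Z - r%:Z)%:~R * (y + j%:R) / l%:R).
  by congr cos; rewrite natrM rmorphB/= -!pmulrn; ring.
under eq_bigr do rewrite E.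
rewrite sum_cos_roots//; case: ifP => _; rewrite ?mulr0//; ring.
Qed.

(** Only frequencies divisible by [l] survive the sum over the [l] sample points, and they carry the
    coefficients C(2m, m + l |k|), which vanish once l |k| > m. Starting at [- p] with [l = 2p + 1]
    centres the sample. The unshifted sample is added so that the dual terms contain [1 + cos] and
    are nonnegative. *)
Lemma hasum_bin m p x : let l := (2 * p).+1 in
  hasum [set: int] (fun k => 'C(2 * m, m + l * `|k|)%:R * (1 + cos (2 * pi * k%:~R * x)))
    (4 ^+ m / l%:R * (cospow m l (x - p%:R) + cospow m l (- p%:R))).
Proof.
move=> l; have l0 : (0 < l)%N by [].
have lR : l%:R != 0 :> R by rewrite pnatr_eq0 -lt0n.
set T := (4 ^+ m / l%:R * _).
have {T}-> : T = (4 ^+ m * cospow m l (x - p%:R) + 4 ^+ m * cospow m l (- p%:R)) / l%:R.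
  by rewrite /T; ring.
rewrite !cospowE// -mulrDr mulrAC mulfV// mul1r -big_split/=.
pose g (r : 'I_(2 * m).+1) : R := if (l %| m%:Z - r%:Z)%Z
  then 'C(2 * m, r)%:R * (1 + cos (2 * pi * ((m%:Z - r%:Z) %/ l)%Z%:~R * x)) else 0.
have cge (t : R) : 0 <= 1 + cos t by have := cos_geN1 t; lra.
rewrite (eq_bigr g); last first.
  move=> r _; rewrite /g; case: ifPn => [/dvdzP[k ek]|_]; last by rewrite addr0.
  rewrite ek mulzK// -mulrDr; congr (_ * _); rewrite addrC; congr (_ + _).
    rewrite -[RHS](cos2piz _ (- k * p)); congr cos; rewrite !intrM -!pmulrn rmorphN/=.
    by field; rewrite lR.
  rewrite -[RHS](cosD2piz _ (- k * p)); congr cos; rewrite !intrM -!pmulrn rmorphN/=.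
  by field; rewrite lR.
have g0 r : 0 <= g r by rewrite /g; case: ifP => // _; rewrite mulr_ge0.
have hg := hasum_fin g0.
pose P := [set r : 'I_(2 * m).+1 | (l %| m%:Z - r%:Z)%Z].
pose Q := [set k : int | (l * `|k| <= m)%N].
have hP : hasum P g (\sum_i g i).
  apply/(@hasum_subset _ _ P [set: _]) => //.
  by move=> r _ /negP; rewrite /g => /negbTE ->.
apply/(@hasum_subset _ _ Q) => //.
  move=> k _ /negP; rewrite -ltnNge => h.
  by rewrite bin_small ?mul0r//; lia.
(* The surviving binomial index [r] and the frequency [k = (m - r) / l] determine each other. *)
have bij : set_bij P Q (fun r => ((m%:Z - r%:Z) %/ l)%Z).
  split.
  - move=> r /dvdzP[k ek]; rewrite /Q/= ek mulzK//.
    have := ltn_ord r; move: ek; set n := nat_of_ord r; clearbody n l.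
    move=> ek hn; have : (absz (m%:Z - n%:Z)%R <= m)%N by lia.
    by rewrite ek abszM mulnC.
  - move=> r s /set_mem/dvdzP[k ek] /set_mem/dvdzP[k' ek']; rewrite ek ek' !mulzK// => e.
    by apply/val_inj => /=; move: ek ek'; rewrite e; lia.
  - move=> k Qk.
    have b : (absz (m%:Z - k * l%:Z)%R < (2 * m).+1)%N.
      have : (absz (k * l%:Z)%R <= m)%N by rewrite abszM mulnC.
      move: (k * l); lia.
    have e : m%:Z - (absz (m%:Z - k * l%:Z)%R)%:Z = k * l.
      have : (absz (k * l%:Z)%R <= m)%N by rewrite abszM mulnC.
      move: (k * l); lia.
    exists (Ordinal b); rewrite /P/= e; first by rewrite dvdz_mull.
    by rewrite mulzK.
apply/(hasum_bij _ _ bij); apply: hasum_ext hP => r /= dr.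
rewrite /g dr; move: dr => /dvdzP[k ek]; rewrite ek mulzK//; congr (_%:R * _).
(* Symmetry of binomial coefficients: only the absolute value of the frequency matters. *)
have hr := ltn_ord r; move: ek hr; set n := nat_of_ord r.
case: k => k; rewrite ?NegzE => ek hr.
  have -> : (m + l * `|k|%N = 2 * m - n)%N.
    by have : (k%:Z * l = (k * l)%N) by []; lia.
  by rewrite bin_sub//; lia.
have -> : (m + l * absz (- k.+1%:Z) = n)%N.
  have : (- k.+1%:Z * l = - (k.+1 * l)%N%:Z) by rewrite mulNr.
  by lia.
by [].
Qed.

End FinitePoisson.

Lemma cvgMk (R : realType) (k c : R) (f : nat -> R) :
  f @ \oo --> c -> (fun p => k * f p) @ \oo --> k * c.
Proof. by move=> h; apply: cvgM h; exact: cvg_cst. Qed.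

(** * Passage to the limit on both sides of the finite identity *)

Section PoissonLimit.
Variables (R : realType) (a : R).
Hypothesis a0 : 0 < a.
Implicit Types (x y : R).

Let A : R := a / pi ^+ 2.
Let l (p : nat) := (2 * p).+1.
(** The choice makes m / l^2 tend to a / pi^2, so that the power 2 m of cos (pi y / l) tends to exp
    (- a y^2). Rounding up gives [A <= mu p]. *)
Let m (p : nat) := (Num.truncn (A * (l p)%:R ^+ 2)).+1.
Let il (p : nat) : R := (l p)%:R^-1.
Let mu (p : nat) : R := (m p)%:R * il p ^+ 2.

Let pi2 : 0 < pi ^+ 2 :> R. Proof. by rewrite exprn_gt0// pi_gt0. Qed.
Let A0 : 0 < A. Proof. by rewrite divr_gt0. Qed.
Let l0 p : 0 < (l p)%:R :> R. Proof. by []. Qed.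
Let il0 p : 0 < il p. Proof. by rewrite invr_gt0. Qed.
Let il1 p : il p <= 1. Proof. by rewrite invf_le1// ler1n. Qed.
Let ill p : il p * (l p)%:R = 1. Proof. by rewrite mulVf// gt_eqF. Qed.

Let cvg_il : il @ \oo --> 0.
Proof.
apply: (squeeze_cvgr _ (@cvg_cst _ 0 _ _ _) (@cvg_harmonic R)).
apply: nearW => p; rewrite ltW//= /il /harmonic/= lef_pV2 ?posrE// ler_nat /l; lia.
Qed.

Let mu_bounds p : A <= mu p <= A + il p ^+ 2.
Proof.
have h0 : 0 <= A * (l p)%:R ^+ 2 by rewrite mulr_ge0 ?(ltW A0)// ?exprn_ge0.
have /andP[h1 h2] := truncn_itv h0.
have e : (l p)%:R ^+ 2 * il p ^+ 2 = 1 by rewrite -exprMn mulrC ill expr1n.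
have i2 : 0 <= il p ^+ 2 by rewrite sqr_ge0.
apply/andP; split.
  have := ler_wpM2r i2 (ltW h2); by rewrite -[A * _ * _]mulrA e mulr1.
have := ler_wpM2r i2 h1; rewrite -[A * _ * _]mulrA e mulr1 /mu /m -natr1 mulrDl mul1r; lra.
Qed.

Let cvg_mu : mu @ \oo --> A.
Proof.
apply: (squeeze_cvgr _ (@cvg_cst _ A _ _ _)); last first.
  rewrite -[X in _ --> X]addr0; apply: cvgD; first exact: cvg_cst.
  by rewrite -[X in _ --> X](mulr0 (0 : R)); exact: (cvgM cvg_il cvg_il).
apply: nearW => p; exact: mu_bounds.
Qed.

(** With u the square of sin (pi y / l), the power is (1 - u)^m, squeezed between exp (- m u / (1 -
    u)) and exp (- m u), and m u tends to a y^2. *)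
Let cvg_cos y : (fun p => cos (pi * y / (l p)%:R) ^+ (2 * m p)) @ \oo -->
  expR (- (a * y ^+ 2)).
Proof.
wlog y0 : y / 0 <= y => [h|].
  have [/h//|/ltW y0] := leP 0 y.
  have := h (- y); rewrite oppr_ge0 sqrrN => /(_ y0).
  by under eq_fun do rewrite mulrN mulNr cosN.
pose t p := pi * y * il p.
have t0 p : 0 <= t p by rewrite !mulr_ge0 ?pi_ge0// ltW.
have cvt : t @ \oo --> 0.
  by rewrite -(mulr0 (pi * y)); apply: cvgM; [exact: cvg_cst|exact: cvg_il].
have cvmt : (fun p => (m p)%:R * t p ^+ 2) @ \oo --> a * y ^+ 2.
  have -> : (fun p => (m p)%:R * t p ^+ 2) = (fun p => (pi ^+ 2 * y ^+ 2) * mu p).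
    by apply/funext => p; rewrite /t /mu; ring.
  have -> : a * y ^+ 2 = (pi ^+ 2 * y ^+ 2) * A.
    rewrite /A; have := @pi_gt0 R; generalize (@pi R) => P P0.
    by field; rewrite gt_eqF.
  exact: cvgMk cvg_mu.
pose u p := sin (t p) ^+ 2.
have cvmu : (fun p => (m p)%:R * u p) @ \oo --> a * y ^+ 2.
  apply: (squeeze_cvgr _ _ cvmt); last first.
    have : (fun p => ((m p)%:R * t p ^+ 2) * ((1 - (t p * t p) / 6) * (1 - (t p * t p) / 6))) @ \oo -->
        (a * y ^+ 2) * ((1 - (0 * 0) / 6) * (1 - (0 * 0) / 6)).
      apply: cvgM cvmt _; apply: cvgM; (apply: cvgB; first exact: cvg_cst);
      apply: cvgM; [exact: cvgM|exact: cvg_cst|exact: cvgM|exact: cvg_cst].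
    by rewrite mul0r mul0r subr0 mulr1 mulr1; exact.
  move/cvgrPdist_lt : cvt => /(_ 1 ltr01); apply: filterS => p.
  rewrite sub0r normrN ger0_norm// => t1.
  rewrite -mulrA; apply/andP; split; rewrite ler_wpM2l//.
    rewrite -expr2 -exprMn lerXn2r ?nnegrE//.
    - by rewrite mulr_ge0// subr_ge0; have := t0 p; nra.
    - apply: le_trans (sin_ge3 (t0 p)); have := t0 p; nra.
    - apply: le_trans (sin_ge3 (t0 p)).
      by rewrite le_eqVlt; apply/orP; left; apply/eqP; field.
  rewrite lerXn2r ?nnegrE ?sin_le//.
  by apply: le_trans (sin_ge3 (t0 p)); have := t0 p; nra.
have cvu : u @ \oo --> 0.
  apply: (squeeze_cvgr _ (@cvg_cst _ 0 _ _ _)); last first.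
    by rewrite -(mulr0 (0 : R)); exact: (cvgM cvt cvt).
  apply: nearW => p; rewrite sqr_ge0/=.
  have st : `|sin (t p)| <= t p.
    rewrite ler_norml sin_le// andbT; have [h|h] := leP (t p) 1.
      by have := sin_ge3 (t0 p); have := t0 p; nra.
    by rewrite lerNl; have := sin_geN1 (t p); lra.
  rewrite /u -[sin _ ^+ 2]real_normK ?num_real//.
  apply: (@le_trans _ _ (t p ^+ 2)); last by rewrite expr2.
  by rewrite lerXn2r ?nnegrE.
have E p : cos (pi * y / (l p)%:R) ^+ (2 * m p) = (1 - u p) ^+ m p.
  by rewrite exprM cos2sin2.
under eq_fun do rewrite E.
apply: (@squeeze_cvgr _ _ _ _ (fun p => expR (- ((m p)%:R * u p / (1 - u p)))) (fun p => expR (- ((m p)%:R * u p)))).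
- move/cvgrPdist_lt : cvu => /(_ 1 ltr01); apply: filterS => p.
  rewrite sub0r normrN ger0_norm ?sqr_ge0// => u1.
  have u1' : 0 < 1 - u p by rewrite subr_gt0.
  apply/andP; split.
    rewrite -mulrA -mulrN expRM_natl lerXn2r ?nnegrE ?expR_ge0 ?(ltW u1')//.
    rewrite expRN -[leRHS]invrK lef_pV2 ?posrE ?invr_gt0 ?expR_gt0//.
    apply: le_trans (expR_ge1Dx _); rewrite le_eqVlt; apply/orP; left; apply/eqP.
    by field; rewrite gt_eqF.
  rewrite -[- (_ * u p)]mulrN expRM_natl lerXn2r ?nnegrE ?expR_ge0 ?(ltW u1')//.
  exact: expR_ge1Dx.
- apply: (continuous_cvg _ (@continuous_expR R _)).
  apply: cvgN; rewrite -[X in _ --> X]divr1 -[X in _ / X]subr0.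
  apply: cvgM cvmu _; apply: cvgV; first by rewrite subr0 oner_neq0.
  by apply: cvgB => //; exact: cvg_cst.
- apply: (continuous_cvg _ (@continuous_expR R _)).
  exact: cvgN.
Qed.

(** The majorant needed for [tannery], valid on one period; 16 is the square of the 4 in
    [sin_ge_quarter]. *)
Let cos_ub y p : `|y| <= (l p)%:R / 2 ->
  cos (pi * y / (l p)%:R) ^+ (2 * m p) <= expR (- (a / 16 * y ^+ 2)).
Proof.
wlog y0 : y / 0 <= y => [h|].
  have [/h//|/ltW y0] := leP 0 y.
  have := h (- y); rewrite oppr_ge0 sqrrN normrN => /(_ y0).
  by rewrite mulrN mulNr cosN.
rewrite ger0_norm// => yl.
set t := pi * y / _.
have t0 : 0 <= t <= pi / 2.
  rewrite divr_ge0 ?mulr_ge0 ?pi_ge0//= ler_pdivrMr// -mulrA ler_wpM2l ?pi_ge0//; lra.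
have st := sin_ge_quarter t0.
have /andP[t00 _] := t0.
rewrite exprM cos2sin2.
apply: (@le_trans _ _ (expR (- (sin t ^+ 2)) ^+ m p)).
  have h : 0 <= 1 - sin t ^+ 2 by rewrite -cos2sin2 sqr_ge0.
  by rewrite lerXn2r ?nnegrE ?expR_ge0// expR_ge1Dx.
rewrite -expRM_natl ler_expR mulrN lerN2.
apply: (@le_trans _ _ ((m p)%:R * (t / 4) ^+ 2)); last first.
  have s0 : 0 <= sin t by apply: le_trans st; rewrite divr_ge0.
  have t4 : 0 <= t / 4 by apply: divr_ge0.
  by rewrite ler_wpM2l// lerXn2r ?nnegrE.
have -> : (m p)%:R * (t / 4) ^+ 2 = mu p * (pi ^+ 2 * y ^+ 2 / 16).
  by rewrite /mu /t /il; field; rewrite gt_eqF.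
have -> : a / 16 * y ^+ 2 = A * (pi ^+ 2 * y ^+ 2 / 16).
  rewrite /A; have := @pi_gt0 R; generalize (@pi R) => P P0.
  by field; rewrite gt_eqF.
have /andP[h _] := mu_bounds p.
by rewrite ler_wpM2r// divr_ge0// mulr_ge0// sqr_ge0.
Qed.

(** The sample over one period extended by zero, so that all [p] share the index set of integers. *)
Let fcos x p (n : int) : R :=
  if (`|n| <= p)%N then cos (pi * (n%:~R + x) / (l p)%:R) ^+ (2 * m p) else 0.

Let hasum_fcos x p : hasum [set: int] (fcos x p) (cospow (m p) (l p) (x - p%:R)).
Proof.
have c0 t : 0 <= (cos t : R) ^+ (2 * m p) by rewrite exprM exprn_ge0// sqr_ge0.
apply/(@hasum_subset _ _ [set n : int | (`|n| <= p)%N]) => //.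
  by move=> n _ /negP/= /negbTE h; rewrite /fcos h.
have bij : set_bij [set: 'I_(l p)] [set n : int | (`|n| <= p)%N]
    (fun j : 'I_(l p) => j%:Z - p%:Z).
  split.
  - move=> j _ /=; have := ltn_ord j; rewrite /l; lia.
  - move=> i j _ _ e; apply/val_inj => /=; lia.
  - move=> n /= np; have b : (absz (n + p%:Z)%R < l p)%N by rewrite /l; lia.
    by exists (Ordinal b) => //=; lia.
apply/(hasum_bij _ _ bij).
have := @hasum_fin R _ (fun j : 'I_(l p) => cos (pi * (x - p%:R + j%:R) / (l p)%:R) ^+ (2 * m p)) (fun _ => c0 _).
apply: hasum_ext => j _ /=; rewrite /fcos ifT; last first.
  by have := ltn_ord j; rewrite /l; lia.
by congr (cos (_ * _ / _) ^+ _); rewrite rmorphB/= -!pmulrn; ring.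
Qed.

Let cvg_cospow x : `|x| <= 1 / 2 ->
  (fun p => cospow (m p) (l p) (x - p%:R)) @ \oo --> gsum a x.
Proof.
move=> x12; have a16 : 0 < a / 16 by rewrite divr_gt0.
apply: (tannery (hasum_fcos x) (hasum_gsum x a0) (hasum_gsum x a16)).
- move=> p n _; rewrite /fcos; case: ifP => [np|_]; last exact: expR_ge0.
  apply: cos_ub; apply: le_trans (ler_normD _ _) _.
  have : (`|n%:~R| : R) <= p%:R by rewrite -intr_norm -abszE -pmulrn ler_nat.
  rewrite /l -natr1 natrM; lra.
- move=> n _; have := @cvg_cos (n%:~R + x).
  apply: cvg_trans; apply: near_eq_cvg; exists `|n|%N => // p /= np.
  by rewrite /fcos np.
Qed.

Let cb (p : nat) : R := 'C(2 * m p, m p)%:R.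
Let cb0 p : 0 < cb p. Proof. by rewrite ltr0n bin_gt0; lia. Qed.

Let rbin p (k : int) : R := 'C(2 * m p, m p + l p * `|k|)%:R / cb p.

Let rbin0 p k : 0 <= rbin p k. Proof. by rewrite divr_ge0// ltW. Qed.

Let rbin_ub p k : rbin p k <= expR (- ((2 * (A + 1))^-1 * k%:~R ^+ 2)).
Proof.
rewrite ler_pdivrMr// mulrC.
have [h|h] := leqP (l p * `|k|)%N (m p); last first.
  by rewrite bin_small ?mulr_ge0 ?expR_ge0 ?(ltW (cb0 p))//; lia.
apply: le_trans (bin_central_ub _ _ h) _ => //.
rewrite ler_wpM2l ?(ltW (cb0 p))// ler_expR lerN2.
have -> : (k%:~R ^+ 2 : R) = `|k|%:R ^+ 2.
  by rewrite -[LHS]real_normK ?num_real// -intr_norm -abszE -pmulrn.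
have mR : 0 < (m p)%:R :> R by rewrite ltr0n.
have mm : mu p <= A + 1.
  have /andP[_ h2] := mu_bounds p; apply: le_trans h2 _.
  by rewrite lerD2l exprn_ile1 ?il1 ?(ltW (il0 p)).
have -> : (l p * `|k|)%:R ^+ 2 / (m p + m p)%:R = (2 * mu p)^-1 * `|k|%:R ^+ 2 :> R.
  by rewrite natrM natrD /mu /il; field; rewrite !gt_eqF//=; lra.
have mu0 : 0 < mu p by have /andP[+ _] := mu_bounds p; apply: lt_le_trans.
rewrite ler_wpM2r ?sqr_ge0// lef_pV2 ?posrE ?mulr_gt0 ?addr_gt0//.
by rewrite ler_wpM2l.
Qed.

(** Both binomial bounds are used with J = l |k|, which is negligible against m, of order l^2. *)
Let cvg_rbin k : (fun p => rbin p k) @ \oo --> expR (- (pi ^+ 2 / a * k%:~R ^+ 2)).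
Proof.
have -> : (k%:~R ^+ 2 : R) = `|k|%:R ^+ 2.
  by rewrite -[LHS]real_normK ?num_real// -intr_norm -abszE -pmulrn.
have -> : pi ^+ 2 / a = A^-1 by rewrite /A invf_div.
set K : R := `|k|%:R.
have K0 : 0 <= K by rewrite ler0n.
have cvK (e : R) : (fun p => expR (- (K ^+ 2 / (mu p + e * (K * il p))))) @ \oo -->
    expR (- (A^-1 * K ^+ 2)).
  apply: (continuous_cvg _ (@continuous_expR R _)).
  apply: cvgN; rewrite mulrC; apply: cvgM; first exact: cvg_cst.
  apply: cvgV; first by rewrite gt_eqF.
  rewrite -[X in _ --> X]addr0; apply: cvgD => //.
  rewrite -(mulr0 e); apply: cvgM; first exact: cvg_cst.
  by rewrite -(mulr0 K); apply: cvgM; [exact: cvg_cst|exact: cvg_il].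
have := cvK 1; have := cvK (- 1); apply: squeeze_cvgr.
have cKi : (fun p => K * il p) @ \oo --> 0.
  by rewrite -(mulr0 K); apply: cvgM; [exact: cvg_cst|exact: cvg_il].
move/cvgrPdist_lt : cKi => /(_ A A0); apply: filterS => p.
have Ki0 : 0 <= K * il p by rewrite mulr_ge0// ltW.
rewrite sub0r normrN ger0_norm// => KA.
have /andP[muA _] := mu_bounds p.
have Im : (l p * `|k| < m p)%N.
  rewrite -(ltr_nat R) natrM.
  have -> : (l p)%:R * `|k|%:R = (K * il p) * (l p)%:R ^+ 2.
    by rewrite /K /il; field; rewrite gt_eqF.
  have -> : (m p)%:R = mu p * (l p)%:R ^+ 2 by rewrite /mu /il; field; rewrite gt_eqF.
  by rewrite ltr_pM2r ?exprn_gt0// (lt_le_trans KA).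
have mR : (m p)%:R = mu p * (l p)%:R ^+ 2 by rewrite /mu /il; field; rewrite gt_eqF.
have IR : (l p * `|k|)%:R = (K * il p) * (l p)%:R ^+ 2 :> R.
  by rewrite natrM /K /il; field; rewrite gt_eqF.
have scal (d : R) : (K * il p * (l p)%:R ^+ 2) ^+ 2 / (d * (l p)%:R ^+ 2) = K ^+ 2 / d.
  have -> : K * il p * (l p)%:R ^+ 2 = K * (l p)%:R.
    by rewrite expr2 mulrA -(mulrA K) ill mulr1.
  by rewrite exprMn -mulf_div divff ?mulr1// expf_neq0// gt_eqF.
have d1 : mu p + -1 * (K * il p) != 0 by rewrite gt_eqF//; lra.
have d2 : mu p + 1 * (K * il p) != 0 by rewrite gt_eqF//; lra.
apply/andP; split.
  rewrite ler_pdivlMr// mulrC.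
  apply: le_trans (bin_central_lb R Im (leqnn _)).
  rewrite le_eqVlt; apply/orP; left; apply/eqP; congr (_ * expR (- _)).
  by rewrite natrB ?(ltnW Im)// IR mR -mulrBl scal// mulN1r.
rewrite ler_pdivrMr// mulrC.
have mp0 : (0 < m p + l p * `|k|)%N by [].
apply: le_trans (bin_central_ub R mp0 (leqnn _)) _.
rewrite le_eqVlt; apply/orP; left; apply/eqP; congr (_ * expR (- _)).
by rewrite natrD IR mR -mulrDl scal// mul1r.
Qed.

(** Poisson summation for the shifts [x] and 0 together, and with the constant [L] of [cvg_cbin]
    still unknown. *)
Lemma poisson_raw (L : R) : (fun n => n%:R * cbin R n ^+ 2) @ \oo --> L ->
  forall x, `|x| <= 1 / 2 ->
  gsum a x + gsum a 0 = Num.sqrt (pi ^+ 2 / a * L) *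
    (gsum (pi ^+ 2 / a) 0 + gcos (pi ^+ 2 / a) x).
Proof.
move=> cvL x x12; set b := pi ^+ 2 / a.
have b0 : 0 < b by rewrite divr_gt0.
have lhs : (fun p => cospow (m p) (l p) (x - p%:R) + cospow (m p) (l p) (0 - p%:R))
    @ \oo --> gsum a x + gsum a 0.
  by apply: cvgD; apply: cvg_cospow => //; rewrite normr0.
have cge (t : R) : 0 <= 1 + cos t by have := cos_geN1 t; lra.
have A1 : 0 < (2 * (A + 1))^-1 by rewrite invr_gt0 mulr_gt0// addr_gt0.
have hr p : hasum [set: int] (fun k => rbin p k * (1 + cos (2 * pi * k%:~R * x)))
    ((cb p)^-1 * (4 ^+ m p / (l p)%:R * (cospow (m p) (l p) (x - p%:R) + cospow (m p) (l p) (0 - p%:R)))).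
  have := hasumZ (ltW (_ : 0 < (cb p)^-1)) (hasum_bin (m p) p x).
  rewrite invr_gt0 cb0 sub0r => /(_ isT).
  by apply: hasum_ext => k _; rewrite mulrA /rbin [_ / _]mulrC.
have rhs : (fun p => (cb p)^-1 * (4 ^+ m p / (l p)%:R * (cospow (m p) (l p) (x - p%:R) + cospow (m p) (l p) (0 - p%:R))))
    @ \oo --> gsum b 0 + gcos b x.
  apply: (tannery hr (hasum_gcosE x b0) (hasumZ (ler0n R 2) (hasum_gsum 0 A1))).
    move=> p k _; rewrite addr0 [leLHS]mulrC; apply: ler_pM (cge _) (rbin0 _ _) _ (rbin_ub _ _).
    by have := cos_le1 (2 * pi * k%:~R * x); lra.
  by move=> k _; apply: cvgM (cvg_cst _); exact: cvg_rbin.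
(* The factor l C(2m, m) / 4^m between the two finite sides, written through quantities whose limits
   are known. *)
pose w p := Num.sqrt ((mu p)^-1 * ((m p)%:R * cbin R (m p) ^+ 2)).
have wE p : w p = (l p)%:R * cb p / 4 ^+ m p.
  rewrite /w; have -> : (mu p)^-1 * ((m p)%:R * cbin R (m p) ^+ 2) = ((l p)%:R * cb p / 4 ^+ m p) ^+ 2.
    rewrite /mu /cbin /il /cb; field.
    by rewrite !gt_eqF//= ?exprn_gt0// ltr0n.
  by rewrite sqrtr_sqr ger0_norm// divr_ge0// mulr_ge0// ltW.
have cvm : m @ \oo --> \oo.
  apply/cvgnyPge => N; near=> p.
  rewrite -(ler_nat R).
  have -> : (m p)%:R = mu p * (l p)%:R ^+ 2 by rewrite /mu /il; field; rewrite gt_eqF.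
  have /andP[muA _] := mu_bounds p.
  apply: (@le_trans _ _ (A * (l p)%:R ^+ 2)); last by rewrite ler_wpM2r// sqr_ge0.
  rewrite -ler_pdivrMl//.
  apply: (@le_trans _ _ (p%:R)).
    by near: p; exact: nbhs_infty_ger.
  rewrite -natrX ler_nat /l; nia.
have cvw : w @ \oo --> Num.sqrt (A^-1 * L).
  apply: (continuous_cvg _ (@sqrt_continuous R _)).
  apply: cvgM; first by apply: cvgV => //; rewrite gt_eqF.
  exact: (cvg_comp _ _ cvm cvL).
have := cvgM cvw rhs.
have -> : A^-1 = b by rewrite /A invf_div.
have -> : w \* (fun p => (cb p)^-1 * (4 ^+ m p / (l p)%:R * (cospow (m p) (l p) (x - p%:R) + cospow (m p) (l p) (0 - p%:R)))) =
  (fun p => cospow (m p) (l p) (x - p%:R) + cospow (m p) (l p) (0 - p%:R)).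
  apply/funext => p /=; rewrite wE; field.
  by rewrite (lt0r_neq0 (l0 p)) (lt0r_neq0 (cb0 p)) expf_neq0.
by move=> h; apply: (cvg_unique _ lhs (h _)).
Unshelve. all: by end_near. Qed.

End PoissonLimit.

(** * Poisson summation for Gaussians *)

Section Poisson.
Variable R : realType.

Lemma gcosDz b x (z : int) : gcos b (x + z%:~R) = gcos b x :> R.
Proof.
rewrite /gcos; congr (fine _ - _); apply: eq_esum => k _; congr (_ * (1 + _))%:E.
by rewrite -[RHS](cosD2piz _ (k * z)); congr cos; rewrite intrM; ring.
Qed.

(** At [x = 0] the raw formula counts everything twice, so it can be subtracted to isolate the shift
    [x]; other shifts follow by periodicity. *)
Theorem poisson (a x : R) : 0 < a ->
  gsum a x = Num.sqrt (pi / a) * gcos (pi ^+ 2 / a) x.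
Proof.
move=> a0; have [L [L0 cvL]] := cvg_cbin R.
have pi0 := @pi_gt0 R.
have P (c y : R) : 0 < c -> `|y| <= 1 / 2 ->
    gsum c y = Num.sqrt (pi ^+ 2 / c * L) * gcos (pi ^+ 2 / c) y.
  move=> c0 y12; have b0 : 0 < pi ^+ 2 / c by rewrite divr_gt0// exprn_gt0.
  have h0 := poisson_raw c0 cvL (_ : `|0| <= 1 / 2).
  have {}h0 : gsum c 0 = Num.sqrt (pi ^+ 2 / c * L) * gsum (pi ^+ 2 / c) 0.
    have := h0; rewrite normr0 gcos0// => /(_ _); lra.
  have := poisson_raw c0 cvL y12; rewrite mulrDr; lra.
(* At the self-dual parameter pi both sides contain the same positive theta value, which forces the
   prefactor to be 1. *)
have piL : pi * L = 1.
  have := P pi 0 pi0; rewrite normr0 => /(_ _).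
  have -> : pi ^+ 2 / pi = pi :> R by rewrite expr2 mulfK// gt_eqF.
  rewrite gcos0// => /(_ ltac:(lra)) h.
  have g1 := gsum0_gt1 pi0.
  have s1 : Num.sqrt (pi * L) = 1.
    apply: (mulIf (_ : gsum pi 0 != 0)); first by rewrite gt_eqF// (lt_trans ltr01).
    by rewrite mul1r -h.
  by rewrite -[LHS]sqr_sqrtr ?s1 ?expr1n// mulr_ge0 ?ltW.
have E : pi ^+ 2 / a * L = pi / a.
  rewrite -[RHS]mul1r -piL; generalize (@pi R) => P_; ring.
pose z : int := Num.floor (x + 1 / 2).
have /andP[z1 z2] := floor_itv (x + 1 / 2).
have y12 : `|x - z%:~R| <= 1 / 2.
  by rewrite ler_norml; move: z1 z2; rewrite intrD -/z; lra.
have -> : x = x - z%:~R + z%:~R by rewrite subrK.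
by rewrite gsumDz// gcosDz P// E.
Qed.

End Poisson.

(** * Theta series of binary quadratic forms and their duality *)

Section ThetaForms.
Variable R : realType.
Implicit Types (A B C D s x y : R).

Lemma gcos_le b x : 0 < b -> gcos b x <= gsum b 0.
Proof.
move=> b0; rewrite -(gcos0 b0) -(lerD2l (gsum b 0)).
apply: hasum_le (hasum_gcosE x b0) (hasum_gcosE 0 b0) => k _.
by rewrite mulr0 cos0 ler_wpM2l ?expR_ge0// lerD2l cos_le1.
Qed.

(** On the dual side all coefficients are positive, so the sum is largest where every cosine equals
    1. *)
Lemma gsum_le0 s x : 0 < s -> gsum s x <= gsum s 0.
Proof.
move=> s0; rewrite !poisson//; set b := pi ^+ 2 / s.
have b0 : 0 < b by rewrite divr_gt0// exprn_gt0// pi_gt0.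
by rewrite ler_wpM2l ?sqrtr_ge0// gcos0 ?gcos_le.
Qed.

Definition qform A B C x y : R := A * x ^+ 2 + 2 * B * x * y + C * y ^+ 2.

Definition qsum A B C x y : R :=
  fine (\esum_(k in [set: int * int])
    (expR (- qform A B C (k.1%:~R + x) (k.2%:~R + y)))%:E).

Lemma qformE A B C x y : 0 < C ->
  qform A B C x y = (A * C - B ^+ 2) / C * x ^+ 2 + C * (y + B / C * x) ^+ 2.
Proof. by move=> C0; rewrite /qform; field; rewrite gt_eqF. Qed.

Lemma setT_sigX (T U : Type) : [set: T * U] = [set: T] `*`` (fun=> [set: U]).
Proof. by apply/seteqP; split. Qed.

(** Completing the square turns each row into a one-dimensional theta value, at most [gsum C 0],
    leaving a Gaussian sum over the rows. *)
Lemma hasum_qsum_ex A B C x y : 0 < C -> 0 < A * C - B ^+ 2 ->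
  exists2 S, hasum [set: int * int]
    (fun k => expR (- qform A B C (k.1%:~R + x) (k.2%:~R + y))) S &
  hasum [set: int] (fun m => expR (- ((A * C - B ^+ 2) / C * (m%:~R + x) ^+ 2)) *
      gsum C (y + B / C * (m%:~R + x))) S.
Proof.
move=> C0 D0; set D := A * C - _.
have DC : 0 < D / C by rewrite divr_gt0.
have [|S hS] := hasum_cmp (f := fun m : int => expR (- (D / C * (m%:~R + x) ^+ 2)) *
    gsum C (y + B / C * (m%:~R + x))) _ (hasumZ (gsum_ge0 0 C0) (hasum_gsum x DC)).
  move=> m _; rewrite mulr_ge0 ?expR_ge0 ?gsum_ge0//= mulrC.
  by rewrite ler_wpM2r ?expR_ge0// gsum_le0.
exists S => //; rewrite setT_sigX.
have := (@hasum_pair R _ _ setT (fun=> setT) (fun m n : int => expR (- qform A B C (m%:~R + x) (n%:~R + y))) _ S _).1 hS.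
apply=> m _; have := hasumZ (expR_ge0 (- (D / C * (m%:~R + x) ^+ 2))) (hasum_gsum (y + B / C * (m%:~R + x)) C0).
apply: hasum_ext => n _; rewrite -expRD qformE// -/D; congr expR; ring.
Qed.

Lemma hasum_qsum A B C x y : 0 < C -> 0 < A * C - B ^+ 2 ->
  hasum [set: int * int]
    (fun k => expR (- qform A B C (k.1%:~R + x) (k.2%:~R + y))) (qsum A B C x y).
Proof.
by move=> C0 D0; have [S h _] := hasum_qsum_ex x y C0 D0; rewrite /qsum h.2.
Qed.

Lemma hasum_qsumE A B C x y : 0 < C -> 0 < A * C - B ^+ 2 ->
  hasum [set: int] (fun m => expR (- ((A * C - B ^+ 2) / C * (m%:~R + x) ^+ 2)) *
      gsum C (y + B / C * (m%:~R + x))) (qsum A B C x y).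
Proof.
by move=> C0 D0; have [S h h'] := hasum_qsum_ex x y C0 D0; rewrite /qsum h.2.
Qed.

Lemma qsum_diag A C x y : 0 < A -> 0 < C -> qsum A 0 C x y = gsum A x * gsum C y.
Proof.
move=> A0 C0; have D0 : 0 < A * C - 0 ^+ 2 by rewrite expr0n subr0 mulr_gt0.
apply: hasum_uniq (hasum_qsumE x y C0 D0) _.
have := hasumZ (gsum_ge0 y C0) (hasum_gsum x A0); rewrite mulrC.
apply: hasum_ext => m _; rewrite expr0n subr0 mulfK ?gt_eqF// mul0r mul0r addr0.
by rewrite mulrC.
Qed.

(** Poisson summation in the row variable gives the double sum of exp (- d m^2 - b l^2) cos (2 pi l
    m B / C). Summed over [m] first and transformed back, it is the theta series of [k] times the
    form. In dimension two the inverse form is a multiple of the form itself after a quarter turn,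
    so no new form appears. [F] and [G] carry the extra 1 that makes the terms nonnegative. *)
Lemma qsum_duality A B C : 0 < C -> 0 < A * C - B ^+ 2 ->
  let k := pi ^+ 2 / (A * C - B ^+ 2) in
  qsum A B C 0 0 = Num.sqrt k * qsum (k * A) (k * B) (k * C) 0 0.
Proof.
move=> C0 D0; set D := A * C - B ^+ 2 => k; rewrite -/D in D0.
have pi0 := @pi_gt0 R.
have k0 : 0 < k by rewrite divr_gt0// exprn_gt0.
pose b := pi ^+ 2 / C; pose d := D / C.
have b0 : 0 < b by rewrite divr_gt0// exprn_gt0.
have d0 : 0 < d by rewrite divr_gt0.
have kC : 0 < k * C by rewrite mulr_gt0.
have kD : k * A * (k * C) - (k * B) ^+ 2 = k ^+ 2 * D by rewrite /D; ring.
have kD0 : 0 < k * A * (k * C) - (k * B) ^+ 2 by rewrite kD mulr_gt0// exprn_gt0.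
have h1 := hasum_qsumE 0 0 C0 D0.
have h2 := hasum_qsumE 0 0 kC kD0.
have kd : k ^+ 2 * D / (k * C) = b.
  rewrite /b /k; have := D0; have := pi0; generalize D (@pi R) => D' P P0 D'0; field.
  by rewrite !gt_eqF.
have kBC : k * B / (k * C) = B / C by field; rewrite !gt_eqF.
rewrite -/D in h1; rewrite kD kd kBC in h2.
pose F (m l : int) := expR (- (d * m%:~R ^+ 2)) *
  (expR (- (b * l%:~R ^+ 2)) * (1 + cos (2 * pi * l%:~R * (B / C * m%:~R)))).
have sb : Num.sqrt (pi / C) != 0 by rewrite gt_eqF// sqrtr_gt0 divr_gt0.
have s1 (m : int) : hasum [set: int] (F m) (expR (- (d * m%:~R ^+ 2)) * gsum b 0 +
   (Num.sqrt (pi / C))^-1 * (expR (- (d * (m%:~R + 0) ^+ 2)) * gsum C (0 + B / C * (m%:~R + 0)))).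
  have := hasumZ (expR_ge0 (- (d * m%:~R ^+ 2))) (hasum_gcosE (B / C * m%:~R) b0).
  rewrite [X in hasum _ _ X]mulrDr => h; apply: (hasum_eq _ h); congr (_ + _).
  rewrite addr0 add0r poisson// -/b; field; exact: sb.
have s1' := hasumD (hasumZ (gsum_ge0 0 b0) (hasum_gsum 0 d0))
  (hasumZ (ltW (_ : 0 < (Num.sqrt (pi / C))^-1)) h1).
have {s1'}S1 : hasum [set: int * int] (fun k => F k.1 k.2)
   (gsum b 0 * gsum d 0 + (Num.sqrt (pi / C))^-1 * qsum A B C 0 0).
  rewrite setT_sigX.
  apply: (@hasum_pair R _ _ setT (fun=> setT) F _ _ (fun m _ => s1 m)).1.
  rewrite invr_gt0 sqrtr_gt0 divr_gt0// in s1'.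
  by apply: hasum_ext (s1' isT) => m _; rewrite [gsum b 0 * _]mulrC !addr0.
pose G (l m : int) := F m l.
have pd : Num.sqrt (pi / (k * C)) != 0 by rewrite gt_eqF// sqrtr_gt0 divr_gt0.
have s2 (l : int) : hasum [set: int] (G l) (expR (- (b * l%:~R ^+ 2)) * gsum d 0 +
   (Num.sqrt (pi / (k * C)))^-1 * (expR (- (b * (l%:~R + 0) ^+ 2)) * gsum (k * C) (0 + B / C * (l%:~R + 0)))).
  have := hasumZ (expR_ge0 (- (b * l%:~R ^+ 2))) (hasum_gcosE (B / C * l%:~R) d0).
  rewrite [X in hasum _ _ X]mulrDr => h; apply: (@hasum_ext _ _ _ (fun m : int => expR (- (b * l%:~R ^+ 2)) * (expR (- (d * m%:~R ^+ 2)) *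
           (1 + cos (2 * pi * m%:~R * (B / C * l%:~R)))))).
    move=> m _; rewrite /G /F mulrCA; congr (_ * (_ * (1 + cos _))); ring.
  apply: (hasum_eq _ h); congr (_ + _).
  rewrite addr0 add0r poisson//.
  have -> : pi ^+ 2 / (k * C) = d.
    rewrite /d /k; have := D0; have := pi0; generalize D (@pi R) => D' P P0 D'0.
    by field; rewrite !gt_eqF.
  by field.
have s2' := hasumD (hasumZ (gsum_ge0 0 d0) (hasum_gsum 0 b0))
  (hasumZ (ltW (_ : 0 < (Num.sqrt (pi / (k * C)))^-1)) h2).
have {s2'}S2 : hasum [set: int * int] (fun k => G k.1 k.2)
   (gsum d 0 * gsum b 0 + (Num.sqrt (pi / (k * C)))^-1 * qsum (k * A) (k * B) (k * C) 0 0).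
  rewrite setT_sigX.
  apply: (@hasum_pair R _ _ setT (fun=> setT) G _ _ (fun m _ => s2 m)).1.
  rewrite invr_gt0 sqrtr_gt0 divr_gt0// in s2'.
  by apply: hasum_ext (s2' isT) => m _; rewrite [gsum d 0 * _]mulrC !addr0.
have sw : set_bij [set: int * int] [set: int * int] (fun k : int * int => (k.2, k.1)).
  split=> // [[a a'] [c c'] _ _ /= [-> ->]//|[a c] _]; by exists (c, a).
have := hasum_uniq S2 ((hasum_bij _ _ sw).1 S1).
rewrite [gsum d 0 * _]mulrC => /addrI e.
apply: (mulfI (invr_neq0 sb)); rewrite -e mulrA; congr (_ * _).
have -> : pi / (k * C) = (pi / C) / k by field; rewrite !gt_eqF.
rewrite [in LHS]sqrtrM ?sqrtrV; last by rewrite divr_ge0 ?ltW.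
  by rewrite invfM invrK.
exact: ltW.
Qed.

End ThetaForms.

(** * The tangent bound for the Gaussian *)

Section ExpInequalities.
Variable R : realType.
Implicit Types (s t x y z : R).

(* Both sides agree at [s = 0] and the left-hand side is convex in [s], so
   the case [s = 13/10] suffices. *)
Lemma expR_linear_convex (s0 s u k : R) : 0 < s0 <= s ->
  1 + s0 * k <= expR (s0 * u) -> 1 + s * k <= expR (s * u).
Proof.
move=> /andP[s00 s0s] h; have sp := lt_le_trans s00 s0s.
have t01 : 0 <= s0 / s <= 1.
  by apply/andP; split; [rewrite divr_ge0 ?ltW|rewrite ler_pdivrMr// mul1r].
have := expR_convex (s * u) t01.
have -> : s0 / s * (s * u) = s0 * u by field; rewrite gt_eqF.
move=> h2; have h3 := le_trans h h2.
have h4 : s0 / s * (1 + s * k) <= s0 / s * expR (s * u).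
  have -> : s0 / s * (1 + s * k) = s0 / s + s0 * k by field; rewrite gt_eqF.
  lra.
by rewrite ler_pM2l ?divr_gt0// in h4.
Qed.

(** For p = 2 s v < 1 one has s v^2 < p^2 / 2 because 2 s > 1, which gives strictness; the rest is
    that (1 - p) exp (p + p^2 / 2) decreases from 1. *)
Lemma gauss_tangent_right s v : 13 / 10 <= s -> 0 < v ->
  1 - 2 * s * v < expR (- (s * (2 * v + v ^+ 2))).
Proof.
move=> s1 v0; have [h|h] := leP 1 (2 * s * v).
  by apply: le_lt_trans (expR_gt0 _); lra.
set p := 2 * s * v in h *.
have s0 : 0 < s by lra.
have p0 : 0 <= p by rewrite !mulr_ge0// ltW.
have e : s * v ^+ 2 < p ^+ 2 / 2.
  rewrite /p (_ : (2 * s * v) ^+ 2 / 2 = (2 * s) * (s * v ^+ 2)); last by field.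
  by rewrite ltr_pMl ?mulr_gt0 ?exprn_gt0//; lra.
apply: (@le_lt_trans _ _ (expR (- (p + p ^+ 2 / 2)))); last first.
  by rewrite ltr_expR ltrN2 mulrDr mulrCA mulrA -/p ltrD2l.
rewrite expRN -[leLHS]invrK lef_pV2 ?posrE ?invr_gt0 ?expR_gt0//; last by lra.
have := @le_of_derive R (fun p => - ((1 - p) * expR (p + p ^+ 2 / 2)))
  (fun p => p ^+ 2 * expR (p + p ^+ 2 / 2)) 0 p p0.
rewrite expr0n/= mul0r addr0 expR0 subr0 mulr1 => H.
suff : -1 <= - ((1 - p) * expR (p + p ^+ 2 / 2)).
  by rewrite lerN2 mulrC => ?; rewrite -[leRHS]mul1r ler_pdivlMr//; lra.
apply: H => [y _|y _]; last by rewrite mulr_ge0 ?sqr_ge0 ?expR_ge0.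
pose g : R -> R := (@id R) + 2^-1 \*: ((@id R) ^+ 2).
have -> : (fun p => - ((1 - p) * expR (p + p ^+ 2 / 2))) =
    - ((cst 1 - id) * (expR \o g)).
  apply/funext => z /=; rewrite !fctE /=; congr (- (_ * expR _)).
  by rewrite /g [RHS]/(z + 2^-1 * z ^+ 2) [_ / 2]mulrC.
apply: is_derive_eq; rewrite /= /GRing.scale/=.
have -> : g y = y + y ^+ 2 / 2 by rewrite [LHS]/(y + 2^-1 * y ^+ 2) [_ / 2]mulrC.
rewrite !fctE /=.
by field.
Qed.

(** The line is the tangent at [x = 1]. The tight place is [x = 0], where the claim reads 1 + 2 s <=
    exp s. For [x <= 1] convexity in [s] leaves only s = 13/10, settled by a Taylor polynomial. *)
Lemma gauss_tangent s x : 13 / 10 <= s -> 0 <= x ->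
  1 - 2 * s * (x - 1) <= expR (- (s * (x ^+ 2 - 1))).
Proof.
move=> s1 x0; have [h|h] := ltP 1 x.
  have := @gauss_tangent_right s (x - 1) s1; rewrite subr_gt0 => /(_ h)/ltW.
  by rewrite (_ : 2 * (x - 1) + (x - 1) ^+ 2 = x ^+ 2 - 1)//; ring.
have -> : - (s * (x ^+ 2 - 1)) = s * (1 - x ^+ 2) by ring.
have -> : 1 - 2 * s * (x - 1) = 1 + s * (2 * (1 - x)) by ring.
apply: (@expR_linear_convex (13 / 10)); first by rewrite s1 divr_gt0.
set w := _ * (1 - x ^+ 2).
have w0 : 0 <= w by rewrite /w; nra.
apply: le_trans (expR_ge_taylor5 w).
pose y := (1 + x) / 2.
have y12 : 1 / 2 <= y <= 1 by rewrite /y; lra.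
have ew : w = 52 / 10 * y * (1 - y) by rewrite /w /y; field.
have -> : 13 / 10 * (2 * (1 - x)) = 52 / 10 * (1 - y) by rewrite /y; field.
(* A tangent of the convex right-hand side, rounded down, taken at w = 13/10, the largest value of
   [w], reached at [x = 0]. *)
have t1 : 39 / 100 + 317 / 1000 * w <= 1 / 2 + w / 6 + w ^+ 2 / 24 + w ^+ 3 / 120.
  have w13 : w <= 13 / 10 by rewrite ew; nra.
  have : 0 <= (w - 13 / 10) ^+ 2 by rewrite sqr_ge0.
  have : 0 <= w * (w - 13 / 10) ^+ 2 by rewrite mulr_ge0 ?sqr_ge0.
  nra.
have t2 : 1 <= 52 / 10 * y ^+ 2 * (39 / 100 + 317 / 1000 * w).
  rewrite ew; move: y12 => /andP[y1 y2].
  have h1 : 0 <= (y - 1 / 2) * (1 - y) by apply: mulr_ge0; lra.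
  have h2 : 0 <= (y - 1 / 2) * (1 - y) * y by apply: mulr_ge0 => //; lra.
  have h3 : 0 <= (y - 1 / 2) * (1 - y) * y ^+ 2 by apply: mulr_ge0 => //; rewrite sqr_ge0.
  nra.
(* Multiplied by 52/10 (1 - y)^2, this is the claim with exp w replaced by its Taylor minorant. *)
have t3 : 1 <= 52 / 10 * y ^+ 2 * (1 / 2 + w / 6 + w ^+ 2 / 24 + w ^+ 3 / 120).
  apply: le_trans t2 _; rewrite ler_wpM2l// mulr_ge0 ?sqr_ge0//; lra.
have y1 : 0 <= 1 - y by lra.
have y2 : 0 <= 52 / 10 * (1 - y) ^+ 2 by rewrite mulr_ge0 ?sqr_ge0.
have := ler_wpM2l y2 t3; set T := (1 / 2 + _ + _ + _).
have -> : 52 / 10 * (1 - y) ^+ 2 * (52 / 10 * y ^+ 2 * T) = w ^+ 2 * T.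
  by rewrite ew; ring.
have -> : 1 + w + w ^+ 2 / 2 + w ^+ 3 / 6 + w ^+ 4 / 24 + w ^+ 5 / 120 =
  1 + w + w ^+ 2 * T by rewrite /T; field.
rewrite mulr1 [in 1 + w]ew; lra.
Qed.

End ExpInequalities.

(** * Three exponentials with prescribed mean and spread *)

Section ThreeExp.
Variable R : realType.
Implicit Types (x y z l t K e : R).

Definition taylor5 x : R := 1 + x + x ^+ 2 / 2 + x ^+ 3 / 6 + x ^+ 4 / 24 + x ^+ 5 / 120.

(** For zero sum, the power sums are polynomials in the other two elementary symmetric functions;
    [K] is 2/3 of the sum of squares. *)
Lemma taylor5_sum x y z : x + y + z = 0 ->
  let K := - (4 / 3) * (x * y + y * z + z * x) in let e := x * y * z in
  taylor5 x + taylor5 y + taylor5 z =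
    3 + 3 / 4 * K + e / 2 + 9 / 8 * K ^+ 2 / 24 + K * e / 32.
Proof.
move=> xyz K e; have -> : z = - x - y by lra.
rewrite /K /e /taylor5; have -> : z = - x - y by lra.
by field.
Qed.

(** The cubic with roots [x], [y], [z] has nonnegative discriminant, so e^2 <= K^3 / 16; the
    inequality of means then replaces K^(3/2) by a polynomial. *)
Lemma three_disc x y z : x + y + z = 0 ->
  let K := - (4 / 3) * (x * y + y * z + z * x) in
  0 <= K -> - ((K + K ^+ 2 / 4) / 4) <= x * y * z.
Proof.
move=> xyz K K0; set e := x * y * z.
have D : 0 <= ((x - y) * (y - z) * (z - x)) ^+ 2 by rewrite sqr_ge0.
have E : ((x - y) * (y - z) * (z - x)) ^+ 2 = 27 / 16 * K ^+ 3 - 27 * e ^+ 2.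
  by rewrite /K /e (_ : z = - x - y); [field|lra].
have h : e ^+ 2 <= ((K + K ^+ 2 / 4) / 4) ^+ 2.
  have : 0 <= (K - K ^+ 2 / 4) ^+ 2 by rewrite sqr_ge0.
  move: D; rewrite E; nra.
have h0 : 0 <= (K + K ^+ 2 / 4) / 4 by rewrite divr_ge0 ?addr_ge0 ?divr_ge0 ?sqr_ge0.
set M := (K + K ^+ 2 / 4) / 4 in h h0 *.
by rewrite leNgt; apply/negP => h3; nra.
Qed.

(** The numbers stand for the values of a form on an orbit of the rotation of order three, relative
    to the hexagonal value. Their mean is [l], and equality of discriminants prescribes their
    spread. To first order in d = l - 1 the larger mean costs a factor 1 - 3.5 d while the spread
    gains 1 + 5.1 d. *)
Lemma three_exp_base x y z l : 1 < l <= 6 / 5 -> x + y + z = 3 * l ->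
  x * y + y * z + z * x = (9 * l ^+ 2 + 3) / 4 ->
  3 < expR (- (7 / 2 * (x - 1))) + expR (- (7 / 2 * (y - 1))) + expR (- (7 / 2 * (z - 1))).
Proof.
move=> /andP[l1 l2] s1 s2.
pose d := l - 1; have d0 : 0 < d by rewrite subr_gt0.
have d5 : d <= 1 / 5 by rewrite /d; lra.
pose x' := - (7 / 2 * (x - l)); pose y' := - (7 / 2 * (y - l)); pose z' := - (7 / 2 * (z - l)).
have xyz' : x' + y' + z' = 0 by rewrite /x' /y' /z'; lra.
pose K := 49 / 4 * (2 * d + d ^+ 2).
have eK : - (4 / 3) * (x' * y' + y' * z' + z' * x') = K.
  have -> : x' * y' + y' * z' + z' * x' =
    49 / 4 * ((x * y + y * z + z * x) - 2 * l * (x + y + z) + 3 * l ^+ 2).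
    by rewrite /x' /y' /z'; field.
  by rewrite s1 s2 /K /d; field.
have K0 : 0 <= K by rewrite /K; nra.
have K27 : K <= 27 * d by rewrite /K; nra.
have T := taylor5_sum xyz'; have := three_disc xyz'; rewrite /= eK in T * => /(_ K0).
set e := x' * y' * z' in T * => he.
have Ps : 3 * (1 + 51 / 10 * d + 3 / 2 * d ^+ 2) <= taylor5 x' + taylor5 y' + taylor5 z'.
  rewrite T.
  have h1 : K * - ((K + K ^+ 2 / 4) / 4) <= K * e by rewrite ler_wpM2l.
  (* Since K <= 27 d <= 27/5, the factor [4 - K] is at least - 7/5. *)
  have h2 : - (7 / 5) * K ^+ 2 <= K ^+ 2 * (4 - K).
    by rewrite mulrC ler_wpM2l ?sqr_ge0//; lra.
  have h3 : K ^+ 2 <= (27 * d) ^+ 2 by rewrite lerXn2r ?nnegrE//; lra.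
  have h4 : 3 + 3 / 4 * K - ((K + K ^+ 2 / 4) / 4) / 2 + 9 / 8 * K ^+ 2 / 24 + K * - ((K + K ^+ 2 / 4) / 4) / 32 =
     3 * (1 + 5 / 24 * K + K ^+ 2 * (4 - K) / 1536) by field.
  have h5 : 5 / 24 * K = 5 / 24 * (49 / 4) * (2 * d + d ^+ 2) by rewrite /K; ring.
  have d2 : 0 <= d ^+ 2 by rewrite sqr_ge0.
  have h3' : K ^+ 2 <= 729 * d ^+ 2 by apply: le_trans h3 _; rewrite exprMn; lra.
  lra.
pose w := 7 / 2 * d.
have hw : 1 - w + w ^+ 2 / 2 - w ^+ 3 / 6 <= expR (- w).
  by have := expR_ge_taylor3 (- w); congr (_ <= _); ring.
have Q : 1 < (1 - w + w ^+ 2 / 2 - w ^+ 3 / 6) * (1 + 51 / 10 * d + 3 / 2 * d ^+ 2).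
  have -> : (1 - w + w ^+ 2 / 2 - w ^+ 3 / 6) * (1 + 51 / 10 * d + 3 / 2 * d ^+ 2) =
    1 + d * (8 / 5 - 409 / 40 * d + 2261 / 120 * d ^+ 2 - 4361 / 160 * d ^+ 3
      - 343 / 32 * d ^+ 4) by rewrite /w; field.
  rewrite ltrDl; apply: mulr_gt0; first exact: d0.
  have h3 : d ^+ 3 <= d / 25.
    rewrite (_ : d ^+ 3 = d ^+ 2 * d); last by ring.
    have d25 : d * d <= 1 / 5 * (1 / 5) by apply: ler_pM => //; apply: ltW.
    rewrite mulrC; apply: ler_wpM2l; [exact: ltW d0|rewrite expr2; lra].
  have h4 : d ^+ 4 <= d / 125.
    rewrite (_ : d ^+ 4 = d * d ^+ 3); last by ring.
    apply: ler_wpM2l; [exact: ltW d0|lra].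
  have h5 : 0 <= (d - 1 / 5) ^+ 2 by rewrite sqr_ge0.
  by lra.
have E (u : R) : expR (- (7 / 2 * (u - 1))) = expR (- w) * expR (- (7 / 2 * (u - l))).
  by rewrite -expRD; congr expR; rewrite /w /d; ring.
rewrite (E x) (E y) (E z) -!mulrDr.
apply: (@lt_le_trans _ _ (expR (- w) * (3 * (1 + 51 / 10 * d + 3 / 2 * d ^+ 2)))).
  rewrite mulrCA -[ltLHS]mulr1 ltr_pM2l//; apply: lt_le_trans Q _.
  by rewrite ler_wpM2r//; have := sqr_ge0 d; lra.
rewrite ler_wpM2l ?expR_ge0//; apply: le_trans Ps _.
by rewrite !lerD// expR_ge_taylor5.
Qed.

(** If [l = 1] the variance is zero and all three numbers are 1. Otherwise convexity along exp (- t
    (u - 1)) carries the strict bound from 7/2 to every larger [t]. *)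
Lemma three_exp x y z l t : 7 / 2 <= t -> 1 <= l <= 6 / 5 -> x + y + z = 3 * l ->
  x * y + y * z + z * x = (9 * l ^+ 2 + 3) / 4 ->
  3 <= expR (- (t * (x - 1))) + expR (- (t * (y - 1))) + expR (- (t * (z - 1)))
  ?= iff (l == 1).
Proof.
move=> t72 /andP[l1 l2] s1 s2; have [l11|l11] := eqVneq l 1.
  have h0 : (x - y) ^+ 2 + (y - z) ^+ 2 + (z - x) ^+ 2 = 0.
    have -> : (x - y) ^+ 2 + (y - z) ^+ 2 + (z - x) ^+ 2 =
      2 * ((x + y + z) ^+ 2 - 3 * (x * y + y * z + z * x)) by ring.
    by rewrite s1 s2 l11; field.
  have xy : x = y.
    apply/eqP; rewrite -subr_eq0 -sqrf_eq0; apply/eqP.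
    by have := sqr_ge0 (x - y); have := sqr_ge0 (y - z); have := sqr_ge0 (z - x); lra.
  have yz : y = z.
    apply/eqP; rewrite -subr_eq0 -sqrf_eq0; apply/eqP.
    by have := sqr_ge0 (x - y); have := sqr_ge0 (y - z); have := sqr_ge0 (z - x); lra.
  have [-> [-> ->]] : x = 1 /\ y = 1 /\ z = 1 by split; [|split]; lra.
  by rewrite subrr mulr0 oppr0 expR0; split; [lra|apply/eqP; ring].
have l1' : 1 < l by rewrite lt_neqAle eq_sym l11.
have := @three_exp_base x y z l; rewrite l1' l2 => /(_ isT s1 s2) h.
suff H : 3 < expR (- (t * (x - 1))) + expR (- (t * (y - 1))) + expR (- (t * (z - 1))).
  by split; [exact: ltW|rewrite lt_eqF].
have t0 : 0 < t by lra.
pose r := 7 / 2 / t.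
have r0 : 0 < r by rewrite divr_gt0.
have r01 : 0 <= r <= 1 by rewrite (ltW r0)/= ler_pdivrMr// mul1r.
have E (u : R) : expR (- (7 / 2 * (u - 1))) <= (1 - r) + r * expR (- (t * (u - 1))).
  have := expR_convex (- (t * (u - 1))) r01; congr (expR _ <= _).
  by rewrite /r; field; rewrite gt_eqF.
have := E x; have := E y; have := E z => e1 e2 e3.
rewrite -subr_gt0 -(pmulr_rgt0 _ r0); lra.
Qed.

End ThreeExp.

(** * Upper bound for the hexagonal theta series *)

Section HexSum.
Variable R : realType.
Implicit Types (A B C X s x y : R).

Lemma hasum_parity (f : int -> R) S0 S1 :
  hasum [set: int] (fun n => f (2 * n)) S0 ->
  hasum [set: int] (fun n => f (2 * n + 1)) S1 -> hasum [set: int] f (S0 + S1).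
Proof.
move=> h0 h1.
have b0 : set_bij [set: int] [set n | (2 %| n)%Z] (fun n : int => 2 * n).
  split=> [n _|m n _ _ |n /dvdzP[k ->]] /=; first by rewrite dvdz_mulr.
    by move=> /mulfI; apply.
  by exists k => //; rewrite mulrC.
have b1 : set_bij [set: int] [set n | ~~ (2 %| n)%Z] (fun n : int => 2 * n + 1).
  split=> [n _|m n _ _ /addIr/mulfI|n /= nd]; first by rewrite /=; lia.
    by apply.
  by exists ((n %/ 2)%Z) => //; lia.
pose f0 (n : int) := if (2 %| n)%Z then f n else 0.
pose f1 (n : int) := if (2 %| n)%Z then 0 else f n.
have k0 : hasum [set: int] f0 S0.
  apply/(@hasum_subset _ _ [set n | (2 %| n)%Z]) => //.
    by move=> n _ /negP; rewrite /f0/= => /negbTE ->.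
  apply/(hasum_bij _ _ b0); apply: hasum_ext h0 => n _.
  by rewrite /f0 dvdz_mulr.
have k1 : hasum [set: int] f1 S1.
  apply/(@hasum_subset _ _ [set n | ~~ (2 %| n)%Z]) => //.
    by move=> n _ /negP; rewrite /f1/= negbK => ->.
  apply/(hasum_bij _ _ b1); apply: hasum_ext h1 => n _.
  by rewrite /f1 ifF//; lia.
have := hasumD k0 k1; apply: hasum_ext => n _; rewrite /f0 /f1.
by case: ifP; rewrite ?addr0 ?add0r.
Qed.

(** The hexagonal lattice is a rectangular lattice together with its centres; parity of the first
    coordinate separates the two. *)
Lemma qsum_hex_split X x y : 0 < X -> qsum X (X / 2) X x y =
  gsum (3 * X) (x / 2) * gsum X (y + x / 2) +
  gsum (3 * X) ((x + 1) / 2) * gsum X (y + (x + 1) / 2).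
Proof.
move=> X0; have D : X * X - (X / 2) ^+ 2 = 3 / 4 * X ^+ 2 by field.
have D0 : 0 < X * X - (X / 2) ^+ 2 by rewrite D mulr_gt0// exprn_gt0.
have X3 : 0 < 3 * X by rewrite mulr_gt0.
apply: hasum_uniq (hasum_qsumE x y X0 D0) _; rewrite D.
have e1 : 3 / 4 * X ^+ 2 / X = 3 / 4 * X by field; rewrite gt_eqF.
have e2 : X / 2 / X = 1 / 2 by field; rewrite gt_eqF.
rewrite e1 e2; apply: hasum_parity.
  have := hasumZ (gsum_ge0 (y + x / 2) X0) (hasum_gsum (x / 2) X3).
  move=> h; apply: hasum_ext (hasum_eq (mulrC _ _) h) => m _; rewrite mulrC; congr (expR (- _) * _).
    by rewrite intrM; field.
  by rewrite -[LHS](gsumDz _ m)//; congr gsum; rewrite intrM; field.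
have := hasumZ (gsum_ge0 (y + (x + 1) / 2) X0) (hasum_gsum ((x + 1) / 2) X3).
move=> h; apply: hasum_ext (hasum_eq (mulrC _ _) h) => m _; rewrite mulrC; congr (expR (- _) * _).
  by rewrite intrD intrM; field.
by rewrite -[LHS](gsumDz _ m)//; congr gsum; rewrite intrD intrM; field.
Qed.

Lemma hasum_natS (f : nat -> R) S : 0 <= f 0%N ->
  hasum [set: nat] (fun n => f n.+1) S -> hasum [set: nat] f (f 0%N + S).
Proof.
move=> f0 h.
have b : set_bij [set: nat] ([set: nat] `\` [set` [:: 0%N]]) succn.
  split=> [n _|m n _ _ []//|[|n] [_]]; first by split => //; rewrite /= inE.
    by case; rewrite /= inE.
  by exists n.
apply/(@hasum_split _ _ _ [:: 0%N]) => //; split; last first.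
  by move=> i; rewrite inE => /eqP ->.
by rewrite big_seq1 addrC addKr; apply/(hasum_bij _ _ b).
Qed.

Let expR_exp s (n : nat) : expR (- (s * n%:R)) = expR (- s) ^+ n.
Proof. by rewrite -expRM_natl; congr expR; ring. Qed.

(** Geometric comparison through (n + 1)^2 >= 1 + 3 n. *)
Lemma gsum0_le s : 0 < s ->
  gsum s 0 <= 1 + 2 * expR (- s) / (1 - expR (- s) ^+ 3).
Proof.
move=> s0; set q := expR (- s).
have q1 : q < 1 by rewrite expR_lt1 oppr_lt0.
have q0 : 0 < q by exact: expR_gt0.
have q3 : 0 <= q ^+ 3 < 1 by rewrite exprn_ge0 ?ltW//= exprn_ilt1 ?ltW.
have h1 := hasumZ (ltW q0) (hasum_geometric q3).
have h2 := @hasum_natS (fun n => if n is n'.+1 then q * q ^+ 3 ^+ n' else 1) _ ler01 h1.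
have h := hasum_int h2 h1.
rewrite (_ : 1 + 2 * q / (1 - q ^+ 3) = 1 + q / (1 - q ^+ 3) + q / (1 - q ^+ 3)); last first.
  by field; move/andP: q3 => [_ ?]; lra.
apply: hasum_le (hasum_gsum 0 s0) h => -[[|n]|n] _; rewrite addr0.
- by rewrite expr0n mulr0 oppr0 expR0.
- rewrite -exprM -exprS -expR_exp ler_expR lerN2 ler_pM2l// -pmulrn -natrX ler_nat; nia.
- rewrite -exprM -exprS -expR_exp ler_expR lerN2 ler_pM2l// NegzE rmorphN/= sqrrN.
  rewrite -pmulrn -natrX ler_nat; nia.
Qed.

(** Geometric comparison through (n + 1/2)^2 >= 1/4 + 2 n. *)
Lemma gsum_half_le s : 0 < s ->
  gsum s (1 / 2) <= 2 * expR (- (s / 4)) / (1 - expR (- s) ^+ 2).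
Proof.
move=> s0; set q := expR (- s).
have q1 : q < 1 by rewrite expR_lt1 oppr_lt0.
have q0 : 0 < q by exact: expR_gt0.
have q3 : 0 <= q ^+ 2 < 1 by rewrite exprn_ge0 ?ltW//= exprn_ilt1 ?ltW.
have h1 := hasumZ (expR_ge0 (- (s / 4))) (hasum_geometric q3).
have h := hasum_int h1 h1; set r := expR (- (s / 4)) in h *.
rewrite (_ : 2 * r / (1 - q ^+ 2) = r / (1 - q ^+ 2) + r / (1 - q ^+ 2)); last first.
  by field; move/andP: q3 => [_ ?]; lra.
have E (n : nat) : expR (- (s * (n%:R + 1 / 2) ^+ 2)) <= r * q ^+ 2 ^+ n.
  rewrite -exprM -expR_exp -expRD ler_expR -opprD lerN2.
  have -> : s / 4 + s * (2 * n)%:R = s * (1 / 4 + (2 * n)%:R) by ring.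
  rewrite ler_pM2l// natrM; have : n%:R <= n%:R ^+ 2 :> R.
    by rewrite -natrX ler_nat; nia.
  lra.
apply: hasum_le (hasum_gsum (1 / 2) s0) h => -[n|n] _; first exact: E.
apply: le_trans (E n); rewrite ler_expR lerN2 ler_pM2l// NegzE rmorphN/= -natr1 -pmulrn.
by rewrite (_ : (- n.+1%:R + 1 / 2) ^+ 2 = (n%:R + 1 / 2) ^+ 2)// -natr1; field.
Qed.

(** Two of the six shortest vectors come from the unshifted product and four from the half-shifted
    one, as exp (- X / 4) exp (- 3 X / 4) = exp (- X). With exp (- X) <= 1/20 all other vectors fit
    into the remaining 0.05. *)
Lemma hex_le X : 3 <= X -> qsum X (X / 2) X 0 0 <= 1 + 605 / 100 * expR (- X).
Proof.
move=> X3; have X0 : 0 < X by lra.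
have XX : 0 < 3 * X by rewrite mulr_gt0.
set t := expR (- X).
have t0 : 0 < t by exact: expR_gt0.
have t20 : t <= 1 / 20.
  apply: (@le_trans _ _ (expR (- 3))); first by rewrite ler_expR lerN2.
  rewrite expRN div1r lef_pV2 ?posrE ?expR_gt0//.
  have -> : 3 = 3%:R * 1 :> R by rewrite mulr1.
  rewrite expRM_natl; have := expR_ge_taylor5 (1 : R).
  rewrite !expr1n => h.
  have h0 : 163 / 60 <= expR 1 :> R by lra.
  have : (163 / 60) ^+ 3 <= expR 1 ^+ 3 :> R by rewrite lerXn2r ?nnegrE ?expR_ge0//; lra.
  by apply: le_trans; lra.
rewrite qsum_hex_split// !mul0r !add0r.
have e3 : expR (- (3 * X)) = t ^+ 3 by rewrite -expRM_natl; congr expR; ring.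
have a1 := gsum0_le X0; have a2 := gsum0_le XX; have a3 := gsum_half_le X0; have a4 := gsum_half_le XX.
rewrite -/t e3 in a1 a2 a3 a4.
have p1 : expR (- (X / 4)) * expR (- (3 * X / 4)) = t by rewrite -expRD; congr expR; field.
have t2 : t ^+ 2 <= 1 / 400 by nra.
have t3 : t ^+ 3 <= t / 400 by rewrite exprS ler_wpM2l ?(ltW t0)//; lra.
have t30 : 0 <= t ^+ 3 by rewrite exprn_ge0// ltW.
have t9 : t ^+ 3 ^+ 3 <= 1 / 400.
  apply: (@le_trans _ _ (t ^+ 3)); last by nra.
  by rewrite -[leRHS]expr1 ler_wiXn2l//; nra.
have t6 : t ^+ 3 ^+ 2 <= 1 / 400.
  apply: (@le_trans _ _ (t ^+ 3)); last by nra.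
  by rewrite -[leRHS]expr1 ler_wiXn2l//; nra.
have inv (u v : R) : 0 <= u -> v <= 1 / 400 -> u / (1 - v) <= 400 / 399 * u.
  move=> u0 v1; rewrite ler_pdivrMr; last by lra.
  have v2 : 0 <= 1 / 400 - v by lra.
  by have := mulr_ge0 u0 v2; lra.
have b1 : gsum X 0 <= 1 + 400 / 399 * (2 * t).
  by apply: le_trans a1 _; rewrite lerD2l inv ?mulr_ge0 ?ltW//; nra.
have b2 : gsum (3 * X) 0 <= 1 + 400 / 399 * (2 * t ^+ 3).
  by apply: le_trans a2 _; rewrite lerD2l; apply: inv => //; apply: mulr_ge0.
have b3 : gsum X (1 / 2) <= 400 / 399 * (2 * expR (- (X / 4))).
  by apply: le_trans a3 _; apply: inv => //; apply: mulr_ge0 => //; exact: expR_ge0.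
have b4 : gsum (3 * X) (1 / 2) <= 400 / 399 * (2 * expR (- (3 * X / 4))).
  by apply: le_trans a4 _; apply: inv => //; apply: mulr_ge0 => //; exact: expR_ge0.
have c1 : gsum (3 * X) 0 * gsum X 0 <= (1 + 400 / 399 * (2 * t ^+ 3)) * (1 + 400 / 399 * (2 * t)).
  by rewrite ler_pM ?gsum_ge0.
have c2 : gsum (3 * X) (1 / 2) * gsum X (1 / 2) <=
    (400 / 399 * (2 * expR (- (3 * X / 4)))) * (400 / 399 * (2 * expR (- (X / 4)))).
  by rewrite ler_pM ?gsum_ge0.
have e : (400 / 399 * (2 * expR (- (3 * X / 4)))) * (400 / 399 * (2 * expR (- (X / 4)))) =
  (400 / 399) ^+ 2 * 4 * (expR (- (X / 4)) * expR (- (3 * X / 4))) by ring.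
rewrite e p1 in c2.
have t4 : t ^+ 3 * t <= t / 400 / 20.
  by rewrite mulrC; nra.
by nra.
Qed.

End HexSum.

(** * Optimality of the hexagonal form among reduced forms *)

Section Montgomery.
Variable R : realType.
Implicit Types (A B C X s x y : R).

Lemma qform0 A B C : qform A B C 0 0 = 0.
Proof. by rewrite /qform; ring. Qed.

(** The two vectors of value [A] contribute at least 2 exp (X / 3) exp (- X), and X / 3 > 1.11 makes
    the factor at least 6.06. *)
Lemma montgomery_short A B C X : 7 / 2 <= X -> 0 < C ->
  A * C - B ^+ 2 = 3 / 4 * X ^+ 2 -> A <= 2 / 3 * X ->
  qsum X (X / 2) X 0 0 < qsum A B C 0 0.
Proof.
move=> X72 C0 D AX; have X0 : 0 < X by lra.
apply: (le_lt_trans (hex_le _)); first by lra.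
have D0 : 0 < A * C - B ^+ 2 by rewrite D mulr_gt0// exprn_gt0.
have := @hasum_ge_seq R (int * int)%type setT [:: (0%:Z, 0%:Z); (1%:Z, 0%:Z); (-1%:Z, 0%:Z)] _ _ isT
  (fun _ _ => I) (hasum_qsum 0 0 C0 D0).
rewrite !big_cons big_nil /= !addr0 qform0 oppr0 expR0.
have -> : qform A B C 1%:~R 0 = A by rewrite /qform; ring.
have -> : qform A B C (-1%:Z)%:~R 0 = A by rewrite /qform; ring.
apply: lt_le_trans; rewrite ltrD2l.
have e : expR (111 / 100) * expR (- X) <= expR (- A).
  by rewrite -expRD ler_expR; lra.
have h := expR_ge_taylor5 (111 / 100 : R).
have x0 := expR_gt0 (- X).
have h2 : 303 / 100 <= expR (111 / 100 : R) by lra.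
by nra.
Qed.

(** The automorphism of order three of m^2 + m n + n^2. *)
Definition hexrot (k : int * int) : int * int := (- k.1 - k.2, k.1).

Lemma hexrot_bij : set_bij [set: int * int] [set: int * int] hexrot.
Proof.
split=> // [[m n] [m' n'] _ _ [] h /= mm|[m n] _].
  by congr (_, _) => //; move: h; rewrite mm => /= /addrI/oppr_inj.
by exists (n, - m - n) => //; rewrite /hexrot/=; congr (_, _); ring.
Qed.

(** On each orbit of [hexrot] the values of the form, divided by the hexagonal value, have the same
    mean [l] and the same second symmetric function, so [three_exp] compares orbit by orbit. Here
    [l >= 1], with equality only for the hexagonal form. *)
Lemma montgomery_near A B C X : 7 / 2 <= X -> 0 < C ->
  A * C - B ^+ 2 = 3 / 4 * X ^+ 2 -> 0 <= B -> B <= A ->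
  2 / 3 * X < A <= X ->
  (A = C /\ A = 2 * B) \/ qsum X (X / 2) X 0 0 < qsum A B C 0 0.
Proof.
move=> X72 C0 D B0 BA /andP[AX1 AX2]; have X0 : 0 < X by lra.
have D0 : 0 < A * C - B ^+ 2 by rewrite D mulr_gt0// exprn_gt0.
have DX : 0 < X * X - (X / 2) ^+ 2.
  by rewrite (_ : _ - _ = 3 / 4 * X ^+ 2) ?mulr_gt0 ?exprn_gt0//; field.
have A0 : 0 < A by lra.
pose l := 2 / (3 * X) * (A + C - B).
have lX : 3 * X * l = 2 * (A + C - B) by rewrite /l; field; rewrite gt_eqF.
have sq : (A + C - B) ^+ 2 - 3 * (A * C - B ^+ 2) =
  ((A - C) ^+ 2 + (A - 2 * B) ^+ 2 + (C - 2 * B) ^+ 2) / 2 by field.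
have sq' : (3 * X * l) ^+ 2 - (3 * X) ^+ 2 =
  2 * ((A - C) ^+ 2 + (A - 2 * B) ^+ 2 + (C - 2 * B) ^+ 2).
  rewrite lX; have -> : (2 * (A + C - B)) ^+ 2 = 4 * (A + C - B) ^+ 2 by ring.
  have -> : (3 * X) ^+ 2 = 12 * (3 / 4 * X ^+ 2) by field.
  by rewrite -D; lra.
have S0 : 0 < A + C - B by lra.
have l0 : 0 < l by rewrite /l mulr_gt0// divr_gt0// mulr_gt0.
have l1 : 1 <= l.
  have h : 0 <= (3 * X * l) ^+ 2 - (3 * X) ^+ 2.
    by rewrite sq' mulr_ge0// !addr_ge0 ?sqr_ge0.
  rewrite leNgt; apply/negP => h1.
  have : 3 * X * l < 3 * X by rewrite -[ltRHS]mulr1 ltr_pM2l ?mulr_gt0.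
  have h0 : 0 < 3 * X * l by apply: mulr_gt0 => //; apply: mulr_gt0.
  by move: h h0; move: (3 * X * l) (3 * X) => u v; nra.
have [l11|l11] := eqVneq l 1.
  left; move: sq'; rewrite l11 mulr1 subrr => h.
  have h1 := sqr_ge0 (A - C); have h2 := sqr_ge0 (A - 2 * B); have h3 := sqr_ge0 (C - 2 * B).
  have e1 : (A - C) ^+ 2 = 0 by lra.
  have e2 : (A - 2 * B) ^+ 2 = 0 by lra.
  by split; apply/eqP; rewrite -subr_eq0 -sqrf_eq0 ?e1 ?e2.
right.
have l65 : l <= 6 / 5.
  (* 2/3 and 9/8 are the roots of a^2 - 43/24 a + 3/4. The bound gives l <= 43/36, just below
     6/5. *)
  have hS : A * (A + C - B) <= A * (43 / 24 * X).
    have -> : A * (A + C - B) = A ^+ 2 + 3 / 4 * X ^+ 2 - B * (A - B) by rewrite -D; ring.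
    have : 0 <= B * (A - B) by rewrite mulr_ge0// subr_ge0.
    have : 0 <= (A - 2 / 3 * X) * (9 / 8 * X - A) by rewrite mulr_ge0//; lra.
    by lra.
  rewrite ler_pM2l// in hS.
  have : 3 * X * l <= 3 * X * (6 / 5) by rewrite lX; lra.
  by rewrite ler_pM2l// mulr_gt0.
pose Q := qsum A B C 0 0; pose H := qsum X (X / 2) X 0 0.
pose q (k : int * int) := qform A B C k.1%:~R k.2%:~R.
pose N (k : int * int) : R := k.1%:~R ^+ 2 + k.1%:~R * k.2%:~R + k.2%:~R ^+ 2.
have hQ : hasum [set: int * int] (fun k => expR (- q k)) Q.
  by apply: hasum_ext (hasum_qsum 0 0 C0 D0) => k _; rewrite !addr0.
have hH : hasum [set: int * int] (fun k => expR (- (X * N k))) H.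
  apply: hasum_ext (hasum_qsum 0 0 X0 DX) => k _; rewrite !addr0; congr expR.
  by rewrite /qform /N; field.
have hQ1 := (hasum_bij _ _ hexrot_bij).1 hQ.
have hQ2 := (hasum_bij _ _ hexrot_bij).1 hQ1.
have h3Q := hasumD (hasumD hQ hQ1) hQ2.
have h3H := hasumZ (ler0n R 3) hH.
suff : 3%:R * H < Q + Q + Q by rewrite /Q /H; lra.
have term (k : int * int) : 1 <= N k -> 3 * expR (- (X * N k)) <
    expR (- q k) + expR (- q (hexrot k)) + expR (- q (hexrot (hexrot k))).
  move=> N1; have N0 : 0 < N k by lra.
  pose n := X * N k; have n0 : 0 < n by rewrite mulr_gt0.
  have nn : n != 0 by rewrite gt_eqF.
  have s1 : q k / n + q (hexrot k) / n + q (hexrot (hexrot k)) / n = 3 * l.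
    apply: (mulfI nn); rewrite !mulrDr ![n * (_ / n)]mulrC !divfK//.
    have -> : n * (3 * l) = 3 * X * l * N k by rewrite /n; ring.
    by rewrite lX /q /N /qform /hexrot /= !rmorphB !rmorphN /=; ring.
  have s2 : q k / n * (q (hexrot k) / n) + q (hexrot k) / n * (q (hexrot (hexrot k)) / n) +
     q (hexrot (hexrot k)) / n * (q k / n) = (9 * l ^+ 2 + 3) / 4.
    have nn2 : n ^+ 2 != 0 by rewrite expf_neq0.
    apply: (mulfI nn2).
    have -> : n ^+ 2 * ((9 * l ^+ 2 + 3) / 4) = N k ^+ 2 * ((3 * X * l) ^+ 2 / 4 + 3 / 4 * X ^+ 2).
      by rewrite /n; field.
    rewrite lX -D.
    transitivity (q k * q (hexrot k) + q (hexrot k) * q (hexrot (hexrot k)) + q (hexrot (hexrot k)) * q k).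
      by field.
    by rewrite /q /N /qform /hexrot /= !rmorphB !rmorphN /=; field.
  have t72 : 7 / 2 <= n.
    by apply: le_trans X72 _; rewrite /n ler_peMr// ltW.
  have l165 : 1 <= l <= 6 / 5 by rewrite l1.
  have [h1 h2] := three_exp t72 l165 s1 s2.
  rewrite (negbTE l11) in h2.
  have {h1 h2}h : 3 < expR (- (n * (q k / n - 1))) + expR (- (n * (q (hexrot k) / n - 1))) +
     expR (- (n * (q (hexrot (hexrot k)) / n - 1))) by rewrite lt_neqAle h2.
  have E u : expR (- u) = expR (- n) * expR (- (n * (u / n - 1))).
    by rewrite -expRD; congr expR; field.
  rewrite (E (q k)) (E (q (hexrot k))) (E (q (hexrot (hexrot k)))) -!mulrDr -/n.
  by rewrite mulrC ltr_pM2l ?expR_gt0.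
have Nint (k : int * int) : k != (0, 0) -> 1 <= N k.
  case: k => m n /eqP k0; rewrite /N/= -!rmorphXn -!rmorphM -!rmorphD/=.
  have : 1 <= m ^+ 2 + m * n + n ^+ 2.
    rewrite -gtz0_ge1.
    have e : (m + n) ^+ 2 = m ^+ 2 + 2 * (m * n) + n ^+ 2 by ring.
    have h1 := sqr_ge0 m; have h2 := sqr_ge0 n; have h3 := sqr_ge0 (m + n).
    have [m0|m0] := eqVneq m 0.
      have n0 : n != 0 by apply/eqP => n0; apply: k0; rewrite m0 n0.
      have : 0 < n ^+ 2 by rewrite lt_neqAle eq_sym sqrf_eq0 n0 sqr_ge0.
      lra.
    have : 0 < m ^+ 2 by rewrite lt_neqAle eq_sym sqrf_eq0 m0 sqr_ge0.
    lra.
  by rewrite -(ler_int R).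
apply: (hasum_lt (i0 := (1%:Z, 0%:Z)) _ _ _ h3H h3Q) => //; last by apply/term/Nint.
move=> k _; have [->|k0] := eqVneq k (0, 0); last by rewrite ltW//; exact/term/Nint.
have -> : hexrot (0, 0) = (0, 0) by rewrite /hexrot /= subr0 oppr0.
have -> : q (0, 0) = 0 by rewrite /q /= qform0.
have -> : N (0, 0) = 0 by rewrite /N /=; ring.
by rewrite mulr0 oppr0 expR0; lra.
Qed.

(** For X < 7/2 the dual parameter is above 7/2 by pi^2 >= 9.61. The dual form is a multiple of the
    given one, hence still reduced, and equality transfers back. *)
Theorem montgomery A B C X : 0 < X -> 0 <= 2 * B <= A -> A <= C ->
  A * C - B ^+ 2 = 3 / 4 * X ^+ 2 ->
  [/\ A = X, B = X / 2 & C = X] \/ qsum X (X / 2) X 0 0 < qsum A B C 0 0.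
Proof.
move=> X0 /andP[B0 BA] AC D.
have C0 : 0 < C.
  rewrite ltNge; apply/negP => C0; have : A * C - B ^+ 2 <= 0.
    have := sqr_ge0 B; have : 0 <= A * - C by rewrite mulr_ge0; lra.
    lra.
  by rewrite D leNgt mulr_gt0// exprn_gt0.
have AX : A <= X.
  rewrite leNgt; apply/negP => XA.
  have : A * A <= A * C by rewrite ler_wpM2l//; lra.
  have : X * X < A * A by rewrite ltr_pM//; lra.
  have : B ^+ 2 <= A ^+ 2 / 4.
    rewrite (_ : A ^+ 2 / 4 = (A / 2) ^+ 2); last by field.
    by rewrite lerXn2r ?nnegrE//; lra.
  by rewrite expr2 in D *; lra.
have conc : A = C /\ A = 2 * B -> [/\ A = X, B = X / 2 & C = X].
  move=> [e1 e2]; have AX' : A = X.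
    have : A ^+ 2 = X ^+ 2.
      have : B ^+ 2 = A ^+ 2 / 4 by rewrite e2; field.
      by move: D; rewrite -e1; lra.
    by move/eqP; rewrite eqrXn2 ?ltW//; [move/eqP|lra].
  by split; lra.
have big A' B' C' X' : 7 / 2 <= X' -> 0 < C' -> A' * C' - B' ^+ 2 = 3 / 4 * X' ^+ 2 ->
    0 <= B' -> B' <= A' -> A' <= X' ->
    (A' = C' /\ A' = 2 * B') \/ qsum X' (X' / 2) X' 0 0 < qsum A' B' C' 0 0.
  move=> X72 C0' D' B0' BA' AX'.
  have [h|h] := leP A' (2 / 3 * X'); first by right; exact: montgomery_short.
  by apply: montgomery_near => //; rewrite h.
have [X72|X72] := leP (7 / 2) X.
  by have [] := big A B C X X72 C0 D; [lra|lra|by []|move/conc; left|right].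
have D0 : 0 < A * C - B ^+ 2 by rewrite D mulr_gt0// exprn_gt0.
have eX : X * X - (X / 2) ^+ 2 = 3 / 4 * X ^+ 2 by field.
have DX : 0 < X * X - (X / 2) ^+ 2 by rewrite eX mulr_gt0// exprn_gt0.
rewrite (qsum_duality C0 D0) (qsum_duality X0 DX) eX -D; set k := pi ^+ 2 / _.
have k0 : 0 < k by rewrite divr_gt0// exprn_gt0// pi_gt0.
have kX : 7 / 2 <= k * X.
  have -> : k * X = 4 / 3 * pi ^+ 2 / X.
    by rewrite /k D; generalize (@pi R) => P; field; rewrite gt_eqF.
  rewrite ler_pdivlMr//.
  by have := @pi_sqr_ge R; lra.
have Dk : k * A * (k * C) - (k * B) ^+ 2 = 3 / 4 * (k * X) ^+ 2.
  have -> : 3 / 4 * (k * X) ^+ 2 = k ^+ 2 * (3 / 4 * X ^+ 2) by ring.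
  by rewrite -D; ring.
have -> : k * (X / 2) = k * X / 2 by rewrite mulrA.
have [] := big (k * A) (k * B) (k * C) (k * X) kX _ Dk.
- by rewrite mulr_gt0.
- by rewrite mulr_ge0 ?(ltW k0)//; lra.
- by rewrite ler_pM2l//; lra.
- by rewrite ler_pM2l.
- move=> [/(mulfI (lt0r_neq0 k0)) e1]; rewrite mulrCA => /(mulfI (lt0r_neq0 k0)) e2.
  by left; apply: conc.
- by right; rewrite ltr_pM2l// sqrtr_gt0.
Qed.

End Montgomery.

(** * The one-dimensional theta function is smallest at the half period *)

Section HalfShift.
Variable R : realType.
Implicit Types (b s x y : R).

Lemma sin_natmul_le (n : nat) x : `|sin (n%:R * x)| <= n%:R * `|sin x|.
Proof.
elim: n => [|n IH]; first by rewrite !mul0r sin0 normr0.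
rewrite -natr1 mulrDl mul1r sinD mulrDl mul1r.
apply: le_trans (ler_normD _ _) _; rewrite !normrM.
apply: lerD.
  by rewrite -[leRHS]mulr1 ler_pM ?normr_ge0 ?cos_max.
by rewrite -[leRHS]mul1r ler_wpM2r ?normr_ge0 ?cos_max.
Qed.

(** Half-angle form of |sin (n x)| <= n |sin x|. *)
Lemma one_sub_cos_le (n : nat) x : 1 - cos (n%:R * x) <= n%:R ^+ 2 * (1 - cos x).
Proof.
have E y : 1 - cos y = 2 * `|sin (y / 2)| ^+ 2.
  rewrite real_normK ?num_real//.
  by rewrite {1}(_ : y = y / 2 + y / 2) ?cosD; [rewrite -!expr2 cos2sin2; ring|field].
rewrite !E [leRHS]mulrCA ler_pM2l// -exprMn lerXn2r ?nnegrE ?mulr_ge0 ?normr_ge0//.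
by rewrite -mulrA sin_natmul_le.
Qed.

Lemma hasum_delta (T : choiceType) (r : seq T) (f : T -> R) : uniq r ->
  (forall i, i \in r -> 0 <= f i) ->
  hasum [set: T] (fun i => if i \in r then f i else 0) (\sum_(i <- r) f i).
Proof.
move=> ur f0; apply/(@hasum_subset _ _ [set` r]) => //.
  by move=> i _ /negP/negbTE /= ->.
by apply: hasum_ext (hasum_seq ur f0) => i /= ->.
Qed.

Lemma cos_pi_int (k : int) x : cos (2 * pi * k%:~R * (x + 1 / 2)) =
  (-1) ^+ `|k|%N * cos (2 * pi * k%:~R * x).
Proof.
have -> : 2 * pi * k%:~R * (x + 1 / 2) = 2 * pi * k%:~R * x + pi * k%:~R :> R.
  by generalize (@pi R) => P; field.
rewrite cosD sin_piz mulr0 subr0 mulrC; congr (_ * _).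
have P (n : nat) : cos (pi * n%:R) = (-1) ^+ n :> R.
  have := alternatingn (@cosDpi R) n 0.
  by rewrite add0r cos0 mulr1 -(mulr_natr pi n).
by case: k => n; rewrite ?NegzE ?mulrNz ?mulrN ?cosN -?pmulrn P.
Qed.

(** The terms [n] and [-1 - n] are paired, so that the linear parts of their tangent bounds cancel.
    Since (n + 1/2)^2 >= 1/4, the tangent bound applies from s = 4 * 13/10 = 26/5 on. *)
Lemma gsum_half_lt_large s w : 26 / 5 <= s -> -(1 / 2) <= w <= 1 / 2 -> w != 0 ->
  gsum s (1 / 2) < gsum s (w + 1 / 2).
Proof.
move=> s5 /andP[w1 w2] w0; have s0 : 0 < s by lra.
have bij : set_bij [set: int] [set: int] (fun n : int => -1 - n).
  split=> // [m n _ _ /addrI/oppr_inj//|n _]; by exists (-1 - n) => //; ring.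
have h1 := hasum_gsum (w + 1 / 2) s0.
have h2 := (hasum_bij _ _ bij).1 h1.
have h := hasumD h1 h2; have k := hasumZ (ler0n R 2) (hasum_gsum (1 / 2) s0).
suff : 2%:R * gsum s (1 / 2) < gsum s (w + 1 / 2) + gsum s (w + 1 / 2) by lra.
have U (n : int) : let u := (n%:~R + 1 / 2 : R) in 1 / 4 <= u ^+ 2.
  rewrite /=; have -> : (n%:~R + 1 / 2 : R) ^+ 2 = 1 / 4 + (n * (n + 1))%:~R.
    by rewrite intrM intrD; field.
  rewrite lerDl ler0z; case: n => n; first by rewrite mulr_ge0.
  by rewrite NegzE (_ : - n.+1%:Z * (- n.+1%:Z + 1) = n.+1%:Z * n%:Z) ?mulr_ge0//; rewrite intS; ring.
have E (n : int) v : let u := (n%:~R + 1 / 2 : R) in -(1 / 2) <= v <= 1 / 2 ->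
    expR (- (s * u ^+ 2)) * (1 - 2 * (s * u ^+ 2) * (v / u)) <= expR (- (s * (u + v) ^+ 2)).
  move=> u /andP[v1 v2]; have u4 : 1 / 4 <= u ^+ 2 := U n.
  clearbody u.
  have u0 : u != 0 by apply/eqP => u0; move: u4; rewrite u0 expr0n /=; lra.
  have -> : - (s * (u + v) ^+ 2) = - (s * u ^+ 2) + - (s * u ^+ 2 * ((1 + v / u) ^+ 2 - 1)).
    by field.
  rewrite expRD ler_wpM2l ?expR_ge0//.
  have := @gauss_tangent R (s * u ^+ 2) (1 + v / u); rewrite addrAC subrr add0r; apply.
    by nra.
  have u2 : 0 < u ^+ 2 by lra.
  rewrite -(pmulr_rge0 _ u2) (_ : u ^+ 2 * (1 + v / u) = u ^+ 2 + u * v); last by field.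
  have : (u * v) ^+ 2 <= (u ^+ 2) ^+ 2.
    rewrite exprMn [(u ^+ 2) ^+ 2]expr2 ler_wpM2l ?sqr_ge0//.
    by apply: le_trans u4; nra.
  by move: (u * v) (u ^+ 2) u2 => p q; nra.
apply: (hasum_lt (i0 := 0%:Z) _ _ _ k h) => // [n _|].
  have e1 := E n w; have e2 := E n (- w).
  rewrite /= w1 w2 in e1; rewrite /= in e2.
  have {}e1 := e1 isT; have {}e2 := e2 ltac:(lra).
  have -> : (-1 - n)%:~R + (w + 1 / 2) = - ((n%:~R + 1 / 2) + - w) :> R.
    by rewrite rmorphB rmorphN/=; field.
  rewrite sqrrN (_ : n%:~R + (w + 1 / 2) = n%:~R + 1 / 2 + w); last by ring.
  apply: le_trans (lerD e1 e2); rewrite -mulrDr mulrC ler_wpM2l ?expR_ge0//.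
  by rewrite mulNr mulrN; lra.
have sw v : 0 < v -> expR (- (s * (1 / 2) ^+ 2)) * (1 - s * v) < expR (- (s * (1 / 2 + v) ^+ 2)).
  move=> v0; have H := @gauss_tangent_right R (s / 4) (2 * v).
  have -> : - (s * (1 / 2 + v) ^+ 2) = - (s * (1 / 2) ^+ 2) + - (s / 4 * (2 * (2 * v) + (2 * v) ^+ 2)).
    by field.
  rewrite expRD ltr_pM2l ?expR_gt0//; apply: le_lt_trans (H _ _); [lra|lra|].
  by rewrite mulr_gt0.
have ws v : -(1 / 2) <= v <= 1 / 2 -> expR (- (s * (1 / 2) ^+ 2)) * (1 - s * v) <= expR (- (s * (1 / 2 + v) ^+ 2)).
  move=> v12; have := E 0 v; rewrite /= add0r => /(_ v12).
  by rewrite (_ : 2 * (s * (1 / 2) ^+ 2) * (v / (1 / 2)) = s * v)//; field.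
rewrite add0r.
have -> : (-1 - 0%:Z)%:~R + (w + 1 / 2) = - (1 / 2 + - w) :> R.
  by rewrite subr0 rmorphN/=; field.
rewrite sqrrN add0r (_ : w + 1 / 2 = 1 / 2 + w); last by ring.
set e := expR (- (s * (1 / 2) ^+ 2)) in sw ws *.
have [wp|wn] := ltP 0 w.
  have := sw w wp; have := ws (- w) ltac:(lra); lra.
have wn' : 0 < - w by rewrite oppr_gt0 lt_neqAle w0.
have := sw (- w) wn'; have := ws w ltac:(lra); lra.
Qed.

Lemma expR_decay b (n : nat) : 9 / 5 <= b -> (2 <= n)%N ->
  n%:R ^+ 2 * expR (- (b * n%:R ^+ 2)) <= expR (- b) * (1 / 4) ^+ n.
Proof.
move=> b95 n2; have b4 : expR (- b) <= 1 / 4.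
  rewrite expRN div1r lef_pV2 ?posrE ?expR_gt0//.
  apply: (@le_trans _ _ (expR (9 / 5))); last by rewrite ler_expR.
  by have := expR_ge_taylor5 (9 / 5 : R); lra.
have e0 := expR_ge0 (- b).
have -> : expR (- (b * n%:R ^+ 2)) = expR (- b) * expR (- b) ^+ (n ^ 2 - 1).
  rewrite -exprS -expRM_natl; congr expR; rewrite mulrN mulrC -natrX.
  by congr (- (_%:R * _)); rewrite subn1 prednK//; nia.
rewrite mulrCA ler_wpM2l//.
apply: (@le_trans _ _ (n%:R ^+ 2 * (1 / 4) ^+ (n ^ 2 - 1))).
  by rewrite ler_wpM2l ?sqr_ge0// lerXn2r ?nnegrE// divr_ge0.
have : (n ^ 2 * 4 ^ n <= 4 ^ (n ^ 2 - 1))%N.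
  have h : (n ^ 2 <= 4 ^ (n - 1))%N.
    elim: n n2 => // -[//|[//|n]] IH _; have := IH isT.
    rewrite !subSS !subn0 [(4 ^ n.+2)%N]expnS; move: (4 ^ n.+1)%N => q; nia.
  apply: (@leq_trans (4 ^ (n - 1) * 4 ^ n)); first by rewrite leq_mul2r h orbT.
  by rewrite -expnD leq_exp2l//; nia.
rewrite -(ler_nat R) natrM !natrX => h.
rewrite !expr_div_n !expr1n !mul1r ler_pdivrMr ?exprn_gt0// mulrC ler_pdivlMr ?exprn_gt0//.
Qed.

(** On the dual side the modes 1 and -1 together gain 2 c0 exp (- b), with c0 = 1 - cos phi. Other
    odd modes cannot lose, and even modes lose at most c0 exp (- b) 4^(-|k|); the sum of 4^(-|k|)
    over all integers is 5/3 < 2. *)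
Lemma gsum_half_lt_small s x : 0 < s <= 26 / 5 -> (forall z : int, x != 1 / 2 + z%:~R) ->
  gsum s (1 / 2) < gsum s x.
Proof.
move=> /andP[s0 s5] xz; rewrite !poisson//; set b := pi ^+ 2 / s.
have b95 : 9 / 5 <= b.
  by rewrite ler_pdivlMr//; have := @pi_sqr_ge R; lra.
have b0 : 0 < b by lra.
rewrite ltr_pM2l ?sqrtr_gt0 ?divr_gt0 ?pi_gt0//.
pose phi := 2 * pi * (x - 1 / 2); pose c0 := 1 - cos phi.
have c00 : 0 < c0.
  rewrite lt_neqAle subr_ge0 cos_le1 andbT eq_sym subr_eq0; apply/eqP => h.
  have : cos (pi * (x - 1 / 2) + pi * (x - 1 / 2)) = 1.
    by rewrite [RHS]h; congr cos; rewrite /phi; ring.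
  rewrite cosD -!expr2 cos2sin2 => h1.
  have /sin_pi_eq0[z hz] : sin (pi * (x - 1 / 2)) = 0.
    by apply/eqP; rewrite -sqrf_eq0; apply/eqP; lra.
  by have := xz z; rewrite -hz addrC subrK eqxx.
have hf := hasum_gcosE x b0; have hh := hasum_gcosE (1 / 2) b0.
have q14 : 0 <= (1 / 4 : R) < 1 by apply/andP; split; lra.
have g4 := hasum_geometric q14.
have E4 : hasum [set: int] (fun k => (1 / 4 : R) ^+ `|k|%N) (5 / 3).
  have := hasum_int g4 (hasumZ (proj1 (andP q14)) g4).
  move=> h; apply: hasum_ext (hasum_eq _ h); last by field.
  by case=> n _ //=; rewrite -exprS.
have E4' := hasumZ (mulr_ge0 (ltW c00) (expR_ge0 (- b))) E4.
have D := @hasum_delta int [:: 1; -1] (fun=> c0 * expR (- b)) isT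
  (fun _ _ => mulr_ge0 (ltW c00) (expR_ge0 (- b))).
have hfE := hasumD hf E4'; have hhD := hasumD hh D.
suff : gsum b 0 + gcos b (1 / 2) + \sum_(i <- [:: 1%:Z; -1%:Z]) c0 * expR (- b) <=
   gsum b 0 + gcos b x + c0 * expR (- b) * (5 / 3).
  rewrite !big_cons big_nil; have : 0 < c0 * expR (- b) by rewrite mulr_gt0 ?expR_gt0.
  lra.
apply: hasum_le hhD hfE => k _.
have e0 := expR_ge0 (- (b * k%:~R ^+ 2)).
have cE : cos (2 * pi * k%:~R * x) = (-1) ^+ `|k|%N * cos (`|k|%:R * phi).
  have -> : x = (x - 1 / 2) + 1 / 2 by ring.
  rewrite cos_pi_int; congr (_ * _).
  have -> : `|k|%:R * phi = 2 * pi * `|k%:~R| * (x - 1 / 2).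
    by rewrite -intr_norm -abszE -pmulrn /phi; ring.
  have [k0|k0] := leP 0 (k%:~R : R); first by rewrite ger0_norm.
  by rewrite ltr0_norm// -cosN; congr cos; ring.
have cE2 : cos (2 * pi * k%:~R * (1 / 2)) = (-1) ^+ `|k|%N :> R.
  by have := cos_pi_int k 0; rewrite add0r mulr0 cos0 mulr1.
have k2 : k%:~R ^+ 2 = `|k|%:R ^+ 2 :> R.
  by rewrite -[LHS]real_normK ?num_real// -intr_norm -abszE -pmulrn.
rewrite cE cE2 -signr_odd; case: ifPn => [|nk].
  rewrite !inE => k1.
  have e1 : `|k|%N = 1%N by case/orP: k1 => /eqP ->.
  rewrite k2 e1 /= !expr1n !expr1 mulr1 !mul1r.
  have : 0 <= c0 * expR (- b) * (1 / 4).
    by apply: mulr_ge0; [apply: mulr_ge0; [exact: ltW|exact: expR_ge0]|lra].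
  by rewrite /c0; lra.
rewrite addr0; have [ok|ok] := boolP (odd `|k|); rewrite ?expr1 ?expr0 ?mulN1r ?mul1r.
  rewrite subrr mulr0 addr_ge0//.
  by apply: mulr_ge0; [apply: mulr_ge0; [exact: ltW|exact: expR_ge0]|exact: exprn_ge0].
have [->|k0] := eqVneq k 0.
  rewrite /= mul0r cos0 lerDl.
  by apply: mulr_ge0; [apply: mulr_ge0; [exact: ltW|exact: expR_ge0]|exact: exprn_ge0].
have k2' : (2 <= `|k|)%N by move: ok k0; case: k nk {e0 cE cE2 k2} => [[|[|n]]|[|n]].
have := one_sub_cos_le `|k| phi; rewrite -/c0 => h1.
have := expR_decay b95 k2'; rewrite -k2 div1r => h2.
have h3 := ler_wpM2l (ltW c00) h2.
have h4 := ler_wpM2l e0 h1.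
rewrite -k2 in h4.
lra.
Qed.

Lemma gsum_half_lt s x : 0 < s -> (forall z : int, x != 1 / 2 + z%:~R) ->
  gsum s (1 / 2) < gsum s x.
Proof.
move=> s0 xz; have [s5|s5] := leP s (26 / 5).
  by apply: gsum_half_lt_small => //; rewrite s0.
have /andP[z1 z2] := floor_itv x; set z := Num.floor x in z1 z2.
have -> : gsum s x = gsum s ((x - z%:~R - 1 / 2) + 1 / 2).
  by rewrite subrK -[LHS](gsumDz _ (- z))// rmorphN.
apply: gsum_half_lt_large; first exact: ltW.
  by move: z2; rewrite intrD; lra.
by have := xz z; apply: contra => /eqP h; apply/eqP; lra.
Qed.

End HalfShift.

(** * A hexagonal lattice together with a translate *)

Section HexDouble.
Variable R : realType.
Implicit Types (a b c X x y : R).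

Let hexE X x y := expR (- (2 * X * (x ^+ 2 + x * y + y ^+ 2))).

Let hexEC X x y : hexE X x y = hexE X y x.
Proof. by rewrite /hexE; congr (expR (- (_ * _))); ring. Qed.

(** Here [a], [b], [c] are barycentric coordinates in a triangle of mutually nearest lattice points,
    and [b^2 + b c + c^2] is the squared distance to the vertex of weight [a]. For a >= 0.433 that
    vertex alone suffices, as twice the distance is then at most 0.527. Nearer to the centre
    convexity of exp is used at the mean, twice which is at most 0.727. *)
Let triangle_max a b c X : 4 <= X -> 0 <= b <= a -> 0 <= c <= a -> a + b + c = 1 ->
  605 / 100 * expR (- X) < hexE X b c + hexE X a c + hexE X a b.
Proof.
move=> X4 /andP[b0 ba] /andP[c0 ca] abc.
have key (g : R) : 2 * g <= 527 / 1000 -> 605 / 100 * expR (- X) < expR (- (2 * X * g)).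
  move=> h; have -> : - (2 * X * g) = (X - 2 * X * g) + - X by ring.
  rewrite expRD ltr_pM2r ?expR_gt0//.
  have h1 := expR_ge_taylor5 (189 / 100 : R).
  have h2 : expR (189 / 100) <= expR (X - 2 * X * g) by rewrite ler_expR; nra.
  by apply: lt_le_trans h2; lra.
have p1 := expR_gt0 (- (2 * X * (a ^+ 2 + a * c + c ^+ 2))).
have p2 := expR_gt0 (- (2 * X * (a ^+ 2 + a * b + b ^+ 2))).
have bc1 : 0 <= (a - b) * (a - c) by rewrite mulr_ge0 ?subr_ge0.
have bc0 : 0 <= b * c by rewrite mulr_ge0.
have ebc : b + c = 1 - a by lra.
have sq : b ^+ 2 + b * c + c ^+ 2 = (1 - a) ^+ 2 - b * c by rewrite -ebc; ring.
have bc2 : a * (2 * a - 1) + b * c >= 0.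
  have -> : a * (2 * a - 1) + b * c = (a - b) * (a - c).
    by rewrite (_ : 2 * a - 1 = a - (b + c)); [ring|lra].
  exact: bc1.
have [a12|a12] := leP (433 / 1000) a.
  have := key (b ^+ 2 + b * c + c ^+ 2); rewrite -/(hexE X b c) => h.
  suff : 605 / 100 * expR (- X) < hexE X b c by rewrite /hexE; lra.
  apply: h; rewrite sq; have [h|h] := leP (1 / 2) a.
    by have : (1 - a) ^+ 2 <= 1 / 4; nra.
  by nra.
set G1 := b ^+ 2 + b * c + c ^+ 2; set G2 := a ^+ 2 + a * c + c ^+ 2; set G3 := a ^+ 2 + a * b + b ^+ 2.
pose m := (G1 + G2 + G3) / 3.
have J (g : R) : expR (- (2 * X * m)) * (1 - 2 * X * (g - m)) <= expR (- (2 * X * g)).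
  have -> : - (2 * X * g) = - (2 * X * m) + - (2 * X * (g - m)) by ring.
  by rewrite expRD ler_wpM2l ?expR_ge0//; apply: expR_ge1Dx.
have J3 : 3 * expR (- (2 * X * m)) <= hexE X b c + hexE X a c + hexE X a b.
  have := J G1; have := J G2; have := J G3; rewrite /hexE -/G1 -/G2 -/G3.
  have : G1 - m + (G2 - m) + (G3 - m) = 0 by rewrite /m; field.
  move: (expR (- (2 * X * m))) => e h h3 h2 h1.
  have : e * (1 - 2 * X * (G1 - m)) + e * (1 - 2 * X * (G2 - m)) + e * (1 - 2 * X * (G3 - m)) = 3 * e.
    have -> : e * (1 - 2 * X * (G1 - m)) + e * (1 - 2 * X * (G2 - m)) + e * (1 - 2 * X * (G3 - m)) =
      3 * e - e * (2 * X) * (G1 - m + (G2 - m) + (G3 - m)) by ring.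
    by rewrite h mulr0 subr0.
  lra.
apply: lt_le_trans J3.
have m1 : 2 * m <= 727 / 1000.
  have -> : m = (2 - 3 * (a * (1 - a) + b * c)) / 3.
    rewrite /m /G1 /G2 /G3 -ebc; have -> : 2 = 2 * (a + b + c) ^+ 2 by rewrite abc expr1n mulr1.
    by field.
  have : 0 <= (a - 1 / 3) * (433 / 1000 - a) by apply: mulr_ge0; lra.
  by lra.
have -> : - (2 * X * m) = (X - 2 * X * m) + - X by ring.
rewrite expRD mulrA ltr_pM2r ?expR_gt0//.
have h1 := expR_ge1Dx (109 / 100 : R).
have h2 : expR (109 / 100) <= expR (X - 2 * X * m) by rewrite ler_expR; nra.
lra.
Qed.

Lemma triangle_exp a b c X : 4 <= X -> 0 <= a -> 0 <= b -> 0 <= c -> a + b + c = 1 ->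
  605 / 100 * expR (- X) < expR (- (2 * X * (b ^+ 2 + b * c + c ^+ 2))) +
    expR (- (2 * X * (a ^+ 2 + a * c + c ^+ 2))) +
    expR (- (2 * X * (a ^+ 2 + a * b + b ^+ 2))).
Proof.
move=> X4 a0 b0 c0 abc; rewrite -!/(hexE X _ _).
have [ba|/ltW ab] := leP b a.
  have [ca|/ltW ac] := leP c a; first by apply: triangle_max; rewrite ?b0 ?c0.
  have := @triangle_max c b a X X4; rewrite b0 a0 ac (le_trans ba ac) => /(_ isT isT).
  by rewrite (hexEC X b a) (hexEC X c a) (hexEC X c b) => /(_ ltac:(lra)); lra.
have [cb|/ltW bc] := leP c b.
  have := @triangle_max b a c X X4; rewrite a0 c0 ab cb => /(_ isT isT).
  by rewrite (hexEC X b a) => /(_ ltac:(lra)); lra.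
have := @triangle_max c b a X X4; rewrite b0 a0 bc (le_trans ab bc) => /(_ isT isT).
by rewrite (hexEC X b a) (hexEC X c a) (hexEC X c b) => /(_ ltac:(lra)); lra.
Qed.

Lemma qsumDz A B C x y (i j : int) : 0 < C -> 0 < A * C - B ^+ 2 ->
  qsum A B C (x + i%:~R) (y + j%:~R) = qsum A B C x y :> R.
Proof.
move=> C0 D0; apply: hasum_uniq (hasum_qsum _ _ C0 D0) _.
have bij : set_bij [set: int * int] [set: int * int] (fun k : int * int => (k.1 + i, k.2 + j)).
  split=> // [[m n] [m' n'] _ _ /= [] /addIr -> /addIr ->//|[m n] _].
  by exists (m - i, n - j) => //=; rewrite !subrK.
apply: hasum_ext ((hasum_bij _ _ bij).1 (hasum_qsum x y C0 D0)) => k _ /=.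
by rewrite !intrD -!addrA ![_%:~R + x]addrC ![_%:~R + y]addrC.
Qed.

Lemma qsumN A B C x y : 0 < C -> 0 < A * C - B ^+ 2 ->
  qsum A B C (- x) (- y) = qsum A B C x y :> R.
Proof.
move=> C0 D0; apply: hasum_uniq (hasum_qsum _ _ C0 D0) _.
have bij : set_bij [set: int * int] [set: int * int] (fun k : int * int => (- k.1, - k.2)).
  split=> // [[m n] [m' n'] _ _ /= [] /oppr_inj -> /oppr_inj ->//|[m n] _].
  by exists (- m, - n) => //=; rewrite !opprK.
apply: hasum_ext ((hasum_bij _ _ bij).1 (hasum_qsum x y C0 D0)) => k _ /=.
by rewrite !rmorphN /qform/=; congr expR; ring.
Qed.

Lemma hex_double_large X x y : 4 <= X ->
  qsum X (X / 2) X 0 0 < qsum (2 * X) X (2 * X) 0 0 + qsum (2 * X) X (2 * X) x y.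
Proof.
move=> X4; have X0 : 0 < X by lra.
have C0 : 0 < 2 * X by rewrite mulr_gt0.
have D0 : 0 < 2 * X * (2 * X) - X ^+ 2.
  by rewrite (_ : _ - _ = 3 * X ^+ 2) ?mulr_gt0 ?exprn_gt0//; ring.
apply: (le_lt_trans (hex_le _)); first by lra.
have h1 : 1 <= qsum (2 * X) X (2 * X) 0 0.
  have := @hasum_ge_seq R (int * int)%type setT [:: (0%:Z, 0%:Z)] _ _ isT
    (fun _ _ => I) (hasum_qsum 0 0 C0 D0).
  by rewrite big_seq1 /= !addr0 qform0 oppr0 expR0.
suff : 605 / 100 * expR (- X) < qsum (2 * X) X (2 * X) x y by lra.
have tri u v : 0 <= u -> 0 <= v -> u + v <= 1 ->
    605 / 100 * expR (- X) < qsum (2 * X) X (2 * X) u v.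
  move=> u0 v0 uv.
  have := @hasum_ge_seq R (int * int)%type setT [:: (0%:Z, 0%:Z); (-1%:Z, 0%:Z); (0%:Z, -1%:Z)] _ _ isT
    (fun _ _ => I) (hasum_qsum u v C0 D0).
  apply: lt_le_trans; rewrite !big_cons big_nil /= addr0 addrA.
  have := @triangle_exp (1 - u - v) u v X X4; rewrite u0 v0 => /(_ ltac:(lra) isT isT ltac:(lra)).
  by congr (_ < expR (- _) + expR (- _) + expR (- _)); rewrite /qform ?rmorphN /=; ring.
have /andP[i1 i2] := floor_itv x; have /andP[j1 j2] := floor_itv y.
set i := Num.floor x in i1 i2; set j := Num.floor y in j1 j2.
rewrite !intrD in i2 j2.
have -> : qsum (2 * X) X (2 * X) x y = qsum (2 * X) X (2 * X) (x - i%:~R) (y - j%:~R).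
  by rewrite -[RHS](qsumDz _ _ i j)// !subrK.
have [h|h] := leP ((x - i%:~R) + (y - j%:~R)) 1; first by apply: tri; lra.
rewrite -qsumN// -(qsumDz _ _ 1 1)//.
by apply: tri; lra.
Qed.

Lemma hasum_gcos_sign b x (s : bool) : 0 < b ->
  hasum [set: int]
    (fun k => expR (- (b * k%:~R ^+ 2)) * (1 + (-1) ^+ s * cos (2 * pi * k%:~R * x)))
    (gsum b 0 + (-1) ^+ s * gcos b x).
Proof.
move=> b0; case: s; last first.
  by have := hasum_gcosE x b0; rewrite mul1r; apply: hasum_ext => k _; rewrite mul1r.
have h := hasumB (_ : forall k : int, [set: int] k -> _) (hasumZ (ler0n R 2) (hasum_gsum 0 b0)) (hasum_gcosE x b0).
apply: hasum_ext (hasum_eq _ (h _)) => [k _||k _].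
- by rewrite addr0 expr1; ring.
- by rewrite expr1; ring.
- rewrite addr0 mulrC ler_wpM2r ?expR_ge0//.
  by have := cos_le1 (2 * pi * k%:~R * x); lra.
Qed.

(** For all four sign choices every weight is nonnegative, so any finite set of modes gives a lower
    bound. *)
Lemma hasum_gcos_parity b x (s t : bool) : 0 < b ->
  hasum [set: int]
    (fun k => expR (- (b * k%:~R ^+ 2)) * ((1 + (-1) ^+ s * (-1) ^+ `|k|%N) *
       (1 + (-1) ^+ t * cos (2 * pi * k%:~R * x))))
    (gcos b 0 + (-1) ^+ s * gcos b (1 / 2) + (-1) ^+ t * gcos b x +
      (-1) ^+ s * (-1) ^+ t * gcos b (x + 1 / 2)).
Proof.
move=> b0.
have h1 := hasum_gcos_sign (1 / 2) s b0; have h2 := hasum_gcos_sign x t b0.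
have h3 := hasum_gcos_sign (x + 1 / 2) (s (+) t) b0.
have h := hasumB _ (hasumD (hasumD h1 h2) h3) (hasumZ (ler0n R 2) (hasum_gsum 0 b0)).
have E (k : int) : expR (- (b * k%:~R ^+ 2)) * (1 + (-1) ^+ s * cos (2 * pi * k%:~R * (1 / 2))) +
   expR (- (b * k%:~R ^+ 2)) * (1 + (-1) ^+ t * cos (2 * pi * k%:~R * x)) +
   expR (- (b * k%:~R ^+ 2)) * (1 + (-1) ^+ (s (+) t) * cos (2 * pi * k%:~R * (x + 1 / 2))) -
   2 * expR (- (b * (k%:~R + 0) ^+ 2)) =
   expR (- (b * k%:~R ^+ 2)) * ((1 + (-1) ^+ s * (-1) ^+ `|k|%N) *
       (1 + (-1) ^+ t * cos (2 * pi * k%:~R * x))).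
  have -> : cos (2 * pi * k%:~R * (1 / 2)) = (-1) ^+ `|k|%N :> R.
    by have := cos_pi_int k (0 : R); rewrite add0r mulr0 cos0 mulr1.
  by rewrite cos_pi_int signr_addb addr0; ring.
apply: hasum_ext (hasum_eq _ (h _)) => [k _||k _]; first exact: E.
  by rewrite gcos0// signr_addb; ring.
rewrite -subr_ge0 E mulr_ge0 ?expR_ge0// mulr_ge0//.
  by rewrite -(signr_odd _ `|k|%N) -signr_addb; case: (_ (+) _); rewrite ?expr0 ?expr1; lra.
by have := cos_le1 (2 * pi * k%:~R * x); have := cos_geN1 (2 * pi * k%:~R * x);
   case: (t); rewrite ?expr0 ?expr1; lra.
Qed.

Lemma sign_cos_ge0 (t : bool) (z : R) : 0 <= 1 + (-1) ^+ t * cos z.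
Proof. by have := cos_le1 z; have := cos_geN1 z; case: t; rewrite ?expr0 ?expr1; lra. Qed.

(** Twice the square of v + u / 2 plus 2 - u^2 / 2; the value 3/2 is attained at u = 1, v = -1/2. *)
Lemma shell_weight (u v : R) : -1 <= u <= 1 -> 3 / 2 <= 2 * v ^+ 2 + 2 + 2 * u * v.
Proof.
by move=> /andP[u1 u2]; have := sqr_ge0 (v + u / 2); have : u ^+ 2 <= 1; nra.
Qed.

Lemma shell_exp (X : R) : 16 / 5 <= X -> 605 / 100 * expR (- X) < 3 / 2 * expR (- (X / 2)).
Proof.
move=> X3; have -> : expR (- X) = expR (- (X / 2)) * expR (- (X / 2)).
  by rewrite -expRD; congr expR; field.
rewrite mulrA ltr_pM2r ?expR_gt0//.
have : expR (- (X / 2)) <= expR (- (16 / 10)) by rewrite ler_expR; lra.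
have h5 := expR_ge_taylor5 (16 / 10 : R).
have h6 : expR (- (16 / 10)) * expR (16 / 10) = 1 :> R by rewrite -expRD addNr expR0.
have h7 : 0 < expR (- (16 / 10)) :> R by exact: expR_gt0.
by nra.
Qed.

(** Both sides are dualised. For the doubled configuration the zero mode matches the 1 of the dual
    hexagonal bound, and the first shell has weight exp (- X' / 2), large against exp (- X') since
    X' >= 3.2. *)
Lemma hex_double_small X x y : 0 < X < 4 ->
  qsum X (X / 2) X 0 0 < qsum (2 * X) X (2 * X) 0 0 + qsum (2 * X) X (2 * X) x y.
Proof.
move=> /andP[X0 X4]; have pi0 := @pi_gt0 R.
have T0 : 0 < 2 * X by rewrite mulr_gt0.
have TX : X = 2 * X / 2 by field.
pose X' := 4 / 3 * pi ^+ 2 / X.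
have pi2 := @pi_sqr_ge R.
have X'32 : 32 / 10 <= X' by rewrite /X' ler_pdivlMr//; lra.
pose b := pi ^+ 2 / (2 * X); pose b' := pi ^+ 2 / (3 * (2 * X)).
have b0 : 0 < b by rewrite divr_gt0// exprn_gt0.
have b'0 : 0 < b' by rewrite divr_gt0 ?mulr_gt0// exprn_gt0.
have bX : b + b' = X' / 2.
  by rewrite /b /b' /X'; generalize (@pi R) => P; field; rewrite gt_eqF.
have bX' : b' * 2 ^+ 2 = X' / 2.
  by rewrite /b' /X'; generalize (@pi R) => P; field; rewrite gt_eqF.
have eX : X * X - (X / 2) ^+ 2 = 3 / 4 * X ^+ 2 by field.
have DX : 0 < X * X - (X / 2) ^+ 2 by rewrite eX mulr_gt0// exprn_gt0.
have L : qsum X (X / 2) X 0 0 <= Num.sqrt (pi ^+ 2 / (3 / 4 * X ^+ 2)) * (1 + 605 / 100 * expR (- X')).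
  rewrite (qsum_duality X0 DX) eX; set k := pi ^+ 2 / _.
  rewrite ler_wpM2l ?sqrtr_ge0//.
  have <- : k * X = X' by rewrite /k /X'; generalize (@pi R) => P; field; rewrite gt_eqF.
  have -> : k * (X / 2) = k * X / 2 by rewrite mulrA.
  apply: hex_le; have -> : k * X = X' by rewrite /k /X'; generalize (@pi R) => P; field; rewrite gt_eqF.
  lra.
apply: le_lt_trans L _.
have S : Num.sqrt (pi ^+ 2 / (3 / 4 * X ^+ 2)) = 4 * (Num.sqrt (pi / (3 * (2 * X))) * Num.sqrt (pi / (2 * X))).
  rewrite -sqrtrM; last by rewrite divr_ge0// ?mulr_ge0// ltW.
  have -> : pi ^+ 2 / (3 / 4 * X ^+ 2) = 4 ^+ 2 * (pi / (3 * (2 * X)) * (pi / (2 * X))) :> R.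
    by generalize (@pi R) => P; field; rewrite gt_eqF.
  by rewrite [LHS]sqrtrM ?sqr_ge0// sqrtr_sqr ger0_norm.
have T30 : 0 < 3 * (2 * X) by rewrite mulr_gt0.
have Q u v : qsum (2 * X) X (2 * X) u v = (Num.sqrt (pi / (3 * (2 * X))) * Num.sqrt (pi / (2 * X))) *
   (gcos b' (u / 2) * gcos b (v + u / 2) + gcos b' (u / 2 + 1 / 2) * gcos b (v + u / 2 + 1 / 2)).
  rewrite {2}TX qsum_hex_split// !poisson// -/b -/b'.
  have -> : (u + 1) / 2 = u / 2 + 1 / 2 by field.
  by rewrite [v + (_ + _)]addrA; ring.
rewrite !Q S -mulrDr; set sq := Num.sqrt (pi / (3 * (2 * X))) * Num.sqrt (pi / (2 * X)).
have s0 : 0 < sq by rewrite mulr_gt0// sqrtr_gt0 divr_gt0.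
rewrite (_ : 4 * sq * _ = sq * (4 * (1 + 605 / 100 * expR (- X')))); last by ring.
rewrite ltr_pM2l// mul0r !add0r.
clear Q S; clearbody b b' X'.
set psi := x / 2; set phi := y + psi.
pose U (b : R) (s t : bool) (z : R) := (gcos b 0 + (-1) ^+ s * gcos b (1 / 2) + (-1) ^+ t * gcos b z +
      (-1) ^+ s * (-1) ^+ t * gcos b (z + 1 / 2)).
(* Orthogonality of the four sign characters turns a sum of products of signed series into products
   of nonnegative ones. *)
have Z : gcos b' 0 * gcos b 0 + gcos b' (1 / 2) * gcos b (1 / 2) +
  (gcos b' psi * gcos b phi + gcos b' (psi + 1 / 2) * gcos b (phi + 1 / 2)) =
  (U b' false false psi * U b false false phi + U b' false true psi * U b false true phi +
   U b' true false psi * U b true false phi + U b' true true psi * U b true true phi) / 4.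
  by rewrite /U !expr0 !expr1; field.
rewrite Z.
have Uge (c z : R) (s t : bool) (r : seq int) : 0 < c -> uniq r ->
   \sum_(k <- r) expR (- (c * k%:~R ^+ 2)) * ((1 + (-1) ^+ s * (-1) ^+ `|k|%N) *
       (1 + (-1) ^+ t * cos (2 * pi * k%:~R * z))) <= U c s t z.
  by move=> c0 ur; apply: hasum_ge_seq (hasum_gcos_parity z s t c0).
clearbody U.
have ev2 (c z : R) : 0 < c -> 4 <= U c false false z.
  move=> c0; have := Uge c z false false [:: 0] c0 isT.
  by rewrite big_seq1/= !expr0 mul1r expr0n/= mulr0 oppr0 expR0 mulr0 mul0r cos0; lra.
have evm (c z : R) (s t : bool) : 0 < c -> 0 <= U c s t z.
  by move=> c0; have := Uge c z s t [::] c0 isT; rewrite big_nil.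
have odd1 (c z : R) (t : bool) : 0 < c -> 4 * expR (- c) * (1 + (-1) ^+ t * cos (2 * pi * z)) <= U c true t z.
  move=> c0; have := Uge c z true t [:: 1; -1] c0 isT.
  rewrite !big_cons big_nil addr0 /= !expr1 rmorphN/= sqrrN !expr1n mulr1.
  have -> : 2 * pi * -1 * z = - (2 * pi * z) by ring.
  by rewrite cosN mulr1; apply: le_trans; rewrite le_eqVlt; apply/orP; left; apply/eqP; ring.
have even2 (z : R) : 4 + 4 * expR (- (b' * 2 ^+ 2)) * (1 + cos (2 * (2 * pi * z))) <= U b' false false z.
  have := Uge b' z false false [:: 0; 2; -2] b'0 isT.
  rewrite !big_cons big_nil addr0 /= !expr0 !mul1r rmorphN/= !sqrrN.
  have -> : 2 * pi * - 2%:~R * z = - (2 * (2 * pi * z)) :> R by ring.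
  have -> : 2 * pi * 2%:~R * z = 2 * (2 * pi * z) :> R by ring.
  rewrite cosN expr0n/= mulr0 oppr0 expR0 mulr0 mul0r cos0.
  apply: le_trans; rewrite le_eqVlt; apply/orP; left; apply/eqP.
  by ring.
(* The common weight of the six shortest dual vectors: two come from the modes 2 and -2 of [b']
   alone, four from odd modes in both variables. *)
set q := expR (- (X' / 2)).
have q0 : 0 < q by exact: expR_gt0.
pose cA := cos (2 * pi * phi); pose cB := cos (2 * pi * psi).
have qq : expR (- b) * expR (- b') = q by rewrite -expRD -opprD bX.
have t1 : (4 + 4 * q * (1 + cos (2 * (2 * pi * psi)))) * 4 <= U b' false false psi * U b false false phi.
  apply: ler_pM => //; last exact: ev2.
    by rewrite addr_ge0// mulr_ge0 ?mulr_ge0 ?(ltW q0)//; have := cos_geN1 (2 * (2 * pi * psi)); lra.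
  by have := even2 psi; rewrite bX'.
have t2 : 0 <= U b' false true psi * U b false true phi by rewrite mulr_ge0 ?evm.
have todd (t : bool) : 16 * q * ((1 + (-1) ^+ t * cB) * (1 + (-1) ^+ t * cA)) <=
    U b' true t psi * U b true t phi.
  have := odd1 b' psi t b'0; have := odd1 b phi t b0.
  rewrite -/cA -/cB => h1 h2.
  have h3 : 4 * expR (- b') * (1 + (-1) ^+ t * cB) * (4 * expR (- b) * (1 + (-1) ^+ t * cA)) <=
     U b' true t psi * U b true t phi.
    by apply: ler_pM h2 h1; rewrite !mulr_ge0 ?expR_ge0 ?sign_cos_ge0.
  by apply: le_trans h3; rewrite -qq le_eqVlt; apply/orP; left; apply/eqP; ring.
have t3 := todd false; have t4 := todd true.
rewrite !expr0 expr1 in t3 t4.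
have cE : cos (2 * (2 * pi * psi)) = 2 * cB ^+ 2 - 1.
  by rewrite mulr_natl cos_mulr2n /cB; ring.
rewrite cE in t1.
have cA1 : -1 <= cA <= 1 by rewrite cos_geN1 cos_le1.
have big : 605 / 100 * expR (- X') < 3 / 2 * q by apply: shell_exp; lra.
have h := ler_wpM2l (ltW q0) (shell_weight cB cA1).
clear - t1 t2 t3 t4 big h.
lra.
Qed.

Lemma hex_double X x y : 0 < X ->
  qsum X (X / 2) X 0 0 < qsum (2 * X) X (2 * X) 0 0 + qsum (2 * X) X (2 * X) x y.
Proof.
move=> X0; have [X4|X4] := leP 4 X; first exact: hex_double_large.
by apply: hex_double_small; rewrite X0.
Qed.

End HexDouble.

(** * Dense periodic configurations on the line *)

Section LineConfigurations.
Variable R : realType.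
Implicit Types (s t x : R).

Definition pair_energy N s (y : 'I_N -> R) : R :=
  \sum_(j < N) \sum_(k < N) gsum s (y j - y k).

(** The squared modulus of a geometric exponential sum, [M] times the usual Fejer kernel. *)
Definition fejer M t : R := \sum_(i < M) \sum_(j < M) cos ((i%:R - j%:R) * t).

Lemma fejer_ge0 M t : 0 <= fejer M t.
Proof.
have -> : fejer M t = (\sum_(i < M) cos (i%:R * t)) ^+ 2 + (\sum_(i < M) sin (i%:R * t)) ^+ 2.
  rewrite !expr2 !big_distrlr/= -big_split/=; apply: eq_bigr => i _.
  by rewrite -big_split/=; apply: eq_bigr => j _; rewrite mulrBl cosB.
by rewrite addr_ge0 ?sqr_ge0.
Qed.

Lemma fejer0 M : fejer M 0 = M%:R ^+ 2.
Proof.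
rewrite /fejer; under eq_bigr do under eq_bigr do rewrite mulr0 cos0.
by rewrite !sumr_const card_ord -mulrnA natrM expr2.
Qed.

Lemma fejerE M t :
  fejer M t = M%:R + 2 * \sum_(m < M) (M%:R - m.+1%:R) * cos (m.+1%:R * t).
Proof.
elim: M => [|M IH]; first by rewrite /fejer !big_ord0 mulr0 addr0.
have -> : fejer M.+1 t = fejer M t + 1 + 2 * \sum_(m < M) cos (m.+1%:R * t).
  rewrite /fejer big_ord_recr/= big_ord_recr/= subrr mul0r cos0.
  under eq_bigr do rewrite big_ord_recr/=.
  rewrite big_split/=.
  have e1 : \sum_(i < M) cos ((i%:R - M%:R) * t) = \sum_(m < M) cos (m.+1%:R * t).
    rewrite (reindex_inj rev_ord_inj)/=; apply: eq_bigr => i _.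
    rewrite natrB// -[RHS]cosN; congr cos; ring.
  have e2 : \sum_(i < M) cos ((M%:R - i%:R) * t) = \sum_(m < M) cos (m.+1%:R * t).
    rewrite -e1; apply: eq_bigr => i _; rewrite -cosN; congr cos; ring.
  by rewrite e1 e2; ring.
rewrite IH big_ord_recr/= subrr mul0r addr0.
have -> : \sum_(m < M) (M.+1%:R - m.+1%:R) * cos (m.+1%:R * t) =
    \sum_(m < M) (M%:R - m.+1%:R) * cos (m.+1%:R * t) + \sum_(m < M) cos (m.+1%:R * t).
  by rewrite -big_split/=; apply: eq_bigr => m _; rewrite -(natr1 M); ring.
by rewrite -[M.+1%:R]natr1; ring.
Qed.

Lemma floor_split x : 0 <= x -> exists M (f : R), [/\ x = M%:R + f & 0 <= f < 1].
Proof.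
move=> x0; exists (Num.truncn x), (x - (Num.truncn x)%:R); split; first by ring.
by have /andP[h1 h2] := truncn_itv x0; rewrite -natr1 in h2; lra.
Qed.

(** The structure factor: the squared modulus of the [m]-th exponential sum over the points. *)
Definition spectrum N (y : 'I_N -> R) (m : nat) : R :=
  \sum_(j < N) \sum_(k < N) cos (2 * pi * m%:R * (y j - y k)).

Lemma spectrum_ge0 N (y : 'I_N -> R) m : 0 <= spectrum y m.
Proof.
have -> : spectrum y m = (\sum_(j < N) cos (2 * pi * m%:R * y j)) ^+ 2 +
    (\sum_(j < N) sin (2 * pi * m%:R * y j)) ^+ 2.
  rewrite !expr2 !big_distrlr/= -big_split/=; apply: eq_bigr => i _.
  by rewrite -big_split/=; apply: eq_bigr => j _; rewrite mulrBr cosB.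
by rewrite addr_ge0 ?sqr_ge0.
Qed.

Lemma spectrum0 N (y : 'I_N -> R) : spectrum y 0 = N%:R ^+ 2.
Proof.
rewrite /spectrum; under eq_bigr do under eq_bigr do rewrite mulr0 mul0r cos0.
by rewrite !sumr_const card_ord -mulrnA natrM expr2.
Qed.

(* The weights [(r - |m|)_+] interpolate between two consecutive Fejer kernels. *)
Lemma fejer_spectrum N (y : 'I_N -> R) M (f r : R) : 0 <= f <= 1 -> r = M%:R + f ->
  N%:R * r ^+ 2 <= r * N%:R ^+ 2 + 2 * \sum_(m < M) (r - m.+1%:R) * spectrum y m.+1.
Proof.
move=> /andP[f0 f1] rE.
pose T t := (1 - f) * fejer M t + f * fejer M.+1 t.
have TE t : T t = r + 2 * \sum_(m < M) (r - m.+1%:R) * cos (m.+1%:R * t).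
  rewrite /T !fejerE big_ord_recr/= subrr mul0r addr0 !mulrDr.
  rewrite addrACA; congr (_ + _); first by rewrite rE -natr1; ring.
  rewrite [(1 - f) * _]mulrCA [f * (2 * _)]mulrCA -mulrDr; congr (2 * _).
  rewrite !mulr_sumr -big_split/=; apply: eq_bigr => m _; rewrite rE -!natr1; ring.
have T0 t : 0 <= T t by rewrite addr_ge0// mulr_ge0 ?fejer_ge0// subr_ge0.
have T00 : r ^+ 2 <= T 0.
  rewrite /T !fejer0 rE -natr1; have : 0 <= M%:R :> R by []; nra.
have -> : r * N%:R ^+ 2 + 2 * \sum_(m < M) (r - m.+1%:R) * spectrum y m.+1 =
    \sum_(j < N) \sum_(k < N) T (2 * pi * (y j - y k)).
  under [RHS]eq_bigr do under eq_bigr do rewrite TE.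
  under [RHS]eq_bigr do rewrite big_split/= sumr_const card_ord -mulr_sumr.
  rewrite big_split/= sumr_const card_ord -mulr_sumr; congr (_ + 2 * _).
    by rewrite -mulr_natr -mulr_natr; ring.
  rewrite [RHS](eq_bigr (fun j => \sum_(m < M) (r - m.+1%:R) * \sum_(k < N) cos (m.+1%:R * (2 * pi * (y j - y k))))).
    rewrite exchange_big/=; apply: eq_bigr => m _; rewrite -mulr_sumr; congr (_ * _).
    by apply: eq_bigr => j _; apply: eq_bigr => k _; congr cos; ring.
  by move=> j _; rewrite exchange_big/=; apply: eq_bigr => m _; rewrite mulr_sumr.
rewrite mulr_natl -[N in _ *+ N]card_ord -sumr_const; apply: ler_sum => j _.
rewrite (bigD1 j)//= subrr mulr0; apply: le_trans T00 _.
by rewrite lerDl sumr_ge0.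
Qed.

Lemma hasum_spectrum N (y : 'I_N -> R) b : 0 < b ->
  hasum [set: int] (fun m => expR (- (b * m%:~R ^+ 2)) * spectrum y `|m|%N)
    (\sum_(j < N) \sum_(k < N) gcos b (y j - y k)).
Proof.
move=> b0.
have cE (m : int) x : cos (2 * pi * m%:~R * x) = cos (2 * pi * `|m|%:R * x).
  have -> : `|m|%:R = `|m%:~R| :> R by rewrite -intr_norm -abszE -pmulrn.
  have [k0|k0] := leP 0 (m%:~R : R); first by rewrite ger0_norm.
  by rewrite ltr0_norm// -cosN; congr cos; ring.
have h := hasum_big (index_enum _) (fun j : 'I_N => hasum_big (index_enum _) (fun k : 'I_N => hasum_gcosE (y j - y k) b0)).
have h0 := hasumZ (ler0n R (N * N)) (hasum_gsum 0 b0).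
have E (m : int) : \sum_(j < N) \sum_(k < N) expR (- (b * m%:~R ^+ 2)) * (1 + cos (2 * pi * m%:~R * (y j - y k))) =
   (N * N)%:R * expR (- (b * (m%:~R + 0) ^+ 2)) + expR (- (b * m%:~R ^+ 2)) * spectrum y `|m|%N.
  rewrite addr0 /spectrum; under eq_bigr do rewrite -mulr_sumr big_split/= sumr_const card_ord.
  rewrite -mulr_sumr big_split/= sumr_const card_ord mulrDr; congr (_ + _).
    by rewrite natrM -[_ *+ N *+ N]mulr_natr -[1 *+ N]mulr_natr; ring.
  by congr (_ * _); apply: eq_bigr => j _; apply: eq_bigr => k _; exact: cE.
have hB := hasumB _ h h0.
apply: hasum_ext (hasum_eq _ (hB _)) => [m _||m _].
- by rewrite E addrAC subrr add0r.
- under eq_bigr do rewrite big_split/= sumr_const card_ord.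
  rewrite big_split/= sumr_const card_ord natrM -[_ *+ N *+ N]mulr_natr -[_ *+ N]mulr_natr.
  by ring.
- by rewrite E lerDl mulr_ge0 ?expR_ge0 ?spectrum_ge0.
Qed.

(** A linear programming bound. The tangent bound at m / N minorises the coefficients by a multiple
    of [r - m], where [r] is the zero of the tangent line; modes beyond [r] are dropped, and the
    tent weights are those of [fejer_spectrum]. *)
Lemma spectrum_bound N (y : 'I_N -> R) b : (0 < N)%N -> 13 / 10 <= b ->
  N%:R ^+ 2 * (1 + expR (- b)) <=
  \sum_(j < N) \sum_(k < N) gcos (b / N%:R ^+ 2) (y j - y k).
Proof.
move=> N0 b13; have b0 : 0 < b by lra.
have NR : 0 < N%:R :> R by rewrite ltr0n.
have N20 : 0 < N%:R ^+ 2 :> R by rewrite exprn_gt0.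
have be0 : 0 < b / N%:R ^+ 2 by rewrite divr_gt0.
pose r := N%:R * (1 + (2 * b)^-1).
have r0 : 0 < r by rewrite mulr_gt0// addr_gt0// invr_gt0 mulr_gt0.
have [M [f [rE /andP[f0 f1]]]] := floor_split (ltW r0).
have f01 : 0 <= f <= 1 by rewrite f0 ltW.
have F := fejer_spectrum y f01 rE.
pose sq := [seq Posz m | m <- iota 0 M.+1] ++ [seq Negz m | m <- iota 0 M].
have usq : uniq sq.
  rewrite cat_uniq !map_inj_uniq ?iota_uniq ?andTb ?andbT; last 2 first.
  - by move=> ? ? [].
  - by move=> ? ? [].
  by apply/hasPn => _ /mapP[m _ ->]; apply/mapP => -[].
have := hasum_ge_seq usq (fun _ _ => I) (hasum_spectrum y be0).
apply: le_trans.
have i1 : iota 1 M = map (addn 1) (iota 0 M) by rewrite -iotaDl addn0.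
rewrite /sq big_cat/= !big_map big_cons/= i1 !big_map.
rewrite spectrum0 expr0n/= mulr0 oppr0 expR0 mul1r.
have -> : iota 0 M = index_iota 0 M by rewrite /index_iota subn0.
rewrite !big_mkord.
pose K := expR (- b) * (2 * b / N%:R).
have K0 : 0 <= K by rewrite mulr_ge0 ?expR_ge0// divr_ge0// mulr_ge0// ltW.
have term (m : nat) : K * ((r - m.+1%:R) * spectrum y m.+1) <=
    expR (- (b / N%:R ^+ 2 * m.+1%:R ^+ 2)) * spectrum y m.+1.
  rewrite mulrA ler_wpM2r ?spectrum_ge0//.
  have := @gauss_tangent R b (m.+1%:R / N%:R) b13; rewrite divr_ge0// => /(_ isT) h.
  have -> : - (b / N%:R ^+ 2 * m.+1%:R ^+ 2) = - b + - (b * ((m.+1%:R / N%:R) ^+ 2 - 1)).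
    by field; rewrite gt_eqF.
  rewrite expRD /K -mulrA ler_wpM2l ?expR_ge0//; apply: le_trans h.
  by rewrite /r le_eqVlt; apply/orP; left; apply/eqP; field; rewrite !gt_eqF.
set S := \sum_(m < M) expR (- (b / N%:R ^+ 2 * m.+1%:R ^+ 2)) * spectrum y m.+1.
have e2 : \sum_(i < M) expR (- (b / N%:R ^+ 2 * (Negz i)%:~R ^+ 2)) * spectrum y i.+1 = S.
  by apply: eq_bigr => m _; rewrite NegzE rmorphN/= sqrrN.
suff : N%:R ^+ 2 * (1 + expR (- b)) <= N%:R ^+ 2 + S + S.
  by move=> h; apply: le_trans h _; rewrite -e2.
have hS : K * \sum_(m < M) (r - m.+1%:R) * spectrum y m.+1 <= S.
  by rewrite mulr_sumr; apply: ler_sum => m _; exact: term.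
have hF := ler_wpM2l K0 F.
have e0 := expR_ge0 (- b).
have KE : K * (N%:R * r ^+ 2) - K * (r * N%:R ^+ 2) = expR (- b) * N%:R ^+ 2 * (1 + (2 * b)^-1).
  by rewrite /K /r; field; rewrite !gt_eqF.
have : expR (- b) * N%:R ^+ 2 <= expR (- b) * N%:R ^+ 2 * (1 + (2 * b)^-1).
  by rewrite ler_peMr ?mulr_ge0 ?sqr_ge0// lerDl invr_ge0 mulr_ge0// ltW.
move: hF; rewrite mulrDr; lra.
Qed.

End LineConfigurations.

(** * Sparse periodic configurations on the line *)

Section LineConfigurations2.
Variable R : realType.
Implicit Types (s t x : R) (z m : int).

(* The infinite sequence with period [N] and increment 1 per period. *)
Definition unfold_conf N (y : nat -> R) (z : int) : R :=
  y `|(z %% N)%Z|%N + (z %/ N)%Z%:~R.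

Section Unfold.
Variables (N : nat) (y : nat -> R).
Hypothesis N0 : (0 < N)%N.
Hypothesis y01 : forall i, (i < N)%N -> 0 <= y i < 1.
Hypothesis ymono : forall i, (i.+1 < N)%N -> y i <= y i.+1.
Let Y := unfold_conf N y.

Lemma unfold_confE (r : nat) (q : int) : (r < N)%N -> Y (q * N + r) = y r + q%:~R.
Proof.
move=> rN; rewrite /Y /unfold_conf divzMDl ?eqz_nat -?lt0n// modzMDl.
by rewrite divz_small ?modz_small ?addr0//= ltz_nat.
Qed.

Lemma unfold_confP z : exists (r : nat) (q : int), (r < N)%N /\ z = q * N + r.
Proof.
have NZ : (N : int) != 0 by rewrite eqz_nat -lt0n.
exists `|(z %% N)%Z|%N, (z %/ N)%Z; split.
  by rewrite -ltz_nat gez0_abs ?modz_ge0// ltz_pmod.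
by rewrite gez0_abs ?modz_ge0// -divz_eq.
Qed.

Lemma unfold_conf_nat (r : nat) : (r < N)%N -> Y r = y r.
Proof. by move=> rN; rewrite -[Posz r]add0r -(mul0r (N : int)) unfold_confE// addr0. Qed.

Lemma unfold_confDN z : Y (z + N) = Y z + 1.
Proof.
have [r [q [rN ->]]] := unfold_confP z.
have -> : q * N + r + N = (q + 1) * N + r by ring.
by rewrite !unfold_confE// intrD addrA.
Qed.

Lemma unfold_conf_le1 z : Y z <= Y (z + 1).
Proof.
have [r [q [rN ->]]] := unfold_confP z.
have [rN1|] := ltnP r.+1 N.
  have -> : q * N + r + 1 = q * N + r.+1 by rewrite -addrA -(PoszD r 1) addn1.
  by rewrite !unfold_confE// lerD2r ymono.
move=> Nr; have NE : N = r.+1 by apply/eqP; rewrite eqn_leq Nr.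
have -> : q * N + r + 1 = (q + 1) * N + 0%N by rewrite NE; lia.
rewrite !unfold_confE// intrD.
have /andP[_ h1] := y01 rN; have /andP[h2 _] := y01 N0; lra.
Qed.

Lemma unfold_conf_le z (n : nat) : Y z <= Y (z + n).
Proof.
elim: n => [|n IH]; first by rewrite addr0.
apply: le_trans IH _; have -> : z + n.+1 = z + n + 1 by lia.
exact: unfold_conf_le1.
Qed.

Lemma unfold_conf_slope z (m : int) : m != 0 -> 0 <= (Y (z + m) - Y z) / m%:~R.
Proof.
case: m => m m0.
  by rewrite divr_ge0 ?subr_ge0 ?unfold_conf_le// ler0z.
rewrite NegzE rmorphN/= invrN mulrN -mulNr opprB divr_ge0 ?ler0z// subr_ge0.
by have := unfold_conf_le (z - m.+1%:Z) m.+1; rewrite subrK.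
Qed.

(** Moving a window of [N] consecutive indices by one replaces a value by itself plus 1. *)
Lemma sum_unfold_conf (m : int) : \sum_(k < N) (Y (k%:Z + m) - Y k%:Z) = m%:~R.
Proof.
have step n : \sum_(k < N) Y (k%:Z + (n + 1)) = \sum_(k < N) Y (k%:Z + n) + 1.
  have -> : \sum_(k < N) Y (k%:Z + (n + 1)) = \sum_(0 <= k < N) Y (k.+1%:Z + n).
    by rewrite big_mkord; apply: eq_bigr => k _; congr Y; lia.
  have -> : \sum_(k < N) Y (k%:Z + n) = \sum_(0 <= k < N) Y (k%:Z + n).
    by rewrite big_mkord.
  have := @telescope_sumr R 0 N (fun k => Y (k%:Z + n)) (leq0n N).
  rewrite sumrB add0r [N%:Z + n]addrC unfold_confDN; lra.
rewrite sumrB; elim: m => [|m IH|m IH].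
- by under eq_bigr do rewrite addr0; rewrite subrr.
- by rewrite -addn1 PoszD step intrD; lra.
- have := step (- m.+1%:Z); have -> : - m.+1%:Z + 1 = - m%:Z by lia.
  have -> : (- m.+1%:Z)%:~R = (- m%:Z)%:~R - 1 :> R.
    by rewrite !rmorphN/= -[m.+1]addn1 PoszD intrD; ring.
  lra.
Qed.

Lemma hasum_unfold_conf s c : 0 < s ->
  hasum [set: int] (fun z => expR (- (s * (Y z - c) ^+ 2)))
    (\sum_(r < N) gsum s (y r - c)).
Proof.
move=> s0; pose e (k : 'I_N * int) : int := k.2 * N + k.1%:Z.
have be : set_bij [set: 'I_N * int] [set: int] e.
  split=> //.
    move=> [r q] [r' q'] _ _; rewrite /e/= => E.
    have rr : r = r'.
      have := congr1 (fun z => (z %% N)%Z) E; rewrite /= !modzMDl !modz_small ?ltz_nat ?ltn_ord//=.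
      by move=> [/val_inj].
    by subst r'; congr (_, _); move/addIr: E; apply: mulIf; rewrite eqz_nat -lt0n.
  move=> z _; have [r [q [rN ->]]] := unfold_confP z.
  by exists (Ordinal rN, q).
apply/(hasum_bij _ _ be); rewrite setT_sigX.
have h := (@hasum_pair R _ _ setT (fun=> setT)
  (fun (r : 'I_N) (q : int) => expR (- (s * (q%:~R + (y r - c)) ^+ 2))) _ _
  (fun r _ => hasum_gsum (y r - c) s0)).1 (hasum_fin (fun r => gsum_ge0 _ s0)).
apply: hasum_ext h => -[r q] _ /=; rewrite /e/= unfold_confE//.
by congr (expR (- (_ * _ ^+ 2))); ring.
Qed.

(** Pairs are grouped by index difference [m]. The normalised gaps [x j] have mean 1, so the linear
    terms of the tangent bounds sum to zero, and the parameter times m^2 stays above 13/10. *)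
Lemma unfold_energy s : 13 / 10 <= s / N%:R ^+ 2 ->
  N%:R * gsum (s / N%:R ^+ 2) 0 <= \sum_(j < N) \sum_(k < N) gsum s (y k - y j).
Proof.
move=> sig; have NR : 0 < N%:R :> R by rewrite ltr0n.
have N2 : 0 < N%:R ^+ 2 :> R by rewrite exprn_gt0.
set sg := s / _ in sig *.
have sg0 : 0 < sg by lra.
have s0 : 0 < s by rewrite -(pmulr_lgt0 _ (_ : 0 < (N%:R ^+ 2)^-1)) ?invr_gt0.
have h1 := hasumZ (ltW NR) (hasum_gsum 0 sg0).
have h2 : hasum [set: int] (fun m => \sum_(j < N) expR (- (s * (Y (j%:Z + m) - Y j%:Z) ^+ 2)))
    (\sum_(j < N) \sum_(k < N) gsum s (y k - y j)).
  apply: hasum_big => j.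
  have h := (hasum_bij _ _ (int_bijD j%:Z)).1 (hasum_unfold_conf (y j) s0).
  apply: hasum_ext h => m _ /=.
  by rewrite [m + _]addrC [Y j%:Z]unfold_conf_nat.
apply: hasum_le h1 h2 => m _; rewrite addr0.
have [->|m0] := eqVneq m 0.
  under eq_bigr do rewrite addr0 subrr expr0n mulr0 oppr0 expR0.
  by rewrite expr0n mulr0 oppr0 expR0 mulr1 sumr_const card_ord.
have mR : m%:~R != 0 :> R by rewrite intr_eq0.
have m2 : 1 <= m%:~R ^+ 2 :> R.
  rewrite -[m%:~R ^+ 2]rmorphXn/= ler1z; move: m0; clear; move: m => [[|m]|m] //; lia.
set t := sg * m%:~R ^+ 2.
have t13 : 13 / 10 <= t by apply: (le_trans sig); rewrite ler_peMr// ltW.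
pose x (j : 'I_N) := N%:R * ((Y (j%:Z + m) - Y j%:Z) / m%:~R).
have x0 j : 0 <= x j by rewrite mulr_ge0 ?unfold_conf_slope// ltW.
have sx : \sum_(j < N) (x j - 1) = 0.
  rewrite sumrB sumr_const card_ord -mulr_sumr -mulr_suml sum_unfold_conf divff// mulr1.
  by rewrite subrr.
have -> : N%:R * expR (- t) = \sum_(j < N) expR (- t) * (1 - 2 * t * (x j - 1)).
  rewrite -mulr_sumr sumrB sumr_const card_ord -mulr_sumr sx mulr0 subr0.
  by rewrite mulrC.
apply: ler_sum => j _.
have -> : - (s * (Y (j%:Z + m) - Y j%:Z) ^+ 2) = - t + - (t * (x j ^+ 2 - 1)).
  rewrite /t /x /sg; field; rewrite mR gt_eqF//.
by rewrite expRD ler_wpM2l ?expR_ge0// gauss_tangent.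
Qed.

End Unfold.

Lemma pair_energy_low N s (y : 'I_N -> R) : (0 < N)%N -> 13 / 10 <= s / N%:R ^+ 2 ->
  N%:R * gsum (s / N%:R ^+ 2) 0 <= pair_energy s y.
Proof.
move=> N0 sig.
have NR : 0 < N%:R :> R by rewrite ltr0n.
have s0 : 0 < s.
  rewrite -(pmulr_lgt0 _ (_ : 0 < (N%:R ^+ 2)^-1)) ?invr_gt0 ?exprn_gt0//.
  by apply: lt_le_trans sig; lra.
(* Fractional parts change no theta value, and sorting them makes the unfolded sequence monotone. *)
pose fr x : R := x - (Num.floor x)%:~R.
pose L := sort <=%R [seq fr (y j) | j <- enum 'I_N].
have sL : size L = N by rewrite size_sort size_map size_enum_ord.
have pL : perm_eq L [seq fr (y j) | j <- enum 'I_N] by rewrite perm_sort.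
have sumL (f : R -> R) : \sum_(j < N) f (fr (y j)) = \sum_(j < N) f (L`_j).
  have -> : \sum_(j < N) f (L`_j) = \sum_(0 <= j < N) f (L`_j) by rewrite big_mkord.
  by rewrite -[X in \sum_(_ <= _ < X) _]sL -(big_nth 0 predT) (perm_big _ pL)/= big_map big_enum.
have -> : pair_energy s y = \sum_(j < N) \sum_(k < N) gsum s (L`_k - L`_j).
  have E (j k : 'I_N) : gsum s (y j - y k) = gsum s (fr (y k) - fr (y j)).
    rewrite -gsumN// -(gsumDz (fr (y k) - fr (y j)) (Num.floor (y k) - Num.floor (y j)) s0).
    by rewrite /fr rmorphB/=; congr gsum; ring.
  rewrite /pair_energy; under eq_bigr do under eq_bigr do rewrite E.
  rewrite (sumL (fun u => \sum_(k < N) gsum s (fr (y k) - u))); apply: eq_bigr => j _.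
  exact: (sumL (fun u => gsum s (u - L`_j))).
apply: unfold_energy => // [i iN|i iN].
  have : L`_i \in L by rewrite mem_nth ?sL.
  rewrite (perm_mem pL) => /mapP[j _ ->]; rewrite /fr.
  have /andP[h1 h2] := floor_itv (y j); rewrite intrD in h2; apply/andP; split; lra.
have := sort_sorted (@le_total _ R) [seq fr (y j) | j <- enum 'I_N].
by move/(sortedP 0) => /(_ i); rewrite -/L sL; exact.
Qed.

End LineConfigurations2.

(** * Products of two one-dimensional energies *)

Section ProductBound.
Variable R : realType.
Implicit Types (s t x : R).

(** All that is used of a one-dimensional energy per point, self-term included, at parameter [t]
    normalised to unit density: the self-term, the zero mode, the equally spaced sum if sparse, a
    first-mode bound if dense. *)
Definition line_bound t e : Prop :=
  [/\ 1 <= e, Num.sqrt (pi / t) <= e, 13 / 10 <= t -> gsum t 0 <= e &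
      13 / 10 <= pi ^+ 2 / t ->
      Num.sqrt (pi / t) * (1 + expR (- (pi ^+ 2 / t))) <= e :> R].

Lemma sum_gcos_ge N (y : 'I_N -> R) b : 0 < b ->
  N%:R ^+ 2 <= \sum_(j < N) \sum_(k < N) gcos b (y j - y k).
Proof.
move=> b0.
have := hasum_ge_seq (r := [:: 0%:Z]) isT (fun _ _ => I) (hasum_spectrum y b0).
by rewrite big_seq1 expr0n mulr0 oppr0 expR0 mul1r spectrum0.
Qed.

Lemma pair_energy_bound N s (y : 'I_N -> R) : (0 < N)%N -> 0 < s ->
  line_bound (s / N%:R ^+ 2) (pair_energy s y / N%:R).
Proof.
move=> N0 s0; have NR : 0 < N%:R :> R by rewrite ltr0n.
have N2 : 0 < N%:R ^+ 2 :> R by rewrite exprn_gt0.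
set t := s / _; have t0 : 0 < t by rewrite divr_gt0.
have pi0 := @pi_gt0 R.
have b0 : 0 < pi ^+ 2 / s by rewrite divr_gt0// exprn_gt0.
have dual : pair_energy s y / N%:R =
    Num.sqrt (pi / t) * ((\sum_(j < N) \sum_(k < N) gcos (pi ^+ 2 / s) (y j - y k)) / N%:R ^+ 2).
  have -> : Num.sqrt (pi / t) = Num.sqrt (pi / s) * N%:R.
    rewrite -[N%:R in RHS]ger0_norm ?ltW// -sqrtr_sqr -sqrtrM ?divr_ge0 ?ltW//.
    by congr Num.sqrt; rewrite /t; generalize (@pi R) => P; field; rewrite !gt_eqF.
  rewrite /pair_energy; under eq_bigr do under eq_bigr do rewrite poisson//.
  under eq_bigr do rewrite -mulr_sumr.
  by rewrite -mulr_sumr; field; rewrite gt_eqF.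
split.
- rewrite ler_pdivlMr// mul1r /pair_energy.
  rewrite -[N in N%:R]card_ord -sumr_const; apply: ler_sum => j _.
  rewrite (bigD1 j)//= subrr; apply: (le_trans (ltW (gsum0_gt1 s0))).
  by rewrite lerDl sumr_ge0// => k _; exact: gsum_ge0.
- rewrite dual ler_peMr ?sqrtr_ge0// ler_pdivlMr// mul1r.
  exact: sum_gcos_ge.
- by move=> t13; rewrite ler_pdivlMr// mulrC pair_energy_low.
- move=> b13; rewrite dual ler_wpM2l ?sqrtr_ge0// ler_pdivlMr// mulrC.
  have <- : pi ^+ 2 / t / N%:R ^+ 2 = pi ^+ 2 / s.
    by rewrite /t; generalize (@pi R) => P; field; rewrite !gt_eqF.
  exact: spectrum_bound.
Qed.

Lemma le_of_sqr x t : 0 <= t -> x ^+ 2 <= t ^+ 2 -> x <= t.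
Proof. by move=> t0 h; apply: le_trans (ler_norm x) _; rewrite -[leRHS]ger0_norm// -ler_sqr ?nnegrE// !real_normK ?num_real. Qed.

Lemma pi2_13 : 739 / 100 <= pi ^+ 2 / (13 / 10) :> R.
Proof.
by rewrite ler_pdivlMr; [have := @pi_sqr_ge R; lra | lra].
Qed.

(* Here [b1], [b2] are the dual parameters, and [X] is that of the dual hexagonal lattice. *)
Lemma dual_mixed (b1 b2 X : R) : 0 < X -> 0 < b1 -> 739 / 100 <= b2 -> b1 <= b2 ->
  7 / 2 <= X -> b1 * b2 = 3 / 4 * X ^+ 2 ->
  605 / 100 * expR (- X) < 2 * expR (- b1).
Proof.
move=> X0 b10 b2l b12 X72 E.
have h : b1 + 112 / 100 <= X.
  have [b23|b23] := leP b1 (23 / 10); first lra.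
  apply: le_of_sqr; first lra.
  have [bs|bs] := leP b1 (739 / 100).
    have h1 : b1 * (739 / 100) <= b1 * b2 by rewrite ler_pM2l.
    have h2 : 0 <= (b1 - 23 / 10) * (739 / 100 - b1) by apply: mulr_ge0; lra.
    rewrite expr2; rewrite expr2 in E; lra.
  have h1 : b1 * b1 <= b1 * b2 by rewrite ler_pM2l.
  have h2 : 0 <= (b1 - 739 / 100) * (b1 - 739 / 100) by apply: mulr_ge0; lra.
  rewrite expr2; rewrite expr2 in E; lra.
have -> : expR (- b1) = expR (- X) * expR (X - b1) by rewrite -expRD; congr expR; ring.
have e0 := expR_gt0 (- X).
have e1 : expR (112 / 100) <= expR (X - b1) by rewrite ler_expR; lra.
have e2 := @expR_ge_taylor5 R (112 / 100).
have : expR (- X) * (3061 / 1000) <= expR (- X) * expR (X - b1).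
  by rewrite ler_pM2l//; lra.
lra.
Qed.

(** If [b2] exceeds [b1] by 2, then X >= b1 + 1.9 and exp (- b1) suffices. Otherwise X exceeds the
    arithmetic mean by 1.12 and the inequality of means is applied to the exponentials. *)
Lemma dual_both (b1 b2 X : R) : 0 < X -> 739 / 100 <= b1 -> b1 <= b2 ->
  b1 * b2 = 3 / 4 * X ^+ 2 ->
  605 / 100 * expR (- X) < expR (- b1) + expR (- b2).
Proof.
move=> X0 b1l b12 E.
have e0 := expR_gt0 (- X); have eb2 := expR_gt0 (- b2).
have [d2|d2] := leP (b1 + 2) b2.
  have h : b1 + 19 / 10 <= X.
    apply: le_of_sqr; first lra.
    have h1 : b1 * (b1 + 2) <= b1 * b2 by rewrite ler_pM2l//; lra.
    have h2 : 0 <= (b1 - 739 / 100) * (b1 - 739 / 100) by apply: mulr_ge0; lra.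
    rewrite expr2; rewrite expr2 in E; lra.
  have -> : expR (- b1) = expR (- X) * expR (X - b1) by rewrite -expRD; congr expR; ring.
  have e1 : expR (19 / 10) <= expR (X - b1) by rewrite ler_expR; lra.
  have e2 := @expR_ge_taylor5 R (19 / 10).
  have : expR (- X) * (65 / 10) <= expR (- X) * expR (X - b1).
    by rewrite ler_pM2l//; lra.
  lra.
pose M := (b1 + b2) / 2.
have h : M + 112 / 100 <= X.
  apply: le_of_sqr; first lra.
  have h2 : 0 <= (b2 - b1) * (2 - (b2 - b1)) by apply: mulr_ge0; lra.
  have h3 : 0 <= (b1 - 739 / 100) * (b1 - 739 / 100) by apply: mulr_ge0; lra.
  have h4 : 0 <= (b1 - 739 / 100) * (b2 - b1) by apply: mulr_ge0; lra.
  rewrite /M expr2; rewrite expr2 in E; lra.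
have amgm : 2 * expR (- M) <= expR (- b1) + expR (- b2).
  pose u := expR (- (b1 / 2)); pose v := expR (- (b2 / 2)).
  have -> : expR (- M) = u * v by rewrite -expRD; congr expR; rewrite /M; field.
  have -> : expR (- b1) = u * u by rewrite -expRD; congr expR; field.
  have -> : expR (- b2) = v * v by rewrite -expRD; congr expR; field.
  by have := sqr_ge0 (u - v); rewrite expr2; lra.
have EM : expR (- M) = expR (- X) * expR (X - M) by rewrite -expRD; congr expR; ring.
have e1 : expR (112 / 100) <= expR (X - M) by rewrite ler_expR; lra.
have e2 := @expR_ge_taylor5 R (112 / 100).
have : expR (- X) * (3061 / 1000) <= expR (- X) * expR (X - M).
  by rewrite ler_pM2l//; lra.
lra.
Qed.

(** Equally spaced points bound both factors, so the competitor is a rectangular lattice, which is a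
    reduced form with B = 0. *)
Lemma product_bound_large t1 t2 e1 e2 X : 0 < X ->
  t1 * t2 = 3 / 4 * X ^+ 2 -> 13 / 10 <= t1 -> t1 <= t2 ->
  gsum t1 0 <= e1 -> gsum t2 0 <= e2 ->
  qsum X (X / 2) X 0 0 < e1 * e2.
Proof.
move=> X0 E h1 h2 g1 g2.
have := @montgomery R t1 0 t2 X X0; rewrite mulr0 lexx/= expr0n subr0.
have t10 : 0 < t1 by lra.
have t20 : 0 < t2 by lra.
move=> /(_ (ltW t10) h2 E) [[_ B _]|]; first lra.
move=> h; apply: lt_le_trans h _; rewrite qsum_diag// ler_pM ?gsum_ge0//.
Qed.

(** For X >= 7/2 the zero mode gives e1 >= 3/2, more than the hexagonal sum. Otherwise everything is
    dualised: a sparse second factor keeps both its first dual modes, a dense one contributes its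
    first-mode bound like the first factor. *)
Lemma product_bound_aux t1 t2 e1 e2 X : 0 < X -> 0 < t1 -> t1 < 13 / 10 -> t1 <= t2 ->
  t1 * t2 = 3 / 4 * X ^+ 2 ->
  line_bound t1 e1 -> line_bound t2 e2 ->
  qsum X (X / 2) X 0 0 < e1 * e2.
Proof.
move=> X0 t10 t113 t12 E [e11 q1 _ d1] [e21 q2 g2 d2].
have t20 : 0 < t2 by lra.
have pi31 := @pi_ge31 R; have pi0 := @pi_gt0 R.
have [Dl|Ds] := leP (7 / 2) X.
  have hh := @hex_le R X (_ : 3 <= X); have {}hh := hh ltac:(lra).
  have s1 : 3 / 2 <= Num.sqrt (pi / t1).
    apply: le_of_sqr; rewrite ?sqrtr_ge0// sqr_sqrtr ?(ltW (divr_gt0 pi0 t10))//.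
    rewrite ler_pdivlMr// expr2.
    have : 3 / 2 * (3 / 2) * t1 <= 3 / 2 * (3 / 2) * (13 / 10) by rewrite ler_wpM2l; lra.
    lra.
  have ex : expR (- X) * expR (7 / 2) <= 1.
    by rewrite -expRD -[leRHS]expR0 ler_expR; lra.
  have t5 := @expR_ge_taylor3 R (7 / 2).
  have ex2 : expR (- X) * (177 / 10) <= expR (- X) * expR (7 / 2).
    by rewrite ler_wpM2l ?expR_ge0//; lra.
  have : 3 / 2 * 1 <= e1 * e2 by apply: ler_pM; lra.
  lra.
pose k : R := pi ^+ 2 / (3 / 4 * X ^+ 2).
have X20 : 0 < X ^+ 2 by rewrite exprn_gt0.
have D0 : 0 < 3 / 4 * X ^+ 2 by lra.
have k0 : 0 < k by rewrite divr_gt0// exprn_gt0.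
pose b1 := pi ^+ 2 / t1; pose b2 := pi ^+ 2 / t2.
have b10 : 0 < b1 by rewrite divr_gt0// exprn_gt0.
have b20 : 0 < b2 by rewrite divr_gt0// exprn_gt0.
have b21 : b2 <= b1 by rewrite ler_wpM2l ?sqr_ge0// lef_pV2.
have XX : 0 < k * X by rewrite mulr_gt0.
have bb : b2 * b1 = 3 / 4 * (k * X) ^+ 2.
  have -> : b2 * b1 = pi ^+ 4 / (t1 * t2).
    by rewrite /b1 /b2; generalize (@pi R) => P; field; rewrite !gt_eqF.
  rewrite E /k; generalize (@pi R) => P; field; rewrite gt_eqF//.
have b1l : 739 / 100 <= b1.
  apply: le_trans pi2_13 _; rewrite ler_wpM2l ?sqr_ge0// lef_pV2 ?posrE//; lra.
have X72 : 7 / 2 <= k * X.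
  have -> : k * X = 4 / 3 * pi ^+ 2 / X.
    by rewrite /k; generalize (@pi R) => P; field; rewrite gt_eqF.
  rewrite ler_pdivlMr//.
  by have := @pi_sqr_ge R; generalize (@pi R ^+ 2) => P; lra.
have DD : X * X - (X / 2) ^+ 2 = 3 / 4 * X ^+ 2 by field.
have dual := @qsum_duality R X (X / 2) X X0.
rewrite DD -/k in dual; have {}dual := dual D0.
have -> : qsum X (X / 2) X 0 0 = Num.sqrt k * qsum (k * X) (k * X / 2) (k * X) 0 0.
  by rewrite dual mulrA.
have kE : Num.sqrt k = Num.sqrt (pi / t1) * Num.sqrt (pi / t2).
  rewrite -sqrtrM ?divr_ge0 ?ltW//; congr Num.sqrt; rewrite /k -E.
  by generalize (@pi R) => P; field; rewrite !gt_eqF.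
have hh := @hex_le R (k * X) ltac:(lra).
have sk0 : 0 < Num.sqrt k by rewrite sqrtr_gt0.
apply: (@le_lt_trans _ _ (Num.sqrt k * (1 + 605 / 100 * expR (- (k * X))))).
  by rewrite ler_pM2l.
have [p1 p2] : 0 <= Num.sqrt (pi / t1) /\ 0 <= Num.sqrt (pi / t2) by rewrite !sqrtr_ge0.
have x1 := expR_ge0 (- b1); have x2 := expR_ge0 (- b2).
have [t213|t213] := leP (13 / 10) t2.
  have b2b1 : b2 <= b1 by [].
  have m := @dual_mixed b2 b1 (k * X) XX b20 b1l b21 X72 bb.
  apply: (@lt_le_trans _ _ (Num.sqrt k * (1 + 2 * expR (- b2)))).
    by rewrite ltr_pM2l// ltrD2l.
  rewrite kE -mulrA; apply: ler_pM => //.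
  apply: le_trans (g2 t213); rewrite (poisson _ t20) ler_wpM2l// gcos0//.
  have := @hasum_ge_seq R int setT [:: 0%:Z; 1%:Z; -1%:Z] _ _ isT (fun _ _ => I)
    (hasum_gsum 0 b20).
  rewrite !big_cons big_nil !addr0 expr0n mulr0 oppr0 expR0 -/b2.
  rewrite rmorphN/= sqrrN expr1n mulr1; lra.
have b2l : 739 / 100 <= b2.
  apply: le_trans pi2_13 _; rewrite ler_wpM2l ?sqr_ge0// lef_pV2 ?posrE//; lra.
have m := @dual_both b2 b1 (k * X) XX b2l b21 bb.
apply: (@lt_le_trans _ _ (Num.sqrt k * ((1 + expR (- b1)) * (1 + expR (- b2))))).
  rewrite ltr_pM2l//; have := mulr_ge0 x1 x2; lra.
rewrite kE mulrACA; apply: ler_pM.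
- by apply: mulr_ge0; [exact: p1|lra].
- by apply: mulr_ge0; [exact: p2|lra].
- by apply: d1; rewrite -/b1; lra.
- by apply: d2; rewrite -/b2; lra.
Qed.

Lemma product_bound t1 t2 e1 e2 X : 0 < X -> 0 < t1 -> 0 < t2 ->
  t1 * t2 = 3 / 4 * X ^+ 2 ->
  line_bound t1 e1 -> line_bound t2 e2 ->
  qsum X (X / 2) X 0 0 < e1 * e2.
Proof.
move=> X0; wlog : t1 t2 e1 e2 / t1 <= t2 => [H t10 t20 E l1 l2|t12 t10 t20 E l1 l2].
  have /orP[t12|t21] := le_total t1 t2; first exact: (H t1 t2).
  by rewrite [e1 * e2]mulrC; apply: (H t2 t1) => //; rewrite mulrC.
have [t1l|t1s] := leP (13 / 10) t1; last exact: product_bound_aux t1s t12 E l1 l2.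
case: l1 => _ _ g1 _; case: l2 => _ _ g2 _.
exact: (product_bound_large X0 E t1l t12 (g1 t1l) (g2 (le_trans t1l t12))).
Qed.

End ProductBound.

(** * Gauss reduction, and doubled rectangular lattices *)

Section Reduction.
Variable R : realType.
Implicit Types (A B C X : R).

Lemma min_on_seq (T : eqType) (F : T -> R) (P : T -> Prop) (s : seq T) :
  (exists2 z, z \in s & P z) ->
  exists z, P z /\ forall z', z' \in s -> P z' -> F z <= F z'.
Proof.
elim: s => [[z] //|a s IH] [z0 z0s Pz0].
have [/IH[z [Pz hz]]|ns] := pselect (exists2 z, z \in s & P z).
  have [[Pa Fa]|na] := pselect (P a /\ F a <= F z).
    exists a; split=> // z'; rewrite inE => /orP[/eqP -> //|z's Pz'].
    by apply: le_trans Fa _; apply: hz.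
  exists z; split=> // z'; rewrite inE => /orP[/eqP -> Pa|z's Pz']; last exact: hz.
  by rewrite leNgt; apply/negP => /ltW Fa; apply: na.
have [Pa|na] := pselect (P a).
  exists a; split=> // z'; rewrite inE => /orP[/eqP -> //|z's Pz'].
  by case: ns; exists z'.
exfalso; move: z0s; rewrite inE => /orP[/eqP E|z0s]; first by apply: na; rewrite -E.
by apply: ns; exists z0.
Qed.

Lemma qform_bounds A B C (x y : R) : 0 < C -> 0 < A * C - B ^+ 2 ->
  (A * C - B ^+ 2) * x ^+ 2 <= C * qform A B C x y /\
  (A * C - B ^+ 2) * y ^+ 2 <= A * qform A B C x y.
Proof.
move=> C0 D0; split; rewrite -subr_ge0 /qform.
  by rewrite (_ : _ - _ = (B * x + C * y) ^+ 2) ?sqr_ge0//; ring.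
by rewrite (_ : _ - _ = (A * x + B * y) ^+ 2) ?sqr_ge0//; ring.
Qed.

(** The discriminant bounds both coordinates by the value of the form, so the search is finite. *)
Lemma qform_min A B C (P : int * int -> Prop) z0 : 0 < A -> 0 < C ->
  0 < A * C - B ^+ 2 -> P z0 ->
  exists z, P z /\ forall z', P z' ->
    qform A B C z.1%:~R z.2%:~R <= qform A B C z'.1%:~R z'.2%:~R.
Proof.
move=> A0 C0; set D := _ - _ => D0 Pz0.
pose Q (z : int * int) := qform A B C z.1%:~R z.2%:~R.
have Q0 z : 0 <= Q z.
  have [h _] := qform_bounds z.1%:~R z.2%:~R C0 D0.
  rewrite -(pmulr_rge0 _ C0); apply: le_trans h.
  exact: (mulr_ge0 (ltW D0) (sqr_ge0 _)).
have K0 : 0 <= (A + C) * Q z0 / D.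
  exact: (divr_ge0 (mulr_ge0 (addr_ge0 (ltW A0) (ltW C0)) (Q0 z0)) (ltW D0)).
pose M := Num.Def.archi_bound ((A + C) * Q z0 / D).
have hM := archi_boundP K0; rewrite -/M in hM.
pose r := [seq Posz m | m <- iota 0 M] ++ [seq Negz m | m <- iota 0 M].
have rP (x : int) : D * x%:~R ^+ 2 <= (A + C) * Q z0 -> x \in r.
  move=> h; have {}h : x%:~R ^+ 2 < M%:R :> R.
    by apply: le_lt_trans hM; rewrite ler_pdivlMr// mulrC.
  have {}h : (`|x| < M)%N.
    move: h; rewrite -real_normK ?num_real// -intr_norm -abszE -pmulrn -natrX ltr_nat.
    apply: leq_ltn_trans; case: `|x|%N => // n.
    by rewrite -[X in (X <= _)%N](expn1 n.+1) leq_pexp2l.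
  rewrite mem_cat; apply/orP; case: x h => n h; [left|right]; apply/mapP; exists n => //.
    by rewrite mem_iota.
  by rewrite mem_iota/= ltnW.
have sP z : Q z <= Q z0 -> z \in [seq (x, y) | x <- r, y <- r].
  move=> h; have [h1 h2] := qform_bounds z.1%:~R z.2%:~R C0 D0.
  have h3 := Q0 z0; have h4 : C * Q z <= C * Q z0 by rewrite ler_pM2l.
  have h5 : A * Q z <= A * Q z0 by rewrite ler_pM2l.
  have h6 := mulr_ge0 (ltW A0) h3; have h7 := mulr_ge0 (ltW C0) h3.
  apply/allpairsP; exists z; split; [| |by case: (z)]; apply: rP.
    by apply: (le_trans h1); rewrite mulrDl; rewrite -/(Q z); lra.
  by apply: (le_trans h2); rewrite mulrDl; rewrite -/(Q z); lra.
have [|z [Pz hz]] := @min_on_seq _ Q P [seq (x, y) | x <- r, y <- r].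
  by exists z0 => //; apply: sP.
exists z; split=> // z' Pz'.
have [h|/ltW h] := leP (Q z') (Q z0); first by apply: hz => //; apply: sP.
by apply: le_trans h; apply: hz => //; apply: sP.
Qed.

(** A primitive vector of least value is completed to a basis. The second vector is reduced modulo
    the first and its sign flipped if needed, hence a determinant of either sign; it is primitive
    too, so its value is no smaller. *)
Lemma gauss_reduction A B C : 0 < A -> 0 < C -> 0 < A * C - B ^+ 2 ->
  exists u v a b : int, (u * b - v * a) ^+ 2 = 1 /\
    let A' := qform A B C u%:~R v%:~R in
    let B' := A * u%:~R * a%:~R + B * (u%:~R * b%:~R + v%:~R * a%:~R) + C * v%:~R * b%:~R in
    0 <= 2 * B' <= A' /\ A' <= qform A B C a%:~R b%:~R.
Proof.
move=> A0 C0 D0.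
pose P (z : int * int) := exists a b : int, z.1 * b - z.2 * a = 1.
have [|[u v] [[a [b /= uv]] hz]] := @qform_min A B C P (1, 0) A0 C0 D0.
  by exists 0, 1; rewrite /= mul0r subr0 mulr1.
pose A' := qform A B C u%:~R v%:~R.
pose B0 := A * u%:~R * a%:~R + B * (u%:~R * b%:~R + v%:~R * a%:~R) + C * v%:~R * b%:~R.
have A'0 : 0 < A'.
  have uv0 : u%:~R * b%:~R - v%:~R * a%:~R = 1 :> R.
    by rewrite -[RHS]/(1%:~R) -uv rmorphB/= !intrM.
  have [h1 h2] := qform_bounds (u%:~R : R) v%:~R C0 D0; rewrite -/A' in h1 h2.
  have [A'0|//] := leP A' 0.
  have c1 : C * A' <= 0 by rewrite pmulr_rle0.
  have c2 : A * A' <= 0 by rewrite pmulr_rle0.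
  have u2 : u%:~R ^+ 2 <= 0 :> R by rewrite -(pmulr_rle0 _ D0) (le_trans h1).
  have v2 : v%:~R ^+ 2 <= 0 :> R by rewrite -(pmulr_rle0 _ D0) (le_trans h2).
  have u0 : u%:~R = 0 :> R.
    by apply/eqP; rewrite -sqrf_eq0 eq_le u2 sqr_ge0.
  have v0 : v%:~R = 0 :> R.
    by apply/eqP; rewrite -sqrf_eq0 eq_le v2 sqr_ge0.
  by move: uv0; rewrite u0 v0; lra.
(* The integer nearest to [B0 / A']. *)
pose k := Num.floor (B0 / A' + 1 / 2).
have /andP[k1 k2] : k%:~R <= B0 / A' + 1 / 2 < (k + 1)%:~R by exact: floor_itv.
pose a' := a - k * u; pose b' := b - k * v.
pose B1 := A * u%:~R * a'%:~R + B * (u%:~R * b'%:~R + v%:~R * a'%:~R) + C * v%:~R * b'%:~R.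
have uv' : u * b' - v * a' = 1 by rewrite -uv /a' /b'; ring.
have B1E : B1 = B0 - k%:~R * A'.
  by rewrite /B1 /B0 /A' /qform /a' /b' !rmorphB/= !intrM; ring.
have B1b : - A' <= 2 * B1 <= A'.
  rewrite intrD in k2.
  have k1' : (k%:~R - 1 / 2) * A' <= B0 by rewrite -ler_pdivlMr//; lra.
  have k2' : B0 <= (k%:~R + 1 / 2) * A' by rewrite -ler_pdivrMr//; lra.
  by rewrite B1E; apply/andP; split; lra.
have le' : A' <= qform A B C a'%:~R b'%:~R.
  by apply: (hz (a', b')); exists (- u), (- v) => /=; rewrite -uv'; ring.
have /andP[B1l B1u] := B1b.
have [B10|B10] := leP 0 B1.
  exists u, v, a', b'; rewrite uv' expr1n; split=> //; split=> //=.
  by apply/andP; split; [apply: mulr_ge0|].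
exists u, v, (- a'), (- b'); split.
  by rewrite -[RHS](expr1n _ 2) -uv'; ring.
rewrite /=; split; last first.
  by rewrite !rmorphN/= (le_trans le')// /qform le_eqVlt; apply/orP; left; apply/eqP; ring.
rewrite !rmorphN/=.
have -> : A * u%:~R * - a'%:~R + B * (u%:~R * - b'%:~R + v%:~R * - a'%:~R) + C * v%:~R * - b'%:~R = - B1.
  by rewrite /B1; ring.
by apply/andP; split; rewrite -/A'; lra.
Qed.

Lemma qform_unimodular A B C (u v a b x y : R) :
  qform A B C (u * x + a * y) (v * x + b * y) =
  qform (qform A B C u v) (A * u * a + B * (u * b + v * a) + C * v * b) (qform A B C a b) x y.
Proof. by rewrite /qform; ring. Qed.

Lemma disc_unimodular A B C (u v a b : R) :
  qform A B C u v * qform A B C a b - (A * u * a + B * (u * b + v * a) + C * v * b) ^+ 2 =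
  (A * C - B ^+ 2) * (u * b - v * a) ^+ 2.
Proof. by rewrite /qform; ring. Qed.

Lemma unimodular_bij (u v a b : int) : (u * b - v * a) ^+ 2 = 1 ->
  set_bij [set: int * int] [set: int * int]
    (fun z : int * int => (u * z.1 + a * z.2, v * z.1 + b * z.2)).
Proof.
set d := u * b - v * a => dd.
have inj z : (d * (b * (u * z.1 + a * z.2) - a * (v * z.1 + b * z.2)),
    d * (u * (v * z.1 + b * z.2) - v * (u * z.1 + a * z.2))) = z.
  case: z => x y /=; congr (_, _).
    have -> : d * (b * (u * x + a * y) - a * (v * x + b * y)) = d ^+ 2 * x by rewrite /d; ring.
    by rewrite dd mul1r.
  have -> : d * (u * (v * x + b * y) - v * (u * x + a * y)) = d ^+ 2 * y by rewrite /d; ring.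
  by rewrite dd mul1r.
split=> //.
  by move=> z z' _ _ [h1 h2]; rewrite -(inj z) -(inj z') h1 h2.
move=> [x y] _; exists (d * (b * x - a * y), d * (u * y - v * x)) => //=; congr (_, _).
  have -> : u * (d * (b * x - a * y)) + a * (d * (u * y - v * x)) = d ^+ 2 * x by rewrite /d; ring.
  by rewrite dd mul1r.
have -> : v * (d * (b * x - a * y)) + b * (d * (u * y - v * x)) = d ^+ 2 * y by rewrite /d; ring.
by rewrite dd mul1r.
Qed.

Lemma qsum_hex_le A B C X : 0 < X -> 0 < A -> 0 < C ->
  A * C - B ^+ 2 = 3 / 4 * X ^+ 2 -> qsum X (X / 2) X 0 0 <= qsum A B C 0 0.
Proof.
move=> X0 A0 C0 D; have D0 : 0 < A * C - B ^+ 2 by rewrite D mulr_gt0// exprn_gt0.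
have [u [v [a [b [uv /= [h1 h2]]]]]] := gauss_reduction A0 C0 D0.
set A' := qform A B C u%:~R v%:~R in h1 h2.
set B' := _ + _ in h1; set C' := qform _ _ _ _ _ in h2.
have D' : A' * C' - B' ^+ 2 = 3 / 4 * X ^+ 2.
  by rewrite disc_unimodular D -[_ - _]/(_ - _) -!intrM -rmorphB/= -rmorphXn/= uv mulr1.
have D'0 : 0 < A' * C' - B' ^+ 2 by rewrite D' mulr_gt0// exprn_gt0.
have C'0 : 0 < C'.
  have /andP[p1 p2] := h1; have c0 : 0 <= C' by lra.
  rewrite lt_neqAle c0 andbT eq_sym; apply/negP => /eqP E.
  by move: D'0; rewrite E mulr0 sub0r oppr_gt0; have := sqr_ge0 B'; lra.
have -> : qsum A B C 0 0 = qsum A' B' C' 0 0.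
  apply: hasum_uniq (hasum_qsum 0 0 C'0 D'0).
  have := (hasum_bij _ _ (unimodular_bij uv)).1 (hasum_qsum 0 0 C0 D0).
  apply: hasum_ext => -[x y] _ /=; congr (expR (- _)).
  by rewrite !addr0 !intrD !intrM qform_unimodular.
by have [[-> -> ->]//|/ltW] := montgomery X0 h1 h2 D'.
Qed.

Lemma qsum_centred A C : 0 < A -> 0 < C ->
  qsum ((A + C) / 4) (A / 2) A 0 0 =
  gsum A 0 * gsum C 0 + gsum C (1 / 2) * gsum A (1 / 2).
Proof.
move=> A0 C0; have D : (A + C) / 4 * A - (A / 2) ^+ 2 = A * C / 4 by field.
have D0 : 0 < (A + C) / 4 * A - (A / 2) ^+ 2 by rewrite D divr_gt0// mulr_gt0.
apply: hasum_uniq (hasum_qsumE 0 0 A0 D0) _; rewrite D.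
have e1 : A * C / 4 / A = C / 4 by field; rewrite gt_eqF.
have e2 : A / 2 / A = 1 / 2 by field; rewrite gt_eqF.
rewrite e1 e2; apply: hasum_parity.
  have := hasumZ (gsum_ge0 0 A0) (hasum_gsum 0 C0).
  apply: hasum_ext => m _; rewrite mulrC; congr (expR (- _) * _).
    by rewrite intrM; field.
  by rewrite -[LHS](gsumDz _ m)//; congr gsum; rewrite intrM; field.
have := hasumZ (gsum_ge0 (1 / 2) A0) (hasum_gsum (1 / 2) C0).
move=> h; apply: hasum_ext (hasum_eq (mulrC _ _) h) => m _; rewrite mulrC; congr (expR (- _) * _).
  by rewrite intrD intrM; field.
by rewrite -[LHS](gsumDz _ m)//; congr gsum; rewrite intrD intrM; field.
Qed.

Lemma gsum_gt0 s x : 0 < s -> 0 < gsum s x :> R.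
Proof.
move=> s0; have := hasum_ge_seq (r := [:: 0%:Z]) isT (fun _ _ => I) (hasum_gsum x s0).
by apply: lt_le_trans; rewrite big_seq1 expR_gt0.
Qed.

Lemma gsum_half_le_any s x : 0 < s -> gsum s (1 / 2) <= gsum s x :> R.
Proof.
move=> s0; have [[z ->]|nz] := pselect (exists z : int, x = 1 / 2 + z%:~R).
  by rewrite gsumDz.
apply/ltW/gsum_half_lt => // z; apply/eqP => E; apply: nz; by exists z.
Qed.

(** Moving the shift to the half periods only lowers the sum, strictly unless it is there already,
    and the centred lattice reached is bounded by [qsum_hex_le]. The exceptional shift is returned
    because the configuration is then a lattice. *)
Lemma rect_double A C X x y : 0 < X -> 0 < A -> 0 < C -> A * C = 3 * X ^+ 2 ->
  (exists m n : int, x = 1 / 2 + m%:~R /\ y = 1 / 2 + n%:~R) \/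
  qsum X (X / 2) X 0 0 < qsum A 0 C 0 0 + qsum A 0 C x y.
Proof.
move=> X0 A0 C0 E; rewrite !qsum_diag//.
have h1 : qsum X (X / 2) X 0 0 <= gsum A 0 * gsum C 0 + gsum C (1 / 2) * gsum A (1 / 2).
  rewrite -qsum_centred//; apply: qsum_hex_le => //; first by rewrite divr_gt0// addr_gt0.
  have -> : (A + C) / 4 * A - (A / 2) ^+ 2 = A * C / 4 by field.
  by rewrite E; field.
have gA := gsum_gt0 (1 / 2) A0; have gC := gsum_gt0 (1 / 2) C0.
have hA := gsum_half_le_any x A0; have hC := gsum_half_le_any y C0.
have [[m xE]|nx] := pselect (exists z : int, x = 1 / 2 + z%:~R); last first.
  right; apply: le_lt_trans h1 _; rewrite ltrD2l mulrC.
  apply: (@lt_le_trans _ _ (gsum A x * gsum C (1 / 2))).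
    rewrite ltr_pM2r//; apply: gsum_half_lt => // z; apply/eqP => E'; apply: nx; by exists z.
  by rewrite ler_pM2l// gsum_gt0.
have [[n yE]|ny] := pselect (exists z : int, y = 1 / 2 + z%:~R).
  by left; exists m, n.
right; apply: le_lt_trans h1 _; rewrite ltrD2l mulrC.
apply: (@lt_le_trans _ _ (gsum A (1 / 2) * gsum C y)).
  rewrite ltr_pM2l//; apply: gsum_half_lt => // z; apply/eqP => E'; apply: ny; by exists z.
by rewrite ler_pM2r// gsum_gt0.
Qed.

End Reduction.

(** * Theta series as the Gaussian flattens *)

Section SmallParameter.
Variable R : realType.
Implicit Types (A B C : R).

Lemma gsum_dual_near (s : R) : 0 < s <= 1 -> 1 < gsum (pi ^+ 2 / s) 0 <= 1 + s.
Proof.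
move=> /andP[s0 s1].
have p9 := @pi_sqr_ge R.
set b := pi ^+ 2 / s.
have bs : 9 <= b * s by rewrite /b divfK ?gt_eqF//; lra.
have b0 : 0 < b by rewrite divr_gt0//; lra.
have b9 : 9 <= b by apply: le_trans bs _; rewrite ler_piMr// ltW.
rewrite gsum0_gt1//=; apply: le_trans (gsum0_le b0) _.
set q := expR (- b).
have q0 : 0 < q := expR_gt0 _.
have qb : q * (1 + b) <= 1.
  by rewrite -[leRHS](expR0 R) -(subrr b) [b - b]addrC expRD ler_pM2l// expR_ge1Dx.
have qb9 : q * 9 <= q * b by rewrite ler_pM2l.
have q3 : q ^+ 3 <= 1 / 2.
  rewrite exprS; have : q * q ^+ 2 <= q * 1.
    by rewrite ler_pM2l// exprn_ile1 ?(ltW q0)//; lra.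
  lra.
rewrite lerD2l ler_pdivrMr; last lra.
have : q * b * s <= 1 * s by rewrite ler_pM2r//; lra.
have : q * 9 <= q * (b * s) by rewrite ler_pM2l.
have : s * q ^+ 3 <= s * (1 / 2) by rewrite ler_pM2l.
lra.
Qed.

Lemma gsum_near (s x : R) : 0 < s <= 1 ->
  Num.sqrt (pi / s) * (1 - s) <= gsum s x <= Num.sqrt (pi / s) * (1 + s).
Proof.
move=> s01; have /andP[s0 s1] := s01; have /andP[h1 h2] := gsum_dual_near s01.
set b := pi ^+ 2 / s in h1 h2.
have b0 : 0 < b by rewrite divr_gt0// exprn_gt0 ?pi_gt0.
have p0 : 0 <= Num.sqrt (pi / s) by rewrite sqrtr_ge0.
rewrite (poisson _ s0) -/b; apply/andP; split; apply: ler_wpM2l => //; last first.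
  exact: le_trans (gcos_le _ b0) h2.
have := hasum_ge_seq (r := [:: 0%:Z]) isT (fun _ _ => I) (hasum_gcosE x b0).
rewrite big_seq1 expr0n mulr0 oppr0 expR0 mulr0 mul0r cos0; lra.
Qed.

(** The limit is the integral of exp (- form). What matters is that the relative error [e * K] is
    uniform in the shift. *)
Lemma qsum_near A B C (D := A * C - B ^+ 2) : 0 < C -> 0 < D ->
  exists2 K, 0 <= K & forall e x y, 0 < e -> e * K <= 1 ->
    pi / Num.sqrt D * (1 - e * K) <= e * qsum (e * A) (e * B) (e * C) x y <=
      pi / Num.sqrt D * (1 + e * K).
Proof.
move=> C0 D0; pose d := D / C; have d0 : 0 < d by rewrite divr_gt0.
have cd0 := mulr_gt0 C0 d0.
exists (1 + C + d + C * d); first lra.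
move=> e x y e0 eK0; have eK := eK0; rewrite !mulrDr mulr1 in eK.
have eC := mulr_gt0 e0 C0; have ed := mulr_gt0 e0 d0; have ecd := mulr_gt0 e0 cd0.
have De : e * A * (e * C) - (e * B) ^+ 2 = e ^+ 2 * D by rewrite /D; ring.
have De0 : 0 < e * A * (e * C) - (e * B) ^+ 2 by rewrite De mulr_gt0// exprn_gt0.
have h := hasum_qsumE x y eC De0.
have E1 : (e * A * (e * C) - (e * B) ^+ 2) / (e * C) = e * d.
  by rewrite De /d; field; rewrite !gt_eqF.
rewrite E1 in h.
have s1 : 0 < e * C <= 1 by apply/andP; split; lra.
have s2 : 0 < e * d <= 1 by apply/andP; split; lra.
pose r1 := Num.sqrt (pi / (e * C)); pose r2 := Num.sqrt (pi / (e * d)).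
have pi0 := @pi_gt0 R.
have r12 : e * (r1 * r2) = pi / Num.sqrt D.
  have -> : r1 * r2 = Num.sqrt ((pi / e) ^+ 2 / D).
    rewrite -sqrtrM ?divr_ge0 ?ltW//; congr Num.sqrt; rewrite /d.
    by generalize (@pi R) => P; field; rewrite !gt_eqF.
  rewrite sqrtrM ?sqr_ge0// sqrtr_sqr sqrtrV ?ltW// ger0_norm ?divr_ge0 ?ltW//.
  by generalize (@pi R) => P; field; rewrite !gt_eqF// sqrtr_gt0.
have [r10 r20] : 0 <= r1 /\ 0 <= r2 by rewrite !sqrtr_ge0.
have g := hasum_gsum x ed; have g0 := hasum_ge0 g.
have /andP[g1 g2] := gsum_near x s2.
have c1 : 0 <= r1 * (1 - e * C) by apply: mulr_ge0 => //; lra.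
have c2 : 0 <= r1 * (1 + e * C) by apply: mulr_ge0 => //; lra.
have lo : r1 * (1 - e * C) * gsum (e * d) x <= qsum (e * A) (e * B) (e * C) x y.
  apply: hasum_le (hasumZ c1 g) h => m _; rewrite mulrC ler_wpM2l ?expR_ge0//.
  by have /andP[] := gsum_near (y + e * B / (e * C) * (m%:~R + x)) s1.
have up : qsum (e * A) (e * B) (e * C) x y <= r1 * (1 + e * C) * gsum (e * d) x.
  apply: hasum_le h (hasumZ c2 g) => m _; rewrite [leRHS]mulrC ler_wpM2l ?expR_ge0//.
  by have /andP[] := gsum_near (y + e * B / (e * C) * (m%:~R + x)) s1.
have lo2 := le_trans (ler_wpM2l c1 g1) lo.
have up2 := le_trans up (ler_wpM2l c2 g2).
have eCd : e * C * (e * d) <= e * (C * d).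
  have -> : e * C * (e * d) = e * (C * d) * e by ring.
  by apply: ler_piMr; lra.
have eCd0 := mulr_ge0 (ltW eC) (ltW ed).
have p0 : 0 <= pi / Num.sqrt D by rewrite divr_ge0 ?sqrtr_ge0// ltW.
apply/andP; split.
  apply: le_trans (ler_wpM2l (ltW e0) lo2).
  have -> : e * (r1 * (1 - e * C) * (r2 * (1 - e * d))) =
    e * (r1 * r2) * ((1 - e * C) * (1 - e * d)) by ring.
  rewrite r12; apply: ler_wpM2l => //; lra.
apply: le_trans (ler_wpM2l (ltW e0) up2) _.
have -> : e * (r1 * (1 + e * C) * (r2 * (1 + e * d))) =
    e * (r1 * r2) * ((1 + e * C) * (1 + e * d)) by ring.
rewrite r12; apply: ler_wpM2l => //; lra.
Qed.

End SmallParameter.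

(** * Planar configurations in coordinates, and their energy *)

Section Representations.
Variable R : realType.
Implicit Types (a : R) (B : 'M[R]_2) (S : set 'cV[R]_2).

Lemma sum2 (F : 'I_2 -> R) : \sum_(i < 2) F i = F 0 + F 1.
Proof.
rewrite !big_ord_recl big_ord0 addr0; congr (F _ + F _); exact/val_inj.
Qed.

Definition pt B (x y : R) : 'cV[R]_2 := \col_i (B i 0 * x + B i 1 * y).

Lemma ptD B x y x' y' : pt B (x + x') (y + y') = pt B x y + pt B x' y'.
Proof. by apply/matrixP => i j; rewrite !mxE; ring. Qed.

Lemma ptB B x y x' y' : pt B (x - x') (y - y') = pt B x y - pt B x' y'.
Proof. by apply/matrixP => i j; rewrite !mxE; ring. Qed.

Lemma pt00 B : pt B 0 0 = 0.
Proof. by apply/matrixP => i j; rewrite !mxE !mulr0 addr0. Qed.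

Lemma mulmx_pt B (v : 'cV[R]_2) : B *m v = pt B (v 0 0) (v 1 0).
Proof.
by apply/matrixP => i j; rewrite !mxE sum2 ord1.
Qed.

Lemma pt_surj B v : B \in unitmx -> exists x y, v = pt B x y.
Proof.
by move=> uB; exists ((invmx B *m v) 0 0), ((invmx B *m v) 1 0); rewrite -mulmx_pt mulKVmx.
Qed.

Lemma pt_inj B x y x' y' : B \in unitmx -> pt B x y = pt B x' y' -> x = x' /\ y = y'.
Proof.
move=> uB; pose c (a b : R) : 'cV[R]_2 := \col_i (if i == 0 then a else b).
have cE a b : pt B a b = B *m c a b by rewrite mulmx_pt !mxE.
rewrite !cE => /(can_inj (mulKmx uB)) /matrixP E.
by have := E 0 0; have := E 1 0; rewrite !mxE.
Qed.

Lemma lattice_ofE B v : lattice_of B v <-> exists m n : int, v = pt B m%:~R n%:~R.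
Proof.
split=> [[z _ <-]|[m [n ->]]].
  by exists (z 0 0), (z 1 0); rewrite mulmx_pt !mxE.
exists (\col_i (if i == 0 then m else n)) => //.
by rewrite mulmx_pt !mxE.
Qed.

Lemma det2 B : \det B = B 0 0 * B 1 1 - B 0 1 * B 1 0.
Proof.
have e : lift 0 0 = 1 :> 'I_2 by exact/val_inj.
rewrite (expand_det_row _ 0) sum2 /cofactor !det_mx11 !mxE /= !addn0 !addn1 expr0 expr1.
have -> : lift 0 (0 : 'I_1) = 1 :> 'I_2 by exact/val_inj.
have -> : lift 1 (0 : 'I_1) = 0 :> 'I_2 by exact/val_inj.
ring.
Qed.

Definition gramA (a : R) B := a * (B 0 0 ^+ 2 + B 1 0 ^+ 2).
Definition gramB (a : R) B := a * (B 0 0 * B 0 1 + B 1 0 * B 1 1).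
Definition gramC (a : R) B := a * (B 0 1 ^+ 2 + B 1 1 ^+ 2).

Lemma gram_disc a B : gramA a B * gramC a B - gramB a B ^+ 2 = (a * \det B) ^+ 2.
Proof. by rewrite /gramA /gramB /gramC det2; ring. Qed.

Lemma unitmx_det B : (B \in unitmx) = (\det B != 0).
Proof. by rewrite unitmxE unitfE. Qed.

Lemma gram_disc_gt0 a B : 0 < a -> B \in unitmx ->
  0 < gramA a B * gramC a B - gramB a B ^+ 2.
Proof.
by move=> a0; rewrite unitmx_det gram_disc => d0; rewrite lt0r sqrf_eq0 mulf_neq0 ?sqr_ge0// gt_eqF.
Qed.

Lemma gramC_gt0 a B : 0 < a -> B \in unitmx -> 0 < gramC a B.
Proof.
move=> a0 uB; have D0 := gram_disc_gt0 a0 uB.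
have c0 : 0 <= gramC a B by apply: mulr_ge0 (ltW a0) (addr_ge0 (sqr_ge0 _) (sqr_ge0 _)).
rewrite lt0r c0 andbT; apply/negP => /eqP E.
by move: D0; rewrite E mulr0 sub0r oppr_gt0 ltNge sqr_ge0.
Qed.

Lemma gramA_gt0 a B : 0 < a -> B \in unitmx -> 0 < gramA a B.
Proof.
move=> a0 uB; have D0 := gram_disc_gt0 a0 uB.
have c0 : 0 <= gramA a B by apply: mulr_ge0 (ltW a0) (addr_ge0 (sqr_ge0 _) (sqr_ge0 _)).
rewrite lt0r c0 andbT; apply/negP => /eqP E.
by move: D0; rewrite E mul0r sub0r oppr_gt0 ltNge sqr_ge0.
Qed.

Lemma gaussian_pt a B x y :
  gaussian a (eucl_norm (pt B x y)) = expR (- qform (gramA a B) (gramB a B) (gramC a B) x y).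
Proof.
rewrite /gaussian /eucl_norm sqr_sqrtr; last first.
  by apply: sumr_ge0 => i _; exact: sqr_ge0.
by congr (expR (- _)); rewrite sum2 !mxE /qform /gramA /gramB /gramC; ring.
Qed.

Definition lsum a B x y := qsum (gramA a B) (gramB a B) (gramC a B) x y.

Lemma hasum_lsum a B x y : 0 < a -> B \in unitmx ->
  hasum [set: int * int]
    (fun k => gaussian a (eucl_norm (pt B (k.1%:~R + x) (k.2%:~R + y)))) (lsum a B x y).
Proof.
move=> a0 uB; have := hasum_qsum x y (gramC_gt0 a0 uB) (gram_disc_gt0 a0 uB).
by apply: hasum_ext => k _; rewrite gaussian_pt.
Qed.

Lemma lsumDz a B x y (m n : int) : 0 < a -> B \in unitmx ->
  lsum a B (x + m%:~R) (y + n%:~R) = lsum a B x y.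
Proof. by move=> a0 uB; rewrite /lsum qsumDz ?gramC_gt0 ?gram_disc_gt0. Qed.

Lemma lsumN a B x y : 0 < a -> B \in unitmx -> lsum a B (- x) (- y) = lsum a B x y.
Proof. by move=> a0 uB; rewrite /lsum qsumN ?gramC_gt0 ?gram_disc_gt0. Qed.

(* [B] and the fractional coordinates [t] of one point per coset describe [S]. *)
Definition rep (I : finType) B (t : I -> R * R) S : Prop :=
  B \in unitmx /\
  set_bij [set: I * (int * int)] S
    (fun k => pt B (k.2.1%:~R + (t k.1).1) (k.2.2%:~R + (t k.1).2)).

(** The average theta value seen from a point, with the self-term: the energy plus 1. *)
Definition mean_pair (I : finType) a B (t : I -> R * R) : R :=
  (\sum_i \sum_j lsum a B ((t j).1 - (t i).1) ((t j).2 - (t i).2)) / #|I|%:R.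

Lemma rep_dist (I : finType) B (t : I -> R * R) S i j (m n : int) : rep B t S -> i != j ->
  pt B (m%:~R + ((t i).1 - (t j).1)) (n%:~R + ((t i).2 - (t j).2)) != 0.
Proof.
move=> [uB [_ inj _]] ij; apply/eqP; rewrite -(pt00 B) => /(pt_inj uB) [h1 h2].
have E : pt B (m%:~R + (t i).1) (n%:~R + (t i).2) = pt B (0%:~R + (t j).1) (0%:~R + (t j).2).
  by congr (pt B); lra.
have [e _ _] := inj (i, (m, n)) (j, (0, 0)) (mem_set Logic.I) (mem_set Logic.I) E.
by move: ij; rewrite e eqxx.
Qed.

Lemma energy_rep (G : periodic_conf R 2) (t : 'I_(ncosets G) -> R * R) a : 0 < a ->
  (forall j, Defs.shift j = pt (Defs.basis G) (t j).1 (t j).2) -> rep (Defs.basis G) t (points G) ->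
  energy (gaussian a) G = (mean_pair a (Defs.basis G) t - 1)%:E.
Proof.
move=> a0 sh rp; have uB := basis_unit G; set B := Defs.basis G in sh rp uB *.
have J0 : (ncosets G)%:R != 0 :> R by rewrite pnatr_eq0 -lt0n ncosets_gt0.
have bij : set_bij [set: int * int] (lattice_of B) (fun k : int * int => pt B k.1%:~R k.2%:~R).
  split=> [k _|[m n] [m' n'] _ _ /= /(pt_inj uB) [/intr_inj -> /intr_inj ->]//|v].
    by apply/lattice_ofE; exists k.1, k.2.
  by move/lattice_ofE => [m [n ->]]; exists (m, n).
have E j k : \esum_(l in [set l | lattice_of B l /\ l + Defs.shift j - Defs.shift k <> 0])
    (gaussian a (eucl_norm (l + Defs.shift j - Defs.shift k)))%:E =
    (lsum a B ((t j).1 - (t k).1) ((t j).2 - (t k).2) - (j == k)%:R)%:E.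
  have h : hasum (lattice_of B) (fun l => gaussian a (eucl_norm (l + Defs.shift j - Defs.shift k)))
      (lsum a B ((t j).1 - (t k).1) ((t j).2 - (t k).2)).
    apply/(hasum_bij _ _ bij); have := hasum_lsum ((t j).1 - (t k).1) ((t j).2 - (t k).2) a0 uB.
    apply: hasum_ext => z _ /=; congr (gaussian a (eucl_norm _)).
    by rewrite ptD ptB !sh addrA.
  (* On the diagonal the excluded vector 0 accounts for exactly 1; off the diagonal nothing is
     excluded, by [rep_dist]. *)
  have [jk|jk] := eqVneq j k.
    subst k.
    have L0 (v : 'cV[R]_2) : v \in [:: 0] -> lattice_of B v.
      by rewrite inE => /eqP ->; apply/lattice_ofE; exists 0, 0; rewrite pt00.
    have [[_ h1] _] := (hasum_split _ _ (r := [:: 0]) isT L0).1 h.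
    rewrite big_seq1 in h1.
    have g0 : gaussian a (eucl_norm (0 + Defs.shift j - Defs.shift j)) = 1.
      by rewrite add0r subrr -(pt00 B) gaussian_pt qform0 oppr0 expR0.
    rewrite g0 in h1; rewrite -h1; congr esum; apply/seteqP; split=> l /= [h2 h3]; split=> //.
      by rewrite inE => /eqP l0; apply: h3; rewrite l0 add0r subrr.
    by move=> h4; apply: h3; rewrite inE; move: h4; rewrite addrK => ->.
  rewrite subr0 -h.2; congr esum; apply/seteqP; split=> l /= => [[]|] // lL; split=> //.
  have /lattice_ofE [m [n ->]] := lL.
  by rewrite -addrA !sh -ptB -ptD; apply/eqP; exact: rep_dist rp jk.
rewrite /energy; under eq_bigr do under eq_bigr do rewrite E.
under eq_bigr do rewrite sumEFin.
rewrite sumEFin -EFinM; congr EFin.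
under eq_bigr do rewrite sumrB.
rewrite sumrB [X in _ * (_ - X)](_ : _ = (ncosets G)%:R); last first.
  rewrite -[in RHS](card_ord (ncosets G)) -sumr_const; apply: eq_bigr => i _.
  by rewrite (bigD1 i)//= eqxx big1 ?addr0// => j ji; rewrite eq_sym (negbTE ji).
by rewrite mulrBr mulVf// /mean_pair exchange_big card_ord mulrC.
Qed.

End Representations.

(** * Density and energy do not depend on the representation *)

Section Independence.
Variable R : realType.
Implicit Types (a e x y : R) (B : 'M[R]_2) (S : set 'cV[R]_2).

Lemma rep_conf (G : periodic_conf R 2) :
  exists t : 'I_(ncosets G) -> R * R,
    (forall j, Defs.shift j = pt (Defs.basis G) (t j).1 (t j).2) /\
    rep (Defs.basis G) t (points G).
Proof.
have uB := basis_unit G; set B := Defs.basis G in uB *.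
exists (fun j => ((invmx B *m Defs.shift j) 0 0, (invmx B *m Defs.shift j) 1 0)).
have sh j : Defs.shift j = pt B ((invmx B *m Defs.shift j) 0 0) ((invmx B *m Defs.shift j) 1 0).
  by rewrite -mulmx_pt mulKVmx.
split=> //; split=> //; split.
- move=> [j [m n]] _ /=; exists j => //; exists (pt B m%:~R n%:~R).
    by apply/lattice_ofE; exists m, n.
  by rewrite ptD -sh.
- move=> [j [m n]] [k [m' n']] _ _ /=; rewrite !ptD -!sh => E.
  have [jk|jk] := eqVneq j k; last first.
    case: (shift_distinct jk); apply/lattice_ofE; exists (m' - m), (n' - n).
    rewrite !rmorphB/= ptB; by apply/eqP; rewrite subr_eq addrAC -E addrAC subrr add0r.
  by subst k; move/addIr: E => /(pt_inj uB) [/intr_inj -> /intr_inj ->].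
- move=> _ [j _ [v /lattice_ofE [m [n ->]] <-]]; exists (j, (m, n)) => //=.
  by rewrite ptD -sh.
Qed.

Lemma hasum_rep (I : finType) B (t : I -> R * R) S (g : 'cV[R]_2 -> R) (s : I -> R) :
  rep B t S ->
  (forall i, hasum [set: int * int]
     (fun z => g (pt B (z.1%:~R + (t i).1) (z.2%:~R + (t i).2))) (s i)) ->
  hasum S g (\sum_i s i).
Proof.
move=> [uB bij] h; apply/(hasum_bij _ _ bij); rewrite setT_sigX.
have h0 i : 0 <= s i := hasum_ge0 (h i).
exact: ((@hasum_pair R _ _ setT (fun=> setT)
  (fun i z => g (pt B (z.1%:~R + (t i).1) (z.2%:~R + (t i).2))) _ _
  (fun i _ => h i)).1 (hasum_fin h0)).
Qed.

Lemma lsum_near B : B \in unitmx ->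
  exists2 K, 0 <= K & forall e x y, 0 < e -> e * K <= 1 ->
    pi / `|\det B| * (1 - e * K) <= e * lsum e B x y <= pi / `|\det B| * (1 + e * K).
Proof.
move=> uB; have [K K0 h] := qsum_near (gramC_gt0 ltr01 uB) (gram_disc_gt0 ltr01 uB).
exists K => // e x y e0 eK; have := h e x y e0 eK.
rewrite gram_disc mul1r sqrtr_sqr /lsum.
have -> : e * gramA 1 B = gramA e B by rewrite /gramA mul1r.
have -> : e * gramB 1 B = gramB e B by rewrite /gramB mul1r.
by have -> : e * gramC 1 B = gramC e B by rewrite /gramC mul1r.
Qed.

Definition coset_constant (I : finType) B (t : I -> R * R) (F : 'cV[R]_2 -> R) (c : I -> R) :=
  forall i (z : int * int), F (pt B (z.1%:~R + (t i).1) (z.2%:~R + (t i).2)) = c i.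

Lemma hasum_weighted (I : finType) B (t : I -> R * R) S F (c : I -> R) e : 0 < e ->
  rep B t S -> coset_constant B t F c -> (forall i, 0 <= c i) ->
  hasum S (fun p => F p * gaussian e (eucl_norm p))
    (\sum_i c i * lsum e B (t i).1 (t i).2).
Proof.
move=> e0 rp cc c0; apply: (hasum_rep rp) => i.
have := hasumZ (c0 i) (hasum_lsum (t i).1 (t i).2 e0 rp.1).
by apply: hasum_ext => z _; rewrite cc.
Qed.

(** [F] is summed over [S] against the Gaussian of parameter [e]. Through either representation, [e]
    times this sum is pi times the mean of [F] per unit area up to a relative error of order [e],
    and [e] tends to 0. *)
Lemma coset_mean_le (I I' : finType) B B' (t : I -> R * R) (t' : I' -> R * R) S F c c' :
  rep B t S -> rep B' t' S -> coset_constant B t F c -> coset_constant B' t' F c' ->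
  (forall i, 0 <= c i) -> (forall i, 0 <= c' i) ->
  (\sum_i c i) / `|\det B| <= (\sum_i c' i) / `|\det B'|.
Proof.
move=> rp rp' cc cc' c0 c0'; have pi0 := @pi_gt0 R.
have [K K0 hK] := lsum_near rp.1; have [K' K0' hK'] := lsum_near rp'.1.
set q := pi / `|\det B| in hK; set q' := pi / `|\det B'| in hK'.
pose m := \sum_i c i; pose m' := \sum_i c' i.
suff : q * m <= q' * m'.
  by rewrite /q /q' -!mulrA ler_pM2l// ![_^-1 * _]mulrC.
have m0 : 0 <= m by apply: sumr_ge0.
have m0' : 0 <= m' by apply: sumr_ge0.
have q0 : 0 <= q by rewrite divr_ge0// ltW.
have q0' : 0 <= q' by rewrite divr_ge0// ltW.
pose L := q * m * K + q' * m' * K'.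
have L0 : 0 <= L := addr_ge0 (mulr_ge0 (mulr_ge0 q0 m0) K0) (mulr_ge0 (mulr_ge0 q0' m0') K0').
apply/ler_addgt0Pr => d d0.
have w0 : 0 < 1 + K + K' + L / d.
  have := divr_ge0 L0 (ltW d0); lra.
(* Small enough for both estimates to apply and for the total error [e * L] to stay below [d]. *)
pose e := (1 + K + K' + L / d)^-1.
have e0 : 0 < e by rewrite invr_gt0.
have Ld := divr_ge0 L0 (ltW d0).
have eK : e * K <= 1 by rewrite mulrC ler_pdivrMr// mul1r; lra.
have eK' : e * K' <= 1 by rewrite mulrC ler_pdivrMr// mul1r; lra.
have eL : e * L <= d.
  rewrite mulrC ler_pdivrMr// -[leLHS](divfK (lt0r_neq0 d0)) mulrC ler_pM2l//; lra.
have E := hasum_uniq (hasum_weighted e0 rp cc c0) (hasum_weighted e0 rp' cc' c0').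
have lo : q * (1 - e * K) * m <= e * \sum_i c i * lsum e B (t i).1 (t i).2.
  rewrite !mulr_sumr; apply: ler_sum => i _.
  rewrite mulrCA [leLHS]mulrC ler_wpM2l//.
  by have /andP[] := hK e (t i).1 (t i).2 e0 eK.
have up : e * \sum_i c' i * lsum e B' (t' i).1 (t' i).2 <= q' * (1 + e * K') * m'.
  rewrite !mulr_sumr; apply: ler_sum => i _.
  rewrite mulrCA [leRHS]mulrC ler_wpM2l//.
  by have /andP[] := hK' e (t' i).1 (t' i).2 e0 eK'.
rewrite E in lo; have := le_trans lo up.
have -> : q * (1 - e * K) * m = q * m - e * (q * m * K) by ring.
have -> : q' * (1 + e * K') * m' = q' * m' + e * (q' * m' * K') by ring.
by move: eL; rewrite /L mulrDr; lra.
Qed.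

Lemma coset_mean_eq (I I' : finType) B B' (t : I -> R * R) (t' : I' -> R * R) S F c c' :
  rep B t S -> rep B' t' S -> coset_constant B t F c -> coset_constant B' t' F c' ->
  (forall i, 0 <= c i) -> (forall i, 0 <= c' i) ->
  (\sum_i c i) / `|\det B| = (\sum_i c' i) / `|\det B'|.
Proof.
move=> rp rp' cc cc' c0 c0'; apply/eqP; rewrite eq_le.
by rewrite (coset_mean_le rp rp' cc cc' c0 c0') (coset_mean_le rp' rp cc' cc c0' c0).
Qed.

(** Depends on the set alone, yet is constant on the cosets of each representation. *)
Definition theta a S (p : 'cV[R]_2) : R :=
  fine (\esum_(v in S) (gaussian a (eucl_norm (v - p)))%:E).

Lemma thetaE (I : finType) a B (t : I -> R * R) S x y : 0 < a -> rep B t S ->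
  theta a S (pt B x y) = \sum_i lsum a B ((t i).1 - x) ((t i).2 - y).
Proof.
move=> a0 rp; rewrite /theta.
have h := @hasum_rep I B t S (fun v => gaussian a (eucl_norm (v - pt B x y)))
  (fun i => lsum a B ((t i).1 - x) ((t i).2 - y)) rp.
rewrite (h _).2// => i.
have := hasum_lsum ((t i).1 - x) ((t i).2 - y) a0 rp.1; apply: hasum_ext => z _.
by rewrite !addrA ptB.
Qed.

Lemma theta_coset (I : finType) a B (t : I -> R * R) S : 0 < a -> rep B t S ->
  coset_constant B t (theta a S)
    (fun i => \sum_j lsum a B ((t j).1 - (t i).1) ((t j).2 - (t i).2)).
Proof.
move=> a0 rp i [m n] /=; rewrite (thetaE _ _ a0 rp); apply: eq_bigr => j _.
have -> : (t j).1 - (m%:~R + (t i).1) = (t j).1 - (t i).1 + (- m)%:~R by rewrite rmorphN/=; ring.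
have -> : (t j).2 - (n%:~R + (t i).2) = (t j).2 - (t i).2 + (- n)%:~R by rewrite rmorphN/=; ring.
exact: lsumDz a0 rp.1.
Qed.

Lemma lsum_ge0 a B x y : 0 < a -> B \in unitmx -> 0 <= lsum a B x y.
Proof. by move=> a0 uB; exact: hasum_ge0 (hasum_lsum x y a0 uB). Qed.

Lemma rep_card_density (G : periodic_conf R 2) (I : finType) B (t : I -> R * R) :
  rep B t (points G) -> density G = #|I|%:R / `|\det B|.
Proof.
move=> rp; have [s [_ rs]] := rep_conf G.
have := @coset_mean_eq _ _ _ _ _ _ _ (fun=> 1) (fun=> 1) (fun=> 1) rs rp.
by rewrite !sumr_const card_ord /density => ->.
Qed.

(** The mean of [theta] per unit area is intrinsic, and so is the density; their quotient is
    [mean_pair]. *)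
Lemma rep_energy (G : periodic_conf R 2) (I : finType) B (t : I -> R * R) a : 0 < a ->
  rep B t (points G) -> energy (gaussian a) G = (mean_pair a B t - 1)%:E.
Proof.
move=> a0 rp; have [s [sh rs]] := rep_conf G.
rewrite (energy_rep a0 sh rs); congr (_ - 1)%:E; rewrite /mean_pair.
have E := coset_mean_eq rs rp (theta_coset a0 rs) (theta_coset a0 rp)
  (fun i => sumr_ge0 _ (fun j _ => lsum_ge0 _ _ a0 rs.1))
  (fun i => sumr_ge0 _ (fun j _ => lsum_ge0 _ _ a0 rp.1)).
have D := rep_card_density rs; have D' := rep_card_density rp; rewrite D in D'.
have d0 : `|\det (Defs.basis G)| != 0 by rewrite normr_eq0 -unitmx_det rs.1.
have d0' : `|\det B| != 0 by rewrite normr_eq0 -unitmx_det rp.1.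
have J0 : #|'I_(ncosets G)|%:R != 0 :> R by rewrite card_ord pnatr_eq0 -lt0n ncosets_gt0.
have I0 : #|I|%:R != 0 :> R.
  apply/eqP => E0; move: D'; rewrite E0 mul0r => /eqP.
  by rewrite mulf_eq0 invr_eq0 (negbTE J0) (negbTE d0).
set m := \sum_i _ in E *; set m' := \sum_i _ in E *.
have -> : m / #|'I_(ncosets G)|%:R = m / `|\det (Defs.basis G)| / (#|'I_(ncosets G)|%:R / `|\det (Defs.basis G)|).
  by field; rewrite J0 d0.
by rewrite E D'; field; rewrite I0 d0'.
Qed.

End Independence.

(** * Change of basis and Gram matrices *)

Section LatticeCase.
Variable R : realType.
Implicit Types (a x y : R) (B H : 'M[R]_2) (S : set 'cV[R]_2).

Lemma block2E (A B C D : 'M[R]_1) (M := (block_mx A B C D : 'M[R]_(1 + 1)) : 'M[R]_2) :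
  [/\ M 0 0 = A 0 0, M 0 1 = B 0 0, M 1 0 = C 0 0 & M 1 1 = D 0 0].
Proof.
rewrite /M; split.
- by rewrite -(block_mxEul A B C D); congr (fun_of_matrix _ _ _); exact/val_inj.
- by rewrite -(block_mxEur A B C D); congr (fun_of_matrix _ _ _); exact/val_inj.
- by rewrite -(block_mxEdl A B C D); congr (fun_of_matrix _ _ _); exact/val_inj.
- by rewrite -(block_mxEdr A B C D); congr (fun_of_matrix _ _ _); exact/val_inj.
Qed.

Lemma ord2P (i : 'I_2) : i = 0 \/ i = 1.
Proof. by case: i => [[|[|//]] i]; [left|right]; exact/val_inj. Qed.

Lemma matrix2P B H : B 0 0 = H 0 0 -> B 0 1 = H 0 1 -> B 1 0 = H 1 0 ->
  B 1 1 = H 1 1 -> B = H.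
Proof.
by move=> h1 h2 h3 h4; apply/matrixP => i j; case: (ord2P i) => ->; case: (ord2P j) => ->.
Qed.

Lemma rep_lattice B : B \in unitmx -> rep B ((fun=> (0, 0)) : 'I_1 -> R * R) (lattice_of B).
Proof.
move=> uB; split=> //; split=> [[i [m n]] _|[i [m n]] [j [m' n']] _ _|v] /=.
- by rewrite !addr0; apply/lattice_ofE; exists m, n.
- by rewrite !addr0 !ord1 => /(pt_inj uB) [/intr_inj -> /intr_inj ->].
- by move=> /lattice_ofE [m [n ->]]; exists (0, (m, n)); rewrite //= !addr0.
Qed.

Lemma mean_pair_lattice a B : mean_pair a B ((fun=> (0, 0)) : 'I_1 -> R * R) = lsum a B 0 0.
Proof. by rewrite /mean_pair !big_ord1 subrr card_ord divr1. Qed.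

Definition change_basis B (u v a b : R) : 'M[R]_2 :=
  \matrix_(i, j) (if j == 0 then pt B u v i 0 else pt B a b i 0).

Lemma pt_change_basis B u v a b x y :
  pt (change_basis B u v a b) x y = pt B (u * x + a * y) (v * x + b * y).
Proof. by apply/matrixP => i j; rewrite !mxE /=; ring. Qed.

Lemma det_change_basis B u v a b :
  \det (change_basis B u v a b) = \det B * (u * b - v * a).
Proof. by rewrite !det2 !mxE /=; ring. Qed.

Lemma gram_change_basis e B u v a b (B' := change_basis B u v a b) :
  [/\ gramA e B' = qform (gramA e B) (gramB e B) (gramC e B) u v,
      gramB e B' = gramA e B * u * a + gramB e B * (u * b + v * a) + gramC e B * v * b &
      gramC e B' = qform (gramA e B) (gramB e B) (gramC e B) a b].
Proof. by rewrite /gramA /gramB /gramC /qform !mxE /=; split; ring. Qed.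

Lemma lattice_change_basis B (u v a b : int) : (u * b - v * a) ^+ 2 = 1 ->
  lattice_of (change_basis B u%:~R v%:~R a%:~R b%:~R) = lattice_of B.
Proof.
move=> uv; apply/seteqP; split=> w /lattice_ofE [m [n ->]]; apply/lattice_ofE.
  rewrite pt_change_basis; exists (u * m + a * n), (v * m + b * n).
  by rewrite !intrD !intrM.
have [_ _ /(_ (m, n) I) [[x y] _ /= [<- <-]]] := unimodular_bij uv.
by exists x, y; rewrite pt_change_basis !intrD !intrM.
Qed.

Lemma reduced_basis e B : 0 < e -> B \in unitmx ->
  exists B', [/\ B' \in unitmx, lattice_of B' = lattice_of B,
    0 <= 2 * gramB e B' <= gramA e B' & gramA e B' <= gramC e B'].
Proof.
move=> e0 uB.
have [u [v [a [b [uv /= [h1 h2]]]]]] :=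
  gauss_reduction (gramA_gt0 e0 uB) (gramC_gt0 e0 uB) (gram_disc_gt0 e0 uB).
exists (change_basis B u%:~R v%:~R a%:~R b%:~R).
have [-> -> ->] := gram_change_basis e B u%:~R v%:~R a%:~R b%:~R; split=> //.
  move: uB; rewrite !unitmx_det det_change_basis => d0; rewrite mulf_neq0//.
  rewrite -!intrM -rmorphB/= intr_eq0; apply/eqP => E.
  by move: uv; rewrite E expr0n.
exact: lattice_change_basis.
Qed.

Lemma orthogonal_of_gram e B H : e != 0 -> H \in unitmx ->
  gramA e B = gramA e H -> gramB e B = gramB e H -> gramC e B = gramC e H ->
  orthogonal_mx (B *m invmx H).
Proof.
move=> e0 uH /(mulfI e0) hA /(mulfI e0) hB /(mulfI e0) hC.
have E : B^T *m B = H^T *m H.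
  apply: matrix2P; rewrite !mxE !sum2 !mxE; rewrite ?expr2 in hA hB hC.
  - exact: hA.
  - exact: hB.
  - by rewrite mulrC [X in _ + X]mulrC hB mulrC [X in _ + X]mulrC.
  - exact: hC.
rewrite /orthogonal_mx trmx_mul -mulmxA [B^T *m _]mulmxA E -mulmxA mulmxV// mulmx1.
by rewrite -trmx_mul mulmxV// trmx1.
Qed.

End LatticeCase.

(** * The hexagonal competitor and the lattice case *)

Section Cases.
Variable R : realType.
Implicit Types (x y : R) (B H : 'M[R]_2) (S : set 'cV[R]_2).

Lemma sqrt3_sqr : Num.sqrt 3 ^+ 2 = 3 :> R.
Proof. by rewrite sqr_sqrtr. Qed.

Lemma sqrt3_gt0 : 0 < Num.sqrt 3 :> R.
Proof. by rewrite sqrtr_gt0. Qed.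

Lemma hexagonal_basisE (s := Num.sqrt (2 / Num.sqrt 3)) (M := hexagonal_basis R) :
  [/\ M 0 0 = s, M 0 1 = s / 2, M 1 0 = 0 & M 1 1 = s * (Num.sqrt 3 / 2)].
Proof.
have [h1 h2 h3 h4] := block2E 1%:M (2^-1)%:M 0 ((Num.sqrt 3 / 2)%:M : 'M[R]_1).
have E i j : M i j = s * (block_mx 1%:M (2^-1)%:M 0 ((Num.sqrt 3 / 2)%:M : 'M[R]_1) : 'M[R]_(1 + 1)) i j.
  by rewrite /M /hexagonal_basis [LHS]mxE.
by split; rewrite E ?h1 ?h2 ?h3 ?h4 ?mxE ?mulr1n ?mulr1 ?mulr0.
Qed.

Lemma hexagonal_gram e c (B := c *: hexagonal_basis R) (Y := e * c ^+ 2 * (2 / Num.sqrt 3)) :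
  [/\ gramA e B = Y, gramB e B = Y / 2, gramC e B = Y & \det B = c ^+ 2].
Proof.
have [h1 h2 h3 h4] := hexagonal_basisE.
have q := sqrt3_sqr; have q0 := sqrt3_gt0.
have s2 : Num.sqrt (2 / Num.sqrt 3) ^+ 2 = 2 / Num.sqrt 3 :> R.
  by rewrite sqr_sqrtr// divr_ge0// ltW.
have E i j : B i j = c * hexagonal_basis R i j by rewrite /B [LHS]mxE.
rewrite /gramA /gramB /gramC det2 !E h1 h2 h3 h4.
set s := Num.sqrt (2 / _) in s2 *; set w := Num.sqrt 3 in q q0 s2 *.
have w0 : w != 0 by rewrite gt_eqF.
split.
- by rewrite /Y -s2; ring.
- by rewrite /Y -s2; field.
- transitivity (e * c ^+ 2 * s ^+ 2 * (1 / 4 + w ^+ 2 / 4)); first by field.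
  by rewrite q s2 /Y -/w; field.
- transitivity (c ^+ 2 * s ^+ 2 * w / 2); first by field.
  by rewrite s2; field.
Qed.

(** The [X] for which [alpha] times the squared length on the hexagonal lattice of density [rho] is
    X (m^2 + m n + n^2). *)
Definition hex_param (alpha rho : R) := alpha / rho * (2 / Num.sqrt 3).

Variables (alpha rho : R).
Hypotheses (alpha_gt0 : 0 < alpha) (rho_gt0 : 0 < rho).

Let X := hex_param alpha rho.
Let H := (Num.sqrt rho)^-1 *: hexagonal_basis R.

Definition hex_minimal (G : periodic_conf R 2) : Prop :=
  (energy (gaussian alpha) (hexagonal_conf rho_gt0) <= energy (gaussian alpha) G)%E /\
  (energy (gaussian alpha) (hexagonal_conf rho_gt0) = energy (gaussian alpha) G ->
   exists2 Q : 'M[R]_2, orthogonal_mx Q &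
     points G = [set Q *m v | v in dilate (Num.sqrt rho)^-1 (hexagonal_lattice R)]).

Lemma hex_param_gt0 : 0 < X.
Proof. by rewrite /X /hex_param mulr_gt0 ?divr_gt0 ?sqrt3_gt0. Qed.

Lemma hex_param_sqr : 3 / 4 * X ^+ 2 = (alpha / rho) ^+ 2.
Proof.
have q := sqrt3_sqr; have q0 := sqrt3_gt0.
rewrite /X /hex_param; set w := Num.sqrt 3 in q q0 *.
transitivity (3 * (alpha / rho) ^+ 2 / w ^+ 2); first by field; rewrite !gt_eqF.
by rewrite q; field; rewrite gt_eqF.
Qed.

Lemma hex_conf_gram : [/\ gramA alpha H = X, gramB alpha H = X / 2, gramC alpha H = X &
  \det H = rho^-1].
Proof.
have [h1 h2 h3 h4] := hexagonal_gram alpha (Num.sqrt rho)^-1.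
have r2 : (Num.sqrt rho)^-1 ^+ 2 = rho^-1 by rewrite exprVn sqr_sqrtr// ltW.
by rewrite h1 h2 h3 h4 r2.
Qed.

Lemma hex_conf_unit : H \in unitmx.
Proof. exact: hexagonal_basis_unit. Qed.

Lemma hex_conf_energy :
  energy (gaussian alpha) (hexagonal_conf rho_gt0) = (qsum X (X / 2) X 0 0 - 1)%:E.
Proof.
have rp : rep H ((fun=> (0, 0)) : 'I_1 -> R * R) (points (hexagonal_conf rho_gt0)).
  by rewrite points_lattice_conf; apply: rep_lattice; exact: hex_conf_unit.
rewrite (rep_energy alpha_gt0 rp) mean_pair_lattice /lsum.
by have [-> -> -> _] := hex_conf_gram.
Qed.

Lemma hex_conf_scaled : scaled_Xi rho (hexagonal_conf rho_gt0).
Proof.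
split.
  rewrite /density /=; have [_ _ _ ->] := hex_conf_gram.
  by rewrite mul1r normfV invrK ger0_norm// ltW.
exists (Num.sqrt rho)^-1, (hexagonal_lattice R); split.
- by rewrite invr_gt0 sqrtr_gt0.
- left; left; exists (hexagonal_basis R) => //.
  by have := hexagonal_basis_unit (@ltr01 R); rewrite sqrtr1 invr1 scale1r.
- exact: points_hexagonal_conf.
Qed.

Lemma strict_case (G : periodic_conf R 2) (I : finType) B (t : I -> R * R) :
  rep B t (points G) -> qsum X (X / 2) X 0 0 < mean_pair alpha B t -> hex_minimal G.
Proof.
move=> rp lt; rewrite /hex_minimal hex_conf_energy (rep_energy alpha_gt0 rp); split.
  by rewrite lee_fin lerD2r ltW.
by move=> [/addIr E]; rewrite E ltxx in lt.
Qed.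

(** The density fixes the discriminant: with |I| points per cell, the lattice of periods is compared
    with parameter |I| X. *)
Lemma covolume (G : periodic_conf R 2) (I : finType) B (t : I -> R * R) :
  rep B t (points G) -> density G = rho ->
  (alpha * \det B) ^+ 2 = 3 / 4 * (#|I|%:R * X) ^+ 2.
Proof.
move=> rp; rewrite (rep_card_density rp) => E.
have d0 : `|\det B| != 0 by rewrite normr_eq0 -unitmx_det rp.1.
have -> : 3 / 4 * (#|I|%:R * X) ^+ 2 = #|I|%:R ^+ 2 * (3 / 4 * X ^+ 2) by ring.
rewrite hex_param_sqr -E exprMn -[X in _ * X = _]real_normK ?num_real//.
have I0 : #|I|%:R != 0 :> R.
  by apply/eqP => I0; move: E; rewrite I0 mul0r => E; move: rho_gt0; rewrite -E ltxx.
by field; rewrite d0 I0.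
Qed.

(** Equality in [montgomery] fixes the Gram matrix of a reduced basis, and this determines the basis
    up to an orthogonal factor. *)
Lemma lattice_case (G : periodic_conf R 2) B : B \in unitmx ->
  points G = lattice_of B -> density G = rho -> hex_minimal G.
Proof.
move=> uB pG dG; have [B' [uB' LB' h1 h2]] := reduced_basis alpha_gt0 uB.
have rp : rep B' ((fun=> (0, 0)) : 'I_1 -> R * R) (points G).
  by rewrite pG -LB'; exact: rep_lattice.
have D := covolume rp dG; rewrite card_ord mul1r in D.
have := montgomery hex_param_gt0 h1 h2; rewrite gram_disc => /(_ D) [[eA eB eC]|lt].
  have [hA hB hC _] := hex_conf_gram.
  split.
    rewrite hex_conf_energy (rep_energy alpha_gt0 rp) mean_pair_lattice /lsum.
    by rewrite eA eB eC.
  move=> _; exists (B' *m invmx H).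
    apply: (@orthogonal_of_gram R alpha); rewrite ?hA ?hB ?hC ?gt_eqF//.
    exact: hex_conf_unit.
  have E v : B' *m v = (B' *m invmx H) *m (H *m v).
    by rewrite mulmxA mulmxKV// hex_conf_unit.
  rewrite pG -LB' -lattice_ofZ -/H; apply/seteqP; split.
    by move=> _ [z _ <-]; exists (H *m map_mx intr z); [exists z|rewrite -E].
  by move=> _ [_ [z _ <-] <-]; exists z => //; rewrite -E.
by apply: strict_case rp _; rewrite mean_pair_lattice.
Qed.

End Cases.

(** * The doubled lattices *)

Section Doubled.
Variable R : realType.
Variables (alpha rho : R).
Hypotheses (alpha_gt0 : 0 < alpha) (rho_gt0 : 0 < rho).
Implicit Types (x y : R) (B : 'M[R]_2) (S : set 'cV[R]_2).

Lemma rep_doubled B x y : B \in unitmx -> ~ lattice_of B (pt B x y) ->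
  rep B (fun i : bool => if i then (x, y) else (0, 0))
    (lattice_of B `|` translate (pt B x y) (lattice_of B)).
Proof.
move=> uB nx; split=> //; split.
- move=> [[] [m n]] _ /=.
    by right; exists (pt B m%:~R n%:~R); [apply/lattice_ofE; exists m, n|rewrite ptD].
  by left; apply/lattice_ofE; exists m, n; rewrite !addr0.
- have ne (m n m' n' : int) : pt B (m%:~R + x) (n%:~R + y) <> pt B (m'%:~R + 0) (n'%:~R + 0).
    move=> /(pt_inj uB) [h1 h2]; apply: nx; apply/lattice_ofE; exists (m' - m), (n' - n).
    by rewrite !rmorphB/=; congr (pt B); lra.
  move=> [[] [m n]] [[] [m' n']] _ _ /= E.
  + by have [/addIr/intr_inj -> /addIr/intr_inj ->] := pt_inj uB E.
  + by case: (ne _ _ _ _ E).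
  + by case: (ne _ _ _ _ (esym E)).
  + by have [/addIr/intr_inj -> /addIr/intr_inj ->] := pt_inj uB E.
- move=> v [/lattice_ofE [m [n ->]]|[w /lattice_ofE [m [n ->]] <-]].
    by exists (false, (m, n)); rewrite //= !addr0.
  by exists (true, (m, n)); rewrite //= ptD.
Qed.

Lemma mean_pair_doubled B x y : B \in unitmx ->
  mean_pair alpha B (fun i : bool => if i then (x, y) else (0, 0)) =
  lsum alpha B 0 0 + lsum alpha B x y.
Proof.
move=> uB; rewrite /mean_pair card_bool !big_bool /= !subrr !sub0r !subr0.
by rewrite lsumN//; field.
Qed.

Lemma int_half (z : int) : exists k : int, z = 2 * k \/ z = 2 * k + 1.
Proof.
exists (z %/ 2)%Z; have h := divz_eq z 2.
have h0 : 0 <= (z %% 2)%Z by exact: modz_ge0.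
have h1 : (z %% 2)%Z < 2 by exact: ltz_pmod.
lia.
Qed.

(** The new basis is half a diagonal and one side; parity of the first coordinate tells the two
    cosets apart. *)
Lemma centred_lattice B (m n : int) :
  lattice_of B `|` translate (pt B (1 / 2 + m%:~R) (1 / 2 + n%:~R)) (lattice_of B) =
  lattice_of (change_basis B (1 / 2) (1 / 2) 1 0).
Proof.
apply/seteqP; split.
  move=> v [/lattice_ofE [i [j ->]]|[w /lattice_ofE [i [j ->]] <-]]; apply/lattice_ofE.
    exists (2 * j), (i - j); rewrite pt_change_basis; congr (pt B).
      by rewrite rmorphB/= intrM; field.
    by rewrite intrM; field.
  exists (2 * (j + n) + 1), (i + m - j - n); rewrite pt_change_basis -ptD; congr (pt B).
    by rewrite !rmorphB/= !intrD intrM intrD; field.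
  by rewrite !intrD intrM intrD; field.
move=> v /lattice_ofE [i [j ->]]; rewrite pt_change_basis.
have [k [->|->]] := int_half i; [left|right].
  apply/lattice_ofE; exists (k + j), k; congr (pt B).
    by rewrite intrD intrM; field.
  by rewrite intrM; field.
exists (pt B (k + j - m)%:~R (k - n)%:~R).
  by apply/lattice_ofE; exists (k + j - m), (k - n).
rewrite -ptD; congr (pt B).
  by rewrite rmorphB/= !intrD intrM; field.
by rewrite rmorphB/= !intrD intrM; field.
Qed.

Lemma dilate_translate (c : R) (x : 'cV[R]_2) S :
  dilate c (translate x S) = translate (c *: x) (dilate c S).
Proof.
apply/seteqP; split=> v.
  by move=> [_ [w Sw <-] <-]; exists (c *: w); [exists w|rewrite scalerDr].
by move=> [_ [w Sw <-] <-]; exists (w + x); [exists w|rewrite scalerDr].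
Qed.

Lemma translate_lattice B x y : lattice_of B (pt B x y) ->
  lattice_of B `|` translate (pt B x y) (lattice_of B) = lattice_of B.
Proof.
move=> /lattice_ofE [m [n ->]]; apply/seteqP; split=> v; last by left.
move=> [//|[w /lattice_ofE [i [j ->]] <-]]; apply/lattice_ofE.
by exists (i + m), (j + n); rewrite !intrD ptD.
Qed.

Lemma doubled_case (G : periodic_conf R 2) (c : R) (A : set 'cV[R]_2) : 0 < c ->
  doubled2 R A -> points G = dilate c A -> density G = rho -> hex_minimal alpha rho_gt0 G.
Proof.
move=> c0 [L [x0 [shape AE]]] pG dG.
have [B0 [uB0 L0 sh]] : exists B0 : 'M[R]_2, [/\ B0 \in unitmx, L = lattice_of B0 &
    (exists2 a : R, 0 < a & B0 = (block_mx a%:M 0 0 (a^-1)%:M : 'M[R]_(1 + 1))) \/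
    B0 = hexagonal_basis R].
  case: shape => [[a a0 ->]|->].
    exists (block_mx a%:M 0 0 (a^-1)%:M : 'M[R]_(1 + 1)); split=> //; last by left; exists a.
    have [h1 h2 h3 h4] := block2E a%:M 0 0 ((a^-1)%:M : 'M[R]_1).
    by rewrite unitmx_det det2 h1 h2 h3 h4 !mxE /= !mulr1n mulr0 subr0 divff ?gt_eqF ?oner_eq0.
  exists (hexagonal_basis R); split=> //; last by right.
  by have := hexagonal_basis_unit (@ltr01 R); rewrite sqrtr1 invr1 scale1r.
pose B := c *: B0.
have uB : B \in unitmx.
  by move: uB0; rewrite !unitmx_det detZ => d0; rewrite mulf_neq0// expf_neq0// gt_eqF.
have [x [y xy]] := pt_surj (c *: x0) uB.
have {}pG : points G = lattice_of B `|` translate (pt B x y) (lattice_of B).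
  rewrite pG AE -xy /B lattice_ofZ -L0 -dilate_translate.
  by apply/seteqP; split=> v; [move=> [w [Lw|Lw] <-]; [left|right]; exists w|move=> [|] [w Lw <-]; exists w => //; [left|right]].
(* A shift inside the lattice adds no coset; the configuration is then a lattice. *)
have [inL|ninL] := pselect (lattice_of B (pt B x y)).
  by apply: (lattice_case alpha_gt0 rho_gt0 uB) => //; rewrite pG translate_lattice.
have rp := rep_doubled uB ninL; rewrite -pG in rp.
have D := covolume alpha rho_gt0 rp dG; rewrite card_bool -gram_disc in D.
have X0 := hex_param_gt0 alpha_gt0 rho_gt0.
have gA := gramA_gt0 alpha_gt0 uB; have gC := gramC_gt0 alpha_gt0 uB.
have strict := strict_case alpha_gt0 rho_gt0 rp; rewrite mean_pair_doubled// in strict.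
case: sh => [[a a0 BE]|BE].
  have [h1 h2 h3 h4] := block2E a%:M 0 0 ((a^-1)%:M : 'M[R]_1).
  have gB : gramB alpha B = 0.
    have E i j : B i j = c * B0 i j by rewrite /B [LHS]mxE.
    by rewrite /gramB !E BE h1 h2 h3 h4 !mxE; ring.
  rewrite /lsum gB in strict; rewrite gB in D.
  have D3 : gramA alpha B * gramC alpha B = 3 * hex_param alpha rho ^+ 2.
    by move: D; rewrite expr0n subr0 => ->; field.
  have [[m [n [xE yE]]]|lt] := rect_double x y X0 gA gC D3; last exact: strict.
  rewrite xE yE centred_lattice in pG.
  apply: (lattice_case alpha_gt0 rho_gt0 _ pG dG).
  move: uB; rewrite !unitmx_det det_change_basis => d0; rewrite mulf_neq0//.
have [eA eB eC _] := hexagonal_gram alpha c; rewrite -BE -/B in eA eB eC.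
set Y := alpha * c ^+ 2 * _ in eA eB eC.
(* Two points per cell double the covolume, hence the hexagonal parameter. *)
have YX : Y = 2 * hex_param alpha rho.
  have Y0 : 0 <= Y by rewrite -eA ltW.
  have E : Y ^+ 2 = (2 * hex_param alpha rho) ^+ 2.
    by move: D; rewrite eA eB eC => D; lra.
  by apply/eqP; rewrite -(eqrXn2 (_ : 0 < 2)%N)// ?E// mulr_ge0// ltW.
apply: strict; rewrite /lsum eA eB eC YX.
have -> : 2 * hex_param alpha rho / 2 = hex_param alpha rho by field.
exact: hex_double.
Qed.

End Doubled.

(** * The product configurations *)

Section Products.
Variable R : realType.
Variables (alpha rho : R).
Hypotheses (alpha_gt0 : 0 < alpha) (rho_gt0 : 0 < rho).

Lemma line_conf_rep (G : periodic_conf R 1) :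
  exists (b : R) (t : 'I_(ncosets G) -> R), b != 0 /\
    set_bij [set: 'I_(ncosets G) * int] (points G)
      (fun k => const_mx (b * (k.2%:~R + t k.1)) : 'cV[R]_1).
Proof.
pose b := Defs.basis G 0 0.
have b0 : b != 0 by have := basis_unit G; rewrite unitmxE unitfE det_mx11.
have latE v : lattice_of (Defs.basis G) v <-> exists m : int, v = const_mx (b * m%:~R).
  split=> [[z _ <-]|[m ->]].
    by exists (z 0 0); apply/matrixP => i j; rewrite !ord1 !mxE big_ord1 !mxE.
  exists (const_mx m) => //.
  by apply/matrixP => i j; rewrite !ord1 !mxE big_ord1 !mxE.
have vE (v : 'cV[R]_1) : v = const_mx (v 0 0).
  by apply/matrixP => i j; rewrite !ord1 !mxE.
pose t (j : 'I_(ncosets G)) := Defs.shift j 0 0 / b.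
have tE (j : 'I_(ncosets G)) (m : int) :
    const_mx (b * (m%:~R + t j)) = const_mx (b * m%:~R) + Defs.shift j :> 'cV[R]_1.
  by apply/matrixP => i k; rewrite !ord1 !mxE mulrDr /t; congr (_ + _); rewrite mulrC divfK.
exists b, t; split=> //; split.
- move=> [j m] _ /=; exists j => //; exists (const_mx (b * m%:~R)); last by rewrite tE.
  by apply/latE; exists m.
- move=> [j m] [k n] _ _ /=; rewrite !tE => E.
  have [jk|jk] := eqVneq j k; last first.
    case: (shift_distinct jk); apply/latE; exists (n - m).
    have -> : const_mx (b * (n - m)%:~R) = const_mx (b * n%:~R) - const_mx (b * m%:~R) :> 'cV[R]_1.
      by apply/matrixP => i l; rewrite !mxE rmorphB/=; ring.
    by apply/eqP; rewrite subr_eq addrAC -E addrAC subrr add0r.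
  subst k; move/addIr: E => /matrixP /(_ 0 0); rewrite !mxE.
  by move/(mulfI b0)/intr_inj => ->.
- move=> _ [j _ [v /latE [m ->] <-]]; exists (j, m) => //=; exact: tE.
Qed.

Lemma col2E (u v : 'cV[R]_1) (w := (col_mx u v : 'cV[R]_(1 + 1)) : 'cV[R]_2) :
  w 0 0 = u 0 0 /\ w 1 0 = v 0 0.
Proof.
rewrite /w; split.
  by rewrite -(col_mxEu u v); congr (fun_of_matrix _ _ _); exact/val_inj.
by rewrite -(col_mxEd u v); congr (fun_of_matrix _ _ _); exact/val_inj.
Qed.

(** The basis is diagonal, so the form has no cross term and the sum over pairs factorises into two
    one-dimensional pair energies, whose normalised parameters multiply to 3/4 X^2. *)
Lemma product_case (G : periodic_conf R 2) (c : R) (A : set 'cV[R]_2) : 0 < c ->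
  products2 R A -> points G = dilate c A -> density G = rho -> hex_minimal alpha rho_gt0 G.
Proof.
move=> c0 [G1 [G2 AE]] pG dG.
have [b1 [t1 [b10 [in1 inj1 sur1]]]] := line_conf_rep G1.
have [b2 [t2 [b20 [in2 inj2 sur2]]]] := line_conf_rep G2.
have N1 := ncosets_gt0 G1; have N2 := ncosets_gt0 G2.
set n1 := ncosets G1 in t1 in1 inj1 sur1 N1 *; set n2 := ncosets G2 in t2 in2 inj2 sur2 N2 *.
pose B := (block_mx (c * b1)%:M 0 0 (c * b2)%:M : 'M[R]_(1 + 1)) : 'M[R]_2.
have [h1 h2 h3 h4] := block2E (c * b1)%:M 0 0 ((c * b2)%:M : 'M[R]_1).
have {}h1 : B 0 0 = c * b1 by rewrite /B h1 mxE.
have {}h2 : B 0 1 = 0 by rewrite /B h2 mxE.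
have {}h3 : B 1 0 = 0 by rewrite /B h3 mxE.
have {}h4 : B 1 1 = c * b2 by rewrite /B h4 mxE.
have dB : \det B = c * b1 * (c * b2) by rewrite det2 h1 h2 h3 h4; ring.
have cb1 : c * b1 != 0 by rewrite mulf_neq0// gt_eqF.
have cb2 : c * b2 != 0 by rewrite mulf_neq0// gt_eqF.
have uB : B \in unitmx by rewrite unitmx_det dB mulf_neq0.
have ptE x y : pt B x y =
    c *: (col_mx (const_mx (b1 * x) : 'cV[R]_1) (const_mx (b2 * y)) : 'cV[R]_(1 + 1)).
  apply/matrixP => i j; rewrite ord1 [LHS]mxE [RHS]mxE.
  have [e0 e1] := col2E (const_mx (b1 * x) : 'cV[R]_1) (const_mx (b2 * y)).
  have [->|->] := ord2P i.
    by rewrite e0 h1 h2 mxE; ring.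
  by rewrite e1 h3 h4 mxE; ring.
pose t (k : 'I_n1 * 'I_n2) := (t1 k.1, t2 k.2).
have rp : rep B t (points G).
  split=> //; rewrite pG AE; split.
  - move=> [[i j] [m n]] _ /=; rewrite ptE; eexists; last by [].
    exists (const_mx (b1 * (m%:~R + t1 i))); first exact: (in1 (i, m)).
    by exists (const_mx (b2 * (n%:~R + t2 j))) => //; exact: (in2 (j, n)).
  - move=> [[i j] [m n]] [[i' j'] [m' n']] _ _ /= /(pt_inj uB) [e1 e2].
    have e1' : const_mx (b1 * (m%:~R + t1 i)) = const_mx (b1 * (m'%:~R + t1 i')) :> 'cV[R]_1.
      by rewrite e1.
    have e2' : const_mx (b2 * (n%:~R + t2 j)) = const_mx (b2 * (n'%:~R + t2 j')) :> 'cV[R]_1.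
      by rewrite e2.
    have [-> ->] := inj1 (i, m) (i', m') (mem_set Logic.I) (mem_set Logic.I) e1'.
    by have [-> ->] := inj2 (j, n) (j', n') (mem_set Logic.I) (mem_set Logic.I) e2'.
  - move=> _ [_ [u /sur1 [[i m] _ /= <-] [v /sur2 [[j n] _ /= <-] <-]] <-].
    by exists ((i, j), (m, n)) => //=; rewrite ptE.
have gB : gramB alpha B = 0 by rewrite /gramB h1 h2 h3 h4; ring.
set s1 := gramA alpha B; set s2 := gramC alpha B.
have s10 : 0 < s1 := gramA_gt0 alpha_gt0 uB.
have s20 : 0 < s2 := gramC_gt0 alpha_gt0 uB.
have D := covolume alpha rho_gt0 rp dG.
rewrite -gram_disc gB expr0n subr0 -/s1 -/s2 card_prod !card_ord natrM in D.
have n10 : n1%:R != 0 :> R by rewrite pnatr_eq0 -lt0n.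
have n20 : n2%:R != 0 :> R by rewrite pnatr_eq0 -lt0n.
apply: (strict_case alpha_gt0 rho_gt0 rp).
have -> : mean_pair alpha B t = pair_energy s1 t1 / n1%:R * (pair_energy s2 t2 / n2%:R).
  rewrite /mean_pair card_prod !card_ord natrM.
  have -> : \sum_i \sum_j lsum alpha B ((t j).1 - (t i).1) ((t j).2 - (t i).2) =
      pair_energy s1 t1 * pair_energy s2 t2.
    under eq_bigr do under eq_bigr do rewrite /lsum gB qsum_diag//.
    rewrite exchange_big /=.
    rewrite -(pair_bigA _ (fun i j => \sum_(k : 'I_n1 * 'I_n2)
      gsum s1 (t1 i - t1 k.1) * gsum s2 (t2 j - t2 k.2)))/=.
    rewrite /pair_energy big_distrlr /=; apply: eq_bigr => i _; apply: eq_bigr => j _.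
    rewrite big_distrlr /= (pair_bigA _ (fun k l => gsum s1 (t1 i - t1 k) * gsum s2 (t2 j - t2 l))).
    by [].
  by field; rewrite n10 n20.
apply: (product_bound (hex_param_gt0 alpha_gt0 rho_gt0) _ _ _
  (pair_energy_bound t1 N1 s10) (pair_energy_bound t2 N2 s20)).
- by rewrite divr_gt0// exprn_gt0// ltr0n.
- by rewrite divr_gt0// exprn_gt0// ltr0n.
- transitivity (s1 * s2 / (n1%:R * n2%:R) ^+ 2); first by field; rewrite n10 n20.
  by rewrite D; field; rewrite n10 n20.
Qed.

End Products.

Theorem corollary1p3 (R : realType) (alpha rho : R)
  (alpha_gt0 : 0 < alpha) (rho_gt0 : 0 < rho) :
  scaled_Xi rho (hexagonal_conf rho_gt0) /\
  forall G : periodic_conf R 2, scaled_Xi rho G ->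
    (energy (gaussian alpha) (hexagonal_conf rho_gt0)
       <= energy (gaussian alpha) G)%E /\
    (energy (gaussian alpha) (hexagonal_conf rho_gt0)
       = energy (gaussian alpha) G ->
     exists2 Q : 'M[R]_2, orthogonal_mx Q &
       points G =
       [set Q *m v | v in dilate (Num.sqrt rho)^-1 (hexagonal_lattice R)]).
Proof.
split=> [|G [dG [c [A [c0 XA pG]]]]]; first exact: hex_conf_scaled.
case: XA => [[[B uB AE]|prodA]|dblA].
- apply: (lattice_case alpha_gt0 rho_gt0 _ _ dG (B := c *: B)).
    by move: uB; rewrite !unitmx_det detZ => d0; rewrite mulf_neq0// expf_neq0// gt_eqF.
  by rewrite lattice_ofZ -AE.
- exact: product_case c0 prodA pG dG.
- exact: doubled_case c0 dblA pG dG.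
Qed.
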